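(* Let $(\mathcal M,\mathbf g,\mathrm W,U)$ be an analytic Riemannian manifold together with a field $\mathrm W$ of $\mathbf g$-symmetric and analytic endomorphisms, with corresponding symmetric bilinear form $\mathrm{II}:=\mathbf g(\mathrm W\cdot,\cdot)$, and an analytic (nowhere vanishing) vector field $U$ satisfying the constraint equation $$\nabla^{\mathbf g}U+u\,\mathrm W=0,\qquad\text{where } u^2=\mathbf g(U,U),\ u>0 .$$ Then, for any positive analytic function $\lambda$ on $\mathbb R\times\mathcal M$, the triple $(\mathbf g_t,U_t,u_t)$ of analytic one-parameter families of Riemannian metrics, vector fields and (positive) functions on $\mathcal M$ defines an analytic Lorentzian metric $$\overline{\mathbf g}=-\lambda^2dt^2+\mathbf g_t$$ on an open neighbourhood $\overline{\mathcal U}$ of $\{0\}\times\mathcal M$ in $\mathbb R\times\mathcal M$ with analytic parallel vector field $$V=\frac{u_t}{\lambda}\partial_t-U_t,$$ if and only if $\mathbf g_t$, $U_t$ and $u_t$ satisfy the following system of PDEs on $\overline{\mathcal U}$, for all $X,Y\in T\mathcal M$, $$\begin{aligned}\ddot{\mathbf g}_t(X,Y)=&\ \frac{\lambda^2}{u_t}\Big(d^{\nabla^t}\!\Big(\frac{\dot{\mathbf g}_t}{\lambda}\Big)(U_t,X,Y)+d^{\nabla^t}\!\Big(\frac{\dot{\mathbf g}_t}{\lambda}\Big)(U_t,Y,X)\Big)+\frac12\dot{\mathbf g}_t(X,\dot{\mathbf g}_t^\sharp(Y))\\&+(\log\lambda)^{\textstyle\cdot}\,\dot{\mathbf g}_t(X,Y)+2\lambda\,\mathrm{Hess}^t(\lambda)(X,Y)+2\frac{\lambda^2}{u_t^2}\mathrm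 R_t(X,U_t,U_t,Y)\\&+\frac1{2u_t^2}\big(\dot{\mathbf g}_t(X,Y)\dot{\mathbf g}_t(U_t,U_t)-\dot{\mathbf g}_t(X,U_t)\dot{\mathbf g}_t(Y,U_t)\big),\end{aligned}$$ $$\begin{aligned}\mathbf g_t(\ddot U_t,X)=&-\frac{\lambda^2}{2u_t}\,d^{\nabla^t}\!\Big(\frac{\dot{\mathbf g}_t}{\lambda}\Big)(U_t,X,U_t)-\frac12(\log\lambda)^{\textstyle\cdot}\,\dot{\mathbf g}_t(U_t,X)-\lambda\,\mathrm{Hess}^t(\lambda)(U_t,X)-\dot{\mathbf g}_t(\dot U_t,X)\\&+u_t\,\mathbf g_t([\partial_t,\mathrm{grad}^t\lambda],X)+\frac{u_t}{2}\dot{\mathbf g}_t(\mathrm{grad}^t\lambda,X)+\big(2\dot u_t-d\lambda(U_t)\big)d\lambda(X),\end{aligned}$$ $$\ddot u_t=\mathbf g_t([\partial_t,\mathrm{grad}^t\lambda],U_t)+2\,d\lambda(\dot U_t)+\frac32\dot{\mathbf g}_t(\mathrm{grad}^t\lambda,U_t)-u_t\|\mathrm{grad}^t\lambda\|^2_{\mathbf g_t},$$ with the initial conditions $$\mathbf g_0=\mathbf g,\quad \dot{\mathbf g}_0=-2\lambda_0\mathrm{II},\quad U_0=U,\quad \dot U_0=u\,\mathrm{grad}^{\mathbf g}(\lambda_0)+\lambda_0\mathrm W(U),\quad u_0=u,\quad \dot u_0=d\lambda_0(U).$$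
   Context: One-parameter families on $\mathcal M$ are regarded as objects on (open subsets of) $\mathbb R\times\mathcal M$ tangential to $\mathcal M$. $\nabla^{\mathbf g}$ and $\nabla^t$ are the Levi-Civita connections of $\mathbf g$ and $\mathbf g_t$; $\mathrm{grad}^t$ and $\mathrm{Hess}^t(f)=\nabla^tdf$ are taken on $\mathcal M$ with respect to $\mathbf g_t$, and $\mathrm R_t(X,Y,Z,W)=\mathbf g_t\big((\nabla^t_X\nabla^t_Y-\nabla^t_Y\nabla^t_X-\nabla^t_{[X,Y]})Z,W\big)$. Dots denote $t$-derivatives: $\dot{\mathbf g}_t=\mathcal L_{\partial_t}\mathbf g_t$ (so $\dot{\mathbf g}_t(X,Y)=\partial_t(\mathbf g_t(X,Y))$ for $t$-independent $X,Y$), $\dot U_t=[\partial_t,U_t]$, $\dot u_t=\partial_tu_t$, $(\log\lambda)^{\cdot}=\partial_t\log\lambda$; $\lambda_0=\lambda(0,\cdot)$. For a symmetric bilinear form $h$, $d^{\nabla}h(X,Y,Z)=(\nabla_Xh)(Y,Z)-(\nabla_Yh)(X,Z)$. $\dot{\mathbf g}_t^\sharp$ is the endomorphism with $\mathbf g_t(X,\dot{\mathbf g}_t^\sharp(Y))=\dot{\mathbf g}_t(X,Y)$. Parallel means $\overline\nabla V=0$ for the Levi-Civita connection $\overline\nabla$ of $\overline{\mathbf g}$. Analytic means real analytic.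
   Formalization: The initial values g_0=g, U_0=U, u_0=u are assumed of the triple throughout (a parallel field alone does not force them), and every connected component of the neighbourhood is assumed to meet {0}×M, since elsewhere the initial conditions say nothing. *)

(* Defs.v *)
From HB Require Import structures.
From mathcomp Require Import all_boot all_order all_algebra.
From mathcomp Require Import all_classical all_reals all_analysis.

Set Implicit Arguments.
Unset Strict Implicit.
Unset Printing Implicit Defensive.

Import Order.TTheory GRing.Theory Num.Theory.
Import numFieldNormedType.Exports.

Local Open Scope classical_set_scope.
Local Open Scope ring_scope.

(* Analytic manifolds are given by an atlas, tensors by their components in
   every chart, subject to the usual transformation laws.  Tangent vectors are
   row vectors, and an endomorphism with matrix W maps v to v *m W. *)

Section Analytic.
Context (R : realType) (m : nat).
Implicit Types (f : 'rV[R]_m -> R) (a x : 'rV[R]_m).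

Definition monomial (N : nat) (alpha : {ffun 'I_m -> 'I_N}) x : R :=
  \prod_(i < m) x 0 i ^+ alpha i.

(* f is the sum, near a, of an absolutely convergent power series in m
   variables; the partial sums range over the cubes {0, ..., N-1}^m. *)
Definition analytic_at f a : Prop :=
  exists (c : ('I_m -> nat) -> R) (r : R), 0 < r /\
  forall x, `|x - a| < r ->
    (exists B : R, forall N : nat,
       \sum_(alpha : {ffun 'I_m -> 'I_N})
          `|c (fun i => nat_of_ord (alpha i)) * monomial alpha (x - a)| <= B) /\
    (fun N : nat => \sum_(alpha : {ffun 'I_m -> 'I_N})
        c (fun i => nat_of_ord (alpha i)) * monomial alpha (x - a)) @ \oo --> f x.

End Analytic.

(* Tensor calculus in a coordinate domain of R^m; only the germs at the point
   of evaluation matter. *)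
Section Coordinates.
Context (R : realType) (m : nat).
Local Notation E := 'rV[R]_m.
Local Notation field := (E -> E).
Local Notation form := (E -> 'M[R]_m).
Implicit Types (g h : form) (X Y Z W : field) (f : E -> R) (x v w : E).

Definition bil (G : 'M[R]_m) v w : R := (v *m G *m w^T) 0 0.

Definition pairing h X Y : E -> R := fun x => bil (h x) (X x) (Y x).

(* The vector Gamma(v, w) with
   2 g(Gamma(v, w), z) = D_v g(w, z) + D_w g(v, z) - D_z g(v, w). *)
Definition christoffel g x v w : E :=
  (\row_l (2^-1 * ('D_v (fun y => bil (g y) w (delta_mx 0 l)) x
                 + 'D_w (fun y => bil (g y) v (delta_mx 0 l)) x
                 - 'D_(delta_mx 0 l) (fun y => bil (g y) v w) x)))
  *m invmx (g x).

(* Levi-Civita connection of g; see nabla_torsion_free, christoffel_metric *)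
Definition nabla g X Y : field :=
  fun x => 'D_(X x) Y x + christoffel g x (X x) (Y x).

Definition lie_bracket X Y : field := fun x => 'D_(X x) Y x - 'D_(Y x) X x.

(* (nabla_X h)(Y, Z) *)
Definition nabla_form g h X Y Z x : R :=
  'D_(X x) (pairing h Y Z) x
  - bil (h x) (nabla g X Y x) (Z x) - bil (h x) (Y x) (nabla g X Z x).

Definition dnabla g h X Y Z x : R :=
  nabla_form g h X Y Z x - nabla_form g h Y X Z x.

Definition grad g f : field :=
  fun x => (\row_j 'D_(delta_mx 0 j) f x) *m invmx (g x).

(* (nabla_X df)(Y) *)
Definition hess g f X Y x : R :=
  'D_(X x) (fun y => 'D_(Y y) f y) x - 'D_(nabla g X Y x) f x.

Definition riem g X Y Z W x : R :=
  bil (g x) (nabla g X (nabla g Y Z) x - nabla g Y (nabla g X Z) x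
             - nabla g (lie_bracket X Y) Z x) (W x).

(* Matrix, in the row vector convention, of the endomorphism of sharpP. *)
Definition sharp (G H : 'M[R]_m) : 'M[R]_m := (invmx G *m H)^T.

Lemma sharpP (G H : 'M[R]_m) v w :
  G \in unitmx -> bil G v (w *m sharp G H) = bil H v w.
Proof.
move=> uG; rewrite /bil /sharp trmx_mul trmxK !mulmxA.
by congr (_ 0 0); rewrite -(mulmxA v G) mulmxV // mulmx1.
Qed.

Lemma gradP g f x v : g x \in unitmx -> differentiable f x ->
  bil (g x) (grad g f x) v = 'D_v f x.
Proof.
move=> ug df; rewrite /bil /grad mulmxKV // mxE [in RHS](row_sum_delta v).
rewrite deriveE // linear_sum /=; apply: eq_bigr => j _.
by rewrite !mxE linearZ /= deriveE // mulrC.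
Qed.

Lemma bil_sym (G : 'M[R]_m) v w : G^T = G -> bil G v w = bil G w v.
Proof.
by move=> sG; rewrite /bil -[v *m G *m w^T]trmxK mxE !trmx_mul trmxK sG mulmxA.
Qed.

Lemma christoffel_sym g x v w : (\forall y \near x, (g y)^T = g y) ->
  christoffel g x v w = christoffel g x w v.
Proof.
move=> sg; rewrite /christoffel; congr (_ *m _); apply/rowP => l; rewrite !mxE.
congr (_ * _); congr (_ - _); first by rewrite addrC.
by apply: near_eq_derive; apply: filterS sg => y; exact: bil_sym.
Qed.

Lemma nabla_torsion_free g X Y x : (\forall y \near x, (g y)^T = g y) ->
  nabla g X Y x - nabla g Y X x = lie_bracket X Y x.
Proof.
move=> sg; rewrite /nabla /lie_bracket (christoffel_sym _ _ sg).
by rewrite opprD addrACA subrr addr0.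
Qed.

Lemma christoffel_metric g x v (i j : 'I_m) :
  g x \in unitmx -> (\forall y \near x, (g y)^T = g y) ->
  'D_v (fun y => g y i j) x =
    bil (g x) (christoffel g x v (delta_mx 0 i)) (delta_mx 0 j)
  + bil (g x) (delta_mx 0 i) (christoffel g x v (delta_mx 0 j)).
Proof.
move=> ug sg.
have bilE v' w' (G : E -> 'M[R]_m) y :
  bil (G y) v' w' = (v' *m G y *m w'^T) 0 0 by [].
have comp v' w' k : bil (g x) (christoffel g x v' w') (delta_mx 0 k) =
    2^-1 * ('D_v' (fun y => bil (g y) w' (delta_mx 0 k)) x
          + 'D_w' (fun y => bil (g y) v' (delta_mx 0 k)) x
          - 'D_(delta_mx 0 k) (fun y => bil (g y) v' w') x).
  by rewrite {1}/bil /christoffel mulmxKV // trmx_delta -colE !mxE.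
have entry k l : 'D_v (fun y => bil (g y) (delta_mx 0 k) (delta_mx 0 l)) x =
    'D_v (fun y => g y k l) x.
  congr ('D_v _ x); apply/funext => y.
  by rewrite bilE trmx_delta -rowE -colE !mxE.
have symD d v' w' : 'D_d (fun y => bil (g y) v' w') x =
    'D_d (fun y => bil (g y) w' v') x.
  by apply: near_eq_derive; apply: filterS sg => y; exact: bil_sym.
rewrite [in X in _ + X]bil_sym; last exact: nbhs_singleton sg.
rewrite !comp !entry.
have -> : 'D_v (fun y => g y j i) x = 'D_v (fun y => g y i j) x.
  by rewrite -!entry; exact: symD.
have avg (a b c : R) : 2^-1 * (a + b - c) + 2^-1 * (a + c - b) = a.
  rewrite -mulrDr -[a + b - c]addrA -[a + c - b]addrA addrACA -(opprB b c).
  by rewrite subrr addr0 -mulr2n -[a *+ 2]mulr_natl mulKf // pnatr_eq0.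
by rewrite avg.
Qed.

End Coordinates.

Section Manifolds.
Context (R : realType).

Record atlas (m : nat) (M : topologicalType) := Atlas {
  chart : Type;
  dom : chart -> set M;
  chart_map : chart -> M -> 'rV[R]_m;
  chart_inv : chart -> 'rV[R]_m -> M }.

Context (m : nat) (M : topologicalType) (A : atlas m M).
Implicit Types (i j : chart A) (p : M) (D : set M) (f : M -> R).

Definition transition i j : 'rV[R]_m -> 'rV[R]_m :=
  fun x => chart_map j (chart_inv i x).

Record analytic_manifold : Prop := AnalyticManifold {
  manifold_hausdorff : hausdorff_space M;
  manifold_second_countable : @second_countable M;
  dom_open : forall i, open (dom i);
  dom_cover : forall p, exists i, dom i p;
  image_open : forall i, open (chart_map i @` dom i);
  chart_mapK : forall i p, dom i p -> chart_inv i (chart_map i p) = p;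
  chart_continuous : forall i, {within dom i, continuous (chart_map i)};
  chart_inv_continuous : forall i,
    {within chart_map i @` dom i, continuous (chart_inv i)};
  transition_analytic : forall i j x k,
    (chart_map i @` (dom i `&` dom j)) x ->
    analytic_at (fun y => transition i j y 0 k) x }.

Definition analytic_function D f : Prop :=
  forall i x, (chart_map i @` (dom i `&` D)) x ->
    analytic_at (fun y => f (chart_inv i y)) x.

Definition analytic_components a b D (T : chart A -> M -> 'M[R]_(a, b)) :=
  forall (i : chart A) k l, forall x, (chart_map i @` (dom i `&` D)) x ->
    analytic_at (fun y => T i (chart_inv i y) k l) x.

(* Coordinate expression of a family of components. *)
Definition local (T : Type) (F : chart A -> M -> T) i : 'rV[R]_m -> T :=
  fun x => F i (chart_inv i x).

(* Differential at p of the change of coordinates. *)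
Definition push i j p (v : 'rV[R]_m) : 'rV[R]_m :=
  'D_v (transition i j) (chart_map i p).

Definition vector_field D (X : chart A -> M -> 'rV[R]_m) : Prop :=
  forall i j p, D p -> dom i p -> dom j p -> X j p = push i j p (X i p).

Definition bilinear_form D (h : chart A -> M -> 'M[R]_m) : Prop :=
  forall i j p v w, D p -> dom i p -> dom j p ->
    bil (h j p) (push i j p v) (push i j p w) = bil (h i p) v w.

Definition endomorphism D (W : chart A -> M -> 'M[R]_m) : Prop :=
  forall i j p v, D p -> dom i p -> dom j p ->
    push i j p (v *m W i p) = push i j p v *m W j p.

Definition riemannian_metric D (g : chart A -> M -> 'M[R]_m) : Prop :=
  bilinear_form D g /\
  forall i p, D p -> dom i p ->
    (g i p)^T = g i p /\ forall v, v != 0 -> 0 < bil (g i p) v v.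

Definition parallel D (g : chart A -> M -> 'M[R]_m)
    (V : chart A -> M -> 'rV[R]_m) : Prop :=
  forall i p v, D p -> dom i p ->
    nabla (local g i) (cst v) (local V i) (chart_map i p) = 0.

End Manifolds.

(* Signature (-, +, ..., +): some basis of every tangent space is orthonormal
   in the Lorentzian sense. *)
Definition lorentzian_metric (R : realType) (n : nat) (M : topologicalType)
    (A : atlas R (1 + n) M) (D : set M) (g : chart A -> M -> 'M[R]_(1 + n)) :=
  bilinear_form D g /\
  forall i p, D p -> dom i p ->
    (g i p)^T = g i p /\
    exists2 P : 'M[R]_(1 + n), P \in unitmx &
      P *m g i p *m P^T = block_mx (- 1)%:M 0 0 1%:M.

Section Cylinder.
Context (R : realType) (n : nat) (M : topologicalType) (A : atlas R n M).

(* The product atlas of R x M. *)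
Definition cylinder : atlas R (1 + n) (R * M)%type :=
  {| chart := chart A;
     dom := fun i => [set q | dom i q.2];
     chart_map := fun i q => row_mx q.1%:M (chart_map i q.2);
     chart_inv := fun i z => (lsubmx z 0 0, chart_inv i (rsubmx z)) |}.

(* - lambda^2 dt^2 + g_t *)
Definition spacetime_metric (lambda : R * M -> R)
    (gt : R -> chart A -> M -> 'M[R]_n) :
    chart cylinder -> R * M -> 'M[R]_(1 + n) :=
  fun i q => block_mx (- lambda q ^+ 2)%:M 0 0 (gt q.1 i q.2).

(* (u_t / lambda) d/dt - U_t *)
Definition spacetime_field (lambda ut : R * M -> R)
    (Ut : R -> chart A -> M -> 'rV[R]_n) :
    chart cylinder -> R * M -> 'rV[R]_(1 + n) :=
  fun i q => row_mx (ut q / lambda q)%:M (- Ut q.1 i q.2).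

Definition slice (D : set (R * M)) (t : R) : set M := [set p | D (t, p)].

(* Analytic one-parameter families of Riemannian metrics, vector fields and
   positive functions on the open set D of R x M. *)
Definition metric_family (D : set (R * M))
    (gt : R -> chart A -> M -> 'M[R]_n) : Prop :=
  (forall t, riemannian_metric (slice D t) (gt t)) /\
  @analytic_components _ _ _ cylinder _ _ D (fun i q => gt q.1 i q.2).

Definition vector_family (D : set (R * M))
    (Ut : R -> chart A -> M -> 'rV[R]_n) : Prop :=
  (forall t, vector_field (slice D t) (Ut t)) /\
  @analytic_components _ _ _ cylinder _ _ D (fun i q => Ut q.1 i q.2).

Definition positive_family (D : set (R * M)) (ut : R * M -> R) : Prop :=
  (forall q, D q -> 0 < ut q) /\ analytic_function cylinder D ut.

End Cylinder.

(* The evolution equations at time t and at the point of coordinates x; g, U,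
   u, lambda are the coordinate expressions of the four families.  The tangent
   vectors X, Y are extended by constant components, all terms being
   tensorial. *)
Section Evolution.
Context (R : realType) (n : nat).
Local Notation E := 'rV[R]_n.

(* For a time-dependent vector field F, [d/dt, F] has components dF^k/dt. *)
Definition dot (T : normedModType R) (F : R -> E -> T) : R -> E -> T :=
  fun t x => derive1 (fun s => F s x) t.

Context (g : R -> E -> 'M[R]_n) (U : R -> E -> E) (u lambda : R -> E -> R).
Context (t : R) (x : E).

Let dlambda (v : E) : R := 'D_v (lambda t) x.
Let dotlog : R := dot (fun s y => ln (lambda s y)) t x.
Let gradl : R -> E -> E := fun s => grad (g s) (lambda s).
Let dotg : 'M[R]_n := dot g t x.

(* d^nabla (dotg / lambda) *)
Let dg (X Y Z : E -> E) : R :=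
  dnabla (g t) (fun y => (lambda t y)^-1 *: dot g t y) X Y Z x.

Definition metric_equation (X Y : E) : Prop :=
  bil (dot (dot g) t x) X Y =
    lambda t x ^+ 2 / u t x
      * (dg (U t) (cst X) (cst Y) + dg (U t) (cst Y) (cst X))
  + 2^-1 * bil dotg X (Y *m sharp (g t x) dotg)
  + dotlog * bil dotg X Y
  + 2 * lambda t x * hess (g t) (lambda t) (cst X) (cst Y) x
  + 2 * (lambda t x ^+ 2 / u t x ^+ 2)
      * riem (g t) (cst X) (U t) (U t) (cst Y) x
  + (2 * u t x ^+ 2)^-1
      * (bil dotg X Y * bil dotg (U t x) (U t x)
         - bil dotg X (U t x) * bil dotg Y (U t x)).

Definition vector_equation (X : E) : Prop :=
  bil (g t x) (dot (dot U) t x) X =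
  - (lambda t x ^+ 2 / (2 * u t x)) * dg (U t) (cst X) (U t)
  - 2^-1 * dotlog * bil dotg (U t x) X
  - lambda t x * hess (g t) (lambda t) (U t) (cst X) x
  - bil dotg (dot U t x) X
  + u t x * bil (g t x) (dot gradl t x) X
  + u t x / 2 * bil dotg (gradl t x) X
  + (2 * dot u t x - dlambda (U t x)) * dlambda X.

Definition function_equation : Prop :=
  dot (dot u) t x =
    bil (g t x) (dot gradl t x) (U t x)
  + 2 * dlambda (dot U t x)
  + 3 / 2 * bil dotg (gradl t x) (U t x)
  - u t x * bil (g t x) (gradl t x) (gradl t x).

End Evolution.

Section System.
Context (R : realType) (n : nat) (M : topologicalType) (A : atlas R n M).
Context (gt : R -> chart A -> M -> 'M[R]_n).
Context (Ut : R -> chart A -> M -> 'rV[R]_n).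
Context (ut lambda : R * M -> R).

Definition evolution_system (D : set (R * M)) : Prop :=
  forall (i : chart A) (t : R) (p : M), D (t, p) -> dom i p ->
    let gi := fun s => local (gt s) i in
    let Ui := fun s => local (Ut s) i in
    let ui := fun s y => ut (s, chart_inv i y) in
    let li := fun s y => lambda (s, chart_inv i y) in
    (forall X Y, metric_equation gi Ui ui li t (chart_map i p) X Y) /\
    (forall X, vector_equation gi Ui ui li t (chart_map i p) X) /\
    function_equation gi Ui ui li t (chart_map i p).

Context (g W : chart A -> M -> 'M[R]_n) (U : chart A -> M -> 'rV[R]_n).
Context (u : M -> R).

(* (g_0, U_0, u_0) = (g, U, u) *)
Definition initial_values : Prop :=
  forall (i : chart A) (p : M), dom i p ->
    gt 0 i p = g i p /\ Ut 0 i p = U i p /\ ut (0, p) = u p.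

(* The matrix of II = g(W., .) is W *m g. *)
Definition initial_velocities : Prop :=
  forall (i : chart A) (p : M), dom i p ->
    let lambda0 := fun y => lambda (0, chart_inv i y) in
    derive1 (fun s => gt s i p) 0 = - 2 * lambda (0, p) *: (W i p *m g i p) /\
    derive1 (fun s => Ut s i p) 0 =
      u p *: grad (local g i) lambda0 (chart_map i p)
      + lambda (0, p) *: (U i p *m W i p) /\
    derive1 (fun s => ut (s, p)) 0 = 'D_(U i p) lambda0 (chart_map i p).

End System.

(* Main.v *)
(* In a chart, V is parallel iff the following four defects vanish:
     A_X = nabla^t_X U_t - (u_t / 2 lambda) g_t'^#(X),
     B_X = du_t(X) - g_t'(X, U_t) / (2 lambda),
     c   = u_t' - d lambda(U_t),
     C   = U_t' - u_t grad^t lambda + g_t'^#(U_t) / 2.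
   The t-derivatives of A, B, c, C are linear in A, B, c, C and the spatial
   derivatives of A, c, C, up to inhomogeneous terms that are combinations of the
   three evolution equations.  So a parallel V gives the equations.  Conversely
   the equations make (A, B, c, C) a solution of a homogeneous linear first-order
   system, and the constraint with the initial velocities says that it is 0 at
   t = 0; all its t-derivatives then vanish there, and by analyticity so does
   (A, B, c, C) near t = 0.  Parallelism does not depend on the chart, hence the
   identity theorem propagates it along the components of the domain, all of
   which meet t = 0. *)

Require Import Defs.
From HB Require Import structures.
From mathcomp Require Import all_boot all_order all_algebra.
From mathcomp Require Import all_classical all_reals all_analysis.
From mathcomp Require Import ring lra.

Set Implicit Arguments.
Unset Strict Implicit.
Unset Printing Implicit Defensive.

Import Order.TTheory GRing.Theory Num.Theory.
Import numFieldNormedType.Exports.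

Local Open Scope classical_set_scope.
Local Open Scope ring_scope.

(** * Power series as sums of homogeneous polynomials *)

(** Analyticity is handled through homogeneous parts: [expands] keeps polynomials [P k] of degree k
    with coefficient bound M K^k, so that products, reciprocals and derivatives only change M and K;
    the cubic sums of [analytic_at] are converted once, in [analytic_atE]. The obstacle in the
    converse is that the system for (A, B, c, C) contains spatial derivatives, so uniqueness for
    ordinary differential equations does not apply. [flat] gets around it: derivatives along t = 0
    keep the order of vanishing, so defects that are flat of order k have t-derivatives flat of
    order k, and are then flat of order k + 1. The curvature term of the first equation is absorbed
    by R(X, U)U = (nabla_X N)U - (nabla_U N)X with N = nabla U = A + (u / 2 lambda) g'^#, which
    turns R into derivatives of A, terms in du (compared with g' by B) and d^nabla (g' / lambda).
    The t-derivative of B closes up because R(X, U, U, U) = 0. Between charts no power series are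
    composed: parallelism is transported pointwise, by naturality of the Levi-Civita connection. *)

Section HomogeneousPolynomials.
Context (R : realType) (m : nat).
Local Notation E := 'rV[R]_m.
Implicit Types (P Q : E -> R) (v x h : E) (k l : nat) (M N : R).

(* hpoly k M P: P is a homogeneous polynomial function of degree k whose
   coefficients have absolute sum at most M. *)
Inductive hpoly : nat -> R -> (E -> R) -> Prop :=
| hpoly_const (c : R) : hpoly 0 `|c| (fun=> c)
| hpolyX k M P (i : 'I_m) : hpoly k M P -> hpoly k.+1 M (fun v => v 0 i * P v)
| hpoly0 k : hpoly k 0 (fun=> 0)
| hpolyD k M N P Q : hpoly k M P -> hpoly k N Q ->
    hpoly k (M + N) (fun v => P v + Q v)
| hpoly_weaken k M N P : M <= N -> hpoly k M P -> hpoly k N P.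

Lemma eq_le_real (a b : R) : a = b -> a <= b.
Proof. by move=> ->. Qed.

Lemma hpoly_ge0 k M P : hpoly k M P -> 0 <= M.
Proof.
elim=> //= {k M P}.
- by move=> k M N P Q _ M0 _ N0; exact: addr_ge0.
- by move=> k M N P MN _ M0; exact: le_trans MN.
Qed.

Lemma rV_norm_ge v i : `|v 0 i| <= `|v|.
Proof.
rewrite [leRHS]/Num.Def.normr/= mx_normrE.
by apply: le_trans; last exact: (le_bigmax _ _ (0, i)).
Qed.

Lemma hpoly_bound k M P : hpoly k M P -> forall v, `|P v| <= M * `|v| ^+ k.
Proof.
elim=> {k M P}.
- by move=> c v; rewrite expr0 mulr1.
- move=> k M P i hP ih v; rewrite normrM exprS mulrCA.
  by apply: ler_pM => //; exact: rV_norm_ge.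
- by move=> k v; rewrite normr0 mul0r.
- move=> k M N P Q _ ihP _ ihQ v; rewrite mulrDl.
  by apply: (le_trans (ler_normD _ _)); exact: lerD.
- move=> k M N P MN _ ih v; apply: (le_trans (ih v)).
  by apply: ler_wpM2r => //; exact: exprn_ge0.
Qed.

Lemma hpoly_eq k M N P Q : hpoly k M P -> M = N -> P =1 Q -> hpoly k N Q.
Proof. by move=> hP <- /funext <-. Qed.

Lemma hpolyZ c k M P : hpoly k M P -> hpoly k (`|c| * M) (fun v => c * P v).
Proof.
elim=> {k M P}.
- by move=> d; apply: hpoly_eq (hpoly_const (c * d)) _ _ => //; rewrite normrM.
- move=> k M P i _ ih; apply: hpoly_eq (hpolyX i ih) _ _ => // v.
  by rewrite mulrCA.
- by move=> k; apply: hpoly_eq (hpoly0 k) _ _ => [|v]; rewrite mulr0.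
- move=> k M N P Q _ ihP _ ihQ; apply: hpoly_eq (hpolyD ihP ihQ) _ _ => [|v];
  by rewrite mulrDr.
- by move=> k M N P MN _; apply: hpoly_weaken; exact: ler_wpM2l.
Qed.

Lemma hpolyM k l M N P Q : hpoly k M P -> hpoly l N Q ->
  hpoly (k + l) (M * N) (fun v => P v * Q v).
Proof.
move=> hP hQ; elim: hP => {k M P}.
- by move=> c; exact: hpolyZ.
- move=> k M P i _ ih; rewrite addSn.
  by apply: hpoly_eq (hpolyX i ih) _ _ => // v; rewrite mulrA.
- by move=> k; apply: hpoly_eq (hpoly0 _) _ _ => [|v]; rewrite mul0r.
- move=> k M M' P P' _ ih _ ih'; apply: hpoly_eq (hpolyD ih ih') _ _ => [|v];
  by rewrite mulrDl.
- move=> k M M' P MM' _; apply: hpoly_weaken; apply: ler_wpM2r => //.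
  exact: hpoly_ge0 hQ.
Qed.

Lemma hpoly_sum (I : Type) (s : seq I) (C : pred I) k (M : I -> R)
    (P : I -> E -> R) : (forall i, C i -> hpoly k (M i) (P i)) ->
  hpoly k (\sum_(i <- s | C i) M i) (fun v => \sum_(i <- s | C i) P i v).
Proof.
move=> hP; elim: s => [|i s ih].
  by apply: hpoly_eq (hpoly0 k) _ _ => [|v]; rewrite big_nil.
have [Ci|nCi] := boolP (C i).
  apply: hpoly_eq (hpolyD (hP i Ci) ih) _ _ => [|v];
  by rewrite big_cons Ci.
by apply: hpoly_eq ih _ _ => [|v]; rewrite big_cons (negPf nCi).
Qed.

Lemma derive_coor i v x : 'D_v (fun w : E => w 0 i) x = v 0 i.
Proof.
have /derive_mx : derivable (@id E) x v by exact: derivable_id.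
by rewrite derive_id => /rowP/(_ i); rewrite mxE.
Qed.

Lemma hpoly_differentiable k M P : hpoly k M P -> forall x, differentiable P x.
Proof.
elim=> {k M P} //.
- move=> k M P i _ ih x.
  by apply: differentiableM => //; exact: differentiable_coord.
- by move=> k M N P Q _ ihP _ ihQ x; exact: differentiableD.
Qed.

Lemma derive_hpolyX k M P i v x : hpoly k M P ->
  'D_v (fun w : E => w 0 i * P w) x = v 0 i * P x + x 0 i * 'D_v P x.
Proof.
move=> hP; rewrite [LHS]deriveM.
- by rewrite derive_coor addrC /GRing.scale /= [P x * _]mulrC.
- by apply: diff_derivable; exact: differentiable_coord.
- by apply: diff_derivable; exact: hpoly_differentiable hP _.
Qed.

Lemma derive_hpolyD k l M N P Q v x : hpoly k M P -> hpoly l N Q ->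
  'D_v (fun w => P w + Q w) x = 'D_v P x + 'D_v Q x.
Proof.
move=> hP hQ; rewrite [LHS]deriveD //; apply: diff_derivable.
- exact: hpoly_differentiable hP _.
- exact: hpoly_differentiable hQ _.
Qed.

Lemma delta_le1 (i j : 'I_m) : `|(delta_mx 0 i : E) 0 j| <= 1.
Proof. by rewrite mxE; case: (_ && _); rewrite ?normr1 ?normr0 ?ler01. Qed.

Lemma hpoly_derive k M P : hpoly k M P ->
  forall i, hpoly k.-1 (k%:R * M) ('D_(delta_mx 0 i) P).
Proof.
move=> hP i; elim: hP => {k M P}.
- move=> c; apply: hpoly_eq (hpoly0 _) _ _ => [|v]; first by rewrite mul0r.
  by rewrite derive_cst.
- move=> k M P j hP ih.
  have -> : 'D_(delta_mx 0 i) (fun v : E => v 0 j * P v) =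
     (fun v => (delta_mx 0 i : E) 0 j * P v + v 0 j * 'D_(delta_mx 0 i) P v).
    by apply/funext => v; exact: derive_hpolyX hP.
  rewrite -natr1 mulrDl mul1r addrC; apply: hpolyD.
    apply: hpoly_weaken (hpolyZ _ hP); rewrite -[leRHS]mul1r.
    by apply: ler_wpM2r; [exact: hpoly_ge0 hP|exact: delta_le1].
  (* In degree 0 multiplying by a coordinate would not restore the degree lost by [k.-1]; but there
     the bound [0 * M] forces the derivative of P to vanish. *)
  case: k hP ih => [|k] hP ih; last exact: hpolyX.
  apply: hpoly_eq (hpoly0 _) _ _ => [|v]; first by rewrite mul0r.
  have := hpoly_bound ih v; rewrite !mul0r normr_le0 => /eqP ->.
  by rewrite mulr0.
- move=> k; apply: hpoly_eq (hpoly0 _) _ _ => [|v]; first by rewrite mulr0.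
  by rewrite derive_cst.
- move=> k M N P Q hP ihP hQ ihQ; rewrite mulrDr.
  apply: hpoly_eq (hpolyD ihP ihQ) _ _ => // v.
  by rewrite (derive_hpolyD _ _ hP hQ).
- by move=> k M N P MN _; apply: hpoly_weaken; exact: ler_wpM2l.
Qed.

Lemma hpoly_deriveC k M P : hpoly k M P -> forall i j x,
  'D_(delta_mx 0 i) ('D_(delta_mx 0 j) P) x =
  'D_(delta_mx 0 j) ('D_(delta_mx 0 i) P) x.
Proof.
have cst0 (c : R) (v w : E) x : 'D_v ('D_w (fun=> c)) x = 0.
  have -> : 'D_w (fun=> c) = (fun=> 0) :> (E -> R).
    by apply/funext => y; rewrite derive_cst.
  by rewrite derive_cst.
elim=> {k M P}.
- by move=> c i j x; rewrite !cst0.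
- move=> k M P l hP ih i j x.
  have D2 i' j' : 'D_(delta_mx 0 i') ('D_(delta_mx 0 j') (fun v : E => v 0 l * P v)) x =
      (delta_mx 0 j' : E) 0 l * 'D_(delta_mx 0 i') P x
      + ((delta_mx 0 i' : E) 0 l * 'D_(delta_mx 0 j') P x
      + x 0 l * 'D_(delta_mx 0 i') ('D_(delta_mx 0 j') P) x).
    have -> : 'D_(delta_mx 0 j') (fun v : E => v 0 l * P v) =
     (fun v => (delta_mx 0 j' : E) 0 l * P v + v 0 l * 'D_(delta_mx 0 j') P v).
      by apply/funext => v; exact: derive_hpolyX hP.
    rewrite (derive_hpolyD _ _ (hpolyZ _ hP) (hpolyX l (hpoly_derive hP j'))).
    rewrite (derive_hpolyX _ _ _ (hpoly_derive hP j')).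
    congr (_ + _).
    rewrite [LHS]deriveMl //.
    by apply: diff_derivable; exact: hpoly_differentiable hP _.
  rewrite !D2 ih; ring.
- by move=> k i j x; rewrite !cst0.
- move=> k M N P Q hP ihP hQ ihQ i j x.
  have DD i' : 'D_(delta_mx 0 i') (fun v => P v + Q v) =
     (fun v => 'D_(delta_mx 0 i') P v + 'D_(delta_mx 0 i') Q v).
    by apply/funext => v; rewrite (derive_hpolyD _ _ hP hQ).
  rewrite !DD.
  rewrite (derive_hpolyD _ _ (hpoly_derive hP j) (hpoly_derive hQ j)).
  rewrite (derive_hpolyD _ _ (hpoly_derive hP i) (hpoly_derive hQ i)).
  by rewrite ihP ihQ.
- by [].
Qed.

Lemma hpoly_euler k M P : hpoly k M P -> forall v, 'D_v P v = k%:R * P v.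
Proof.
elim=> {k M P}.
- by move=> c v; rewrite derive_cst mul0r.
- by move=> k M P i hP ih v; rewrite (derive_hpolyX _ _ _ hP) ih -natr1; ring.
- by move=> k v; rewrite derive_cst mulr0.
- move=> k M N P Q hP ihP hQ ihQ v.
  by rewrite (derive_hpolyD _ _ hP hQ) ihP ihQ mulrDr.
- by [].
Qed.

Lemma derive_partials f x v : differentiable f x ->
  'D_v f x = \sum_(i < m) v 0 i * 'D_(delta_mx 0 i) f x :> R.
Proof.
move=> df; rewrite {1}[v]row_sum_delta deriveE // linear_sum /=.
by apply: eq_bigr => i _; rewrite linearZ /= deriveE.
Qed.

(* The value, the linear part and the remainder of x |-> P (x + h) have
   majorants a, b s, d s^2 with s = |h| / delta, and a + b + d is
   submultiplicative. *)
Lemma hpoly_taylor_split k M P (rho delta : R) v h : hpoly k M P ->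
  0 <= rho -> 0 < delta -> `|v| <= rho -> `|h| <= delta ->
  exists a b d : R, [/\ 0 <= a, 0 <= b & 0 <= d] /\
  [/\ a + b + d <= M * (rho + delta) ^+ k, `|P v| <= a,
   `|'D_h P v| <= b * (`|h| / delta) &
   `|P (v + h) - P v - 'D_h P v| <= d * (`|h| / delta) ^+ 2].
Proof.
move=> hP rho0 delta0 vrho hdelta.
set s : R := `|h| / delta.
have s0 : 0 <= s by rewrite divr_ge0 // ltW.
have s1 : s <= 1 by rewrite ler_pdivrMr // mul1r.
have hs : `|h| = delta * s by rewrite mulrC divfK ?gt_eqF.
clearbody s; elim: hP => {k M P}.
- move=> c; exists `|c|, 0, 0; split=> //; split=> //.
  + by rewrite !addr0 expr0 mulr1.
  + by rewrite derive_cst normr0 mul0r.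
  + by rewrite derive_cst subrr subr0 normr0 mul0r.
- move=> k M P i hP [a [b [d [[a0 b0 d0] [abd Pa Db rd]]]]].
  have vi : `|v 0 i| <= rho by exact: le_trans (rV_norm_ge _ _) vrho.
  have hi : `|h 0 i| <= delta * s.
    by rewrite -hs; exact: rV_norm_ge.
  have delta0' := ltW delta0.
  exists (rho * a), (delta * a + rho * b), (rho * d + delta * b + delta * d).
  split; first by rewrite !addr_ge0 ?mulr_ge0.
  split.
  + rewrite exprS mulrCA.
    apply: le_trans (_ : (rho + delta) * (a + b + d) <= _); last first.
      by apply: ler_wpM2l => //; rewrite addr_ge0.
    by apply: eq_le_real; ring.
  + by rewrite normrM ler_pM.
  + rewrite (derive_hpolyX _ _ _ hP) mulrDl.
    apply: (le_trans (ler_normD _ _)); rewrite !normrM lerD //.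
      by rewrite mulrAC ler_pM.
    by rewrite -mulrA ler_pM.
  + rewrite (derive_hpolyX _ _ _ hP) [(v + h) 0 i]mxE.
    set r := P (v + h) - P v - 'D_h P v in rd.
    have -> : (v 0 i + h 0 i) * P (v + h) - v 0 i * P v
       - (h 0 i * P v + v 0 i * 'D_h P v) =
       v 0 i * r + h 0 i * 'D_h P v + h 0 i * r by rewrite /r; ring.
    rewrite !mulrDl; apply: (le_trans (ler_normD _ _)); rewrite lerD //.
      apply: (le_trans (ler_normD _ _)); rewrite !normrM lerD //.
        by rewrite -mulrA ler_pM.
      rewrite [leRHS](_ : _ = (delta * s) * (b * s)); last by ring.
      by rewrite ler_pM.
    apply: le_trans (_ : (delta * s) * (d * s ^+ 2) <= _).
      by rewrite normrM ler_pM.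
    rewrite (_ : delta * s * _ = s * (delta * d * s ^+ 2)); last by ring.
    by rewrite ler_piMl // !mulr_ge0 ?exprn_ge0.
- move=> k; exists 0, 0, 0; split=> //.
  by rewrite !derive_cst !addr0 !subr0 !normr0 !mul0r.
- move=> k M N P Q hP [a [b [d [[a0 b0 d0] [abd Pa Db rd]]]]].
  move=> hQ [a' [b' [d' [[a0' b0' d0'] [abd' Pa' Db' rd']]]]].
  exists (a + a'), (b + b'), (d + d'); split; first by rewrite !addr_ge0.
  rewrite (derive_hpolyD _ _ hP hQ) !mulrDl; split.
  + by apply: le_trans (lerD abd abd'); apply: eq_le_real; ring.
  + exact: le_trans (ler_normD _ _) (lerD _ _).
  + exact: le_trans (ler_normD _ _) (lerD _ _).
  + rewrite (_ : _ - _ = (P (v + h) - P v - 'D_h P v)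
      + (Q (v + h) - Q v - 'D_h Q v)); last by ring.
    exact: le_trans (ler_normD _ _) (lerD _ _).
- move=> k M N P MN _ [a [b [d [abd0 [abd Pa Db rd]]]]]; exists a, b, d.
  split=> //; split=> //; apply: (le_trans abd).
  by apply: ler_wpM2r => //; rewrite exprn_ge0 // addr_ge0 // ltW.
Qed.

Lemma hpoly_taylor k M P (rho delta : R) v h : hpoly k M P ->
  0 <= rho -> 0 < delta -> `|v| <= rho -> `|h| <= delta ->
  `|P (v + h) - P v - 'D_h P v| <=
    M * (rho + delta) ^+ k * (`|h| / delta) ^+ 2.
Proof.
move=> hP r0 d0 vr hd.
have [a [b [d [[a0 b0 d0'] [abd _ _ rd]]]]] := hpoly_taylor_split hP r0 d0 vr hd.
apply: (le_trans rd); apply: ler_wpM2r; first exact: sqr_ge0.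
by apply: le_trans abd; rewrite ler_wpDl // addr_ge0.
Qed.

End HomogeneousPolynomials.

(** * Geometric estimates and the Cauchy product of real series *)

Section RealSeries.
Context (R : realType).
Implicit Types (p q : nat -> R) (M x : R).

Lemma sum_geometric_le x N : 0 <= x -> x <= 2^-1 ->
  \sum_(0 <= k < N) x ^+ k <= 2.
Proof.
move=> x0 x1; have x2 : x < 1 by lra.
have h : (1 - x) * \sum_(0 <= k < N) x ^+ k = 1 - x ^+ N.
  rewrite big_mkord; elim: N => [|N ih]; first by rewrite big_ord0 mulr0 expr0 subrr.
  by rewrite big_ord_recr /= mulrDr ih exprS; ring.
have xN : 0 <= x ^+ N by exact: exprn_ge0.
have S0 : 0 <= \sum_(0 <= k < N) x ^+ k.
  by apply: sumr_ge0 => k _; exact: exprn_ge0.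
nra.
Qed.

Lemma cvg_series_dominated p M x : (forall k, `|p k| <= M * x ^+ k) ->
  0 <= x -> x < 1 -> cvgn (series p).
Proof.
move=> pM x0 x1; apply: (@normed_cvg _ R^o).
apply: (@series_le_cvg _ _ (geometric M x)) => //.
- by move=> k /=; exact: normr_ge0.
- by move=> k; exact: le_trans (normr_ge0 _) (pM k).
- by apply: is_cvg_geometric_series; rewrite ger0_norm.
Qed.

Lemma cvg_half (C : R) : (fun N => C * 2^-1 ^+ N) @ \oo --> (0 : R).
Proof.
by have := @cvg_geometric R C (2^-1); apply; rewrite ger0_norm ?invr_ge0 //; lra.
Qed.

Lemma sum_triangle p q N :
  \sum_(0 <= k < N) \sum_(0 <= j < k.+1) p j * q (k - j)%N =
  \sum_(0 <= j < N) p j * \sum_(0 <= l < N - j) q l.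
Proof.
elim: N => [|N ih]; first by rewrite !big_geq.
rewrite big_nat_recr //= ih [RHS]big_nat_recr //= subSnn big_nat1.
rewrite [in LHS]big_nat_recr //= subnn addrA; congr (_ + _).
rewrite -big_split /=; apply: eq_big_nat => j /andP[_ jN].
by rewrite subSn ?big_nat_recr ?mulrDr // ltnW.
Qed.

(* The two summands differ by the terms p_j q_l with j + l >= N. *)
Lemma cauchy_product_diff p q M M' N : 0 <= M -> 0 <= M' ->
  (forall k, `|p k| <= M * 4^-1 ^+ k) -> (forall k, `|q k| <= M' * 2^-1 ^+ k) ->
  `|(\sum_(0 <= j < N) p j) * (\sum_(0 <= l < N) q l)
    - \sum_(0 <= k < N) \sum_(0 <= j < k.+1) p j * q (k - j)%N|
  <= 4 * M * M' * 2^-1 ^+ N.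
Proof.
move=> M0 M'0 pM qM; rewrite sum_triangle mulr_suml -sumrB.
have h0 (k : nat) : 0 <= 2^-1 ^+ k :> R by rewrite exprn_ge0 // invr_ge0.
apply: (le_trans (ler_norm_sum _ _ _)).
apply: le_trans (_ : \sum_(0 <= j < N)
   (M * 4^-1 ^+ j) * (2 * M' * 2^-1 ^+ (N - j)) <= _).
  rewrite big_nat_cond [leRHS]big_nat_cond; apply: ler_sum => j /andP[/= jN _].
  rewrite -mulrBr normrM ler_pM //.
  rewrite (@big_cat_nat _ _ _ (N - j)%N 0 N) //= ?leq_subr //.
  rewrite [X in `|X|]addrAC subrr add0r -{1}[(N - j)%N]add0n.
  rewrite big_addn subKn ?(ltnW jN) //.
  apply: (le_trans (ler_norm_sum _ _ _)).
  apply: le_trans (_ : \sum_(0 <= i < j) (M' * 2^-1 ^+ (N - j)) * 2^-1 ^+ i <= _).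
    by apply: ler_sum => i _; rewrite -mulrA -exprD addnC; exact: qM.
  rewrite -mulr_sumr [leRHS](_ : _ = M' * 2^-1 ^+ (N - j) * 2); last by ring.
  by rewrite ler_wpM2l ?mulr_ge0 // sum_geometric_le // ?invr_ge0.
apply: le_trans (_ : \sum_(0 <= j < N)
    (2 * M * M' * 2^-1 ^+ N) * 2^-1 ^+ j <= _).
  rewrite big_nat_cond [leRHS]big_nat_cond; apply: ler_sum => j /andP[/= jN _].
  rewrite -[in leRHS](subnK (ltnW jN)) exprD (_ : 4^-1 = 2^-1 * 2^-1); last by field.
  by rewrite exprMn; apply: eq_le_real; ring.
rewrite -mulr_sumr (_ : 4 * M * M' * _ = (2 * M * M' * 2^-1 ^+ N) * 2); last by ring.
by rewrite ler_wpM2l ?mulr_ge0 // sum_geometric_le // ?invr_ge0.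
Qed.

(** The ratios 1/4 and 1/2 are unequal on purpose: row j of the tail is at most 2 M M' 4^-j 2^-(N -
    j) = 2 M M' 2^-N 2^-j, so the rows sum to a multiple of 2^-N without a factor N. *)
Lemma cvg_cauchy_product p q M M' (s t : R) : 0 <= M -> 0 <= M' ->
  (forall k, `|p k| <= M * 4^-1 ^+ k) -> (forall k, `|q k| <= M' * 2^-1 ^+ k) ->
  series p @ \oo --> s -> series q @ \oo --> t ->
  series (fun k => \sum_(0 <= j < k.+1) p j * q (k - j)%N) @ \oo --> s * t.
Proof.
move=> M0 M'0 pM qM ps qt.
set c := series _.
have -> : c = (fun N => series p N * series q N)
     - (fun N => series p N * series q N - c N).
  by apply/funext => N /=; rewrite !fctE opprB addrC subrK.
rewrite -[s * t]subr0; apply: cvgB; first exact: cvgM.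
apply/norm_cvg0P; apply: (@squeeze_cvgr _ _ _ _ (fun=> 0)
   (fun N => 4 * M * M' * 2^-1 ^+ N)).
- apply: nearW => N /=; rewrite normr_ge0 /=.
  exact: cauchy_product_diff.
- exact: cvg_cst.
- exact: cvg_half.
Qed.

End RealSeries.

(** * Analytic germs: constants, sums and products *)

Section Expansions.
Context (R : realType) (m : nat).
Local Notation E := 'rV[R]_m.
Implicit Types (f g : E -> R) (P Q : nat -> E -> R) (a v x h : E) (M K r : R).

(** K controls the coefficients, and r only the ball on which the sum is known to be f; r can
    therefore be shrunk until K r is as small as an estimate requires ([expands_small]). *)
Definition expands f a P M K r :=
  [/\ 0 < K, 0 < r, forall k, hpoly k (M * K ^+ k) (P k) &
      forall v, `|v| < r -> series (fun k => P k v) @ \oo --> f (a + v)].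

Definition analytic_germ f a := exists P M K r, expands f a P M K r.

Lemma expands_ge0 f a P M K r : expands f a P M K r -> 0 <= M.
Proof. by case=> _ _ /(_ 0) /hpoly_ge0; rewrite expr0 mulr1. Qed.

Lemma expands_shrink f a P M K r M' K' r' : expands f a P M K r ->
  M <= M' -> K <= K' -> 0 < r' -> r' <= r -> expands f a P M' K' r'.
Proof.
move=> ex MM' KK' r'0 r'r; have M0 := expands_ge0 ex.
case: ex => K0 r0 hP cP; split=> //.
- exact: lt_le_trans KK'.
- move=> k; apply: hpoly_weaken (hP k); apply: ler_pM => //.
  + by apply: exprn_ge0; exact: ltW.
  + by apply: lerXn2r => //; rewrite nnegrE ltW // (lt_le_trans K0).
- by move=> v vr; apply: cP; exact: lt_le_trans r'r.
Qed.

Lemma expands_small f a P M K r (e : R) : 0 < e -> expands f a P M K r ->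
  exists2 r', expands f a P M K r' & K * r' <= e.
Proof.
move=> e0 ex; have [K0 r0 _ _] := ex.
exists (Num.min r (e / K)).
  apply: (expands_shrink ex) => //; last by rewrite ge_min lexx.
  by rewrite lt_min r0 divr_gt0.
by rewrite mulrC -ler_pdivlMr // ge_min lexx orbT.
Qed.

Lemma expands_bound f a P M K r k v (q : R) : expands f a P M K r ->
  K * `|v| <= q -> `|P k v| <= M * q ^+ k.
Proof.
move=> ex Kv; have M0 := expands_ge0 ex; case: ex => K0 r0 hP _.
apply: (le_trans (hpoly_bound (hP k) v)); rewrite -mulrA ler_wpM2l // -exprMn.
have h : 0 <= K * `|v| by rewrite mulr_ge0 // ltW.
by apply: lerXn2r => //; rewrite nnegrE // (le_trans h).
Qed.

Lemma hpoly_deg0 k M (p : E -> R) v : hpoly k M p -> k = 0%N -> p v = p 0.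
Proof.
elim=> {k M p} //.
by move=> k M N P Q _ ihP _ ihQ k0; rewrite ihP // ihQ.
Qed.

Lemma hpoly_at0 k M (p : E -> R) : hpoly k.+1 M p -> p 0 = 0.
Proof.
move=> /hpoly_bound/(_ 0); rewrite normr0 exprS mul0r mulr0 normr_le0.
by move/eqP.
Qed.

Lemma expands_val f a P M K r : expands f a P M K r -> f a = P 0%N 0.
Proof.
case=> K0 r0 hP /(_ 0); rewrite normr0 addr0 => /(_ r0) c.
apply: (@cvg_unique _ (@Rhausdorff R) _ _ _ _ c).
apply: (@cvg_near_cst _ _ (P 0%N 0)); exists 1%N => //= N N1.
rewrite /series /= big_ltn // big_nat_cond big1 ?addr0 // => -[|k] //= _.
exact: hpoly_at0 (hP _).
Qed.

Lemma analytic_germ_cst (c : R) a : analytic_germ (fun=> c) a.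
Proof.
exists (fun k => if k is 0 then fun=> c else fun=> 0), `|c|, 1, 1.
split=> //.
- move=> [|k]; first by rewrite expr0 mulr1; exact: hpoly_const.
  apply: hpoly_weaken (hpoly0 _ _ _).
  by rewrite mulr_ge0 // exprn_ge0.
- move=> v _; apply: cvg_near_cst; exists 1%N => //= N N1.
  by rewrite /series /= big_ltn // big_nat_cond big1 ?addr0 // => -[|k].
Qed.

Lemma expands_common f g a P Q M K r M' K' r' (e : R) : 0 < e ->
  expands f a P M K r -> expands g a Q M' K' r' ->
  exists N L s, [/\ expands f a P N L s, expands g a Q N L s & L * s <= e].
Proof.
move=> e0 ef eg.
have [_ r0 _ _] := ef; have [_ r'0 _ _] := eg.
have ef' : expands f a P (Num.max M M') (Num.max K K') r.
  by apply: (expands_shrink ef) => //; rewrite le_max lexx.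
have eg' : expands g a Q (Num.max M M') (Num.max K K') r'.
  by apply: (expands_shrink eg) => //; rewrite le_max lexx orbT.
have [s hs Ls] := expands_small e0 ef'.
have [s' hs' Ls'] := expands_small e0 eg'.
have [K0 s0 _ _] := hs; have [_ s'0 _ _] := hs'.
exists (Num.max M M'), (Num.max K K'), (Num.min s s'); split.
- by apply: (expands_shrink hs) => //; rewrite ?lt_min ?s0 // ge_min lexx.
- by apply: (expands_shrink hs') => //; rewrite ?lt_min ?s0 // ge_min lexx orbT.
- by apply: le_trans Ls; rewrite ler_pM2l // ge_min lexx.
Qed.

Lemma analytic_germD f g a : analytic_germ f a -> analytic_germ g a ->
  analytic_germ (fun x => f x + g x) a.
Proof.
move=> [P [M [K [r ef]]]] [Q [M' [K' [r' eg]]]].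
have [N [L [s [[L0 s0 hP cP] [_ _ hQ cQ] _]]]] := expands_common ltr01 ef eg.
exists (fun k v => P k v + Q k v), (N + N), L, s; split=> //.
- by move=> k; rewrite mulrDl; exact: hpolyD.
- move=> v vs; have -> : series (fun k => P k v + Q k v) =
    series (fun k => P k v) + series (fun k => Q k v).
    by apply/funext => n; rewrite /series /= fctE /= big_split.
  by apply: cvgD; [exact: cP|exact: cQ].
Qed.

Lemma ltn_expr2 k : (k.+1 <= 2 ^ k)%N.
Proof. exact: ltn_expl. Qed.

(** The degree k part of the product has k + 1 summands; this factor is at most 2^k and is absorbed
    by replacing L with 2 L. The radius is shrunk to L s <= 1/4 to provide the ratios of
    [cvg_cauchy_product]. *)
Lemma analytic_germM f g a : analytic_germ f a -> analytic_germ g a ->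
  analytic_germ (fun x => f x * g x) a.
Proof.
move=> [P [M [K [r ef]]]] [Q [M' [K' [r' eg]]]].
have e0 : 0 < 4^-1 :> R by rewrite invr_gt0.
have [N [L [s [eP eQ Ls]]]] := expands_common e0 ef eg.
have N0 := expands_ge0 eP.
have [L0 s0 hP cP] := eP; have [_ _ hQ cQ] := eQ.
exists (fun k v => \sum_(0 <= j < k.+1) P j v * Q (k - j)%N v),
  (N * N), (2 * L), s; split=> //.
- by rewrite mulr_gt0.
- move=> k; apply: (@hpoly_weaken _ _ _
      (\sum_(j < k.+1) (N * L ^+ j) * (N * L ^+ (k - j)%N))).
    apply: le_trans (_ : \sum_(j < k.+1) N * N * L ^+ k <= _).
      apply: ler_sum => j _; rewrite -[in leRHS](subnKC (ltn_ord j : (j <= k)%N)).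
      by rewrite exprD; apply: eq_le_real; ring.
    rewrite sumr_const card_ord -[leLHS]mulr_natr exprMn.
    rewrite [leRHS](_ : _ = N * N * L ^+ k * 2 ^+ k); last by ring.
    apply: ler_wpM2l; first by rewrite !mulr_ge0 // exprn_ge0 // ltW.
    by rewrite -natrX ler_nat ltn_expr2.
  rewrite (_ : (fun v => _) =
      (fun v => \sum_(j < k.+1) P j v * Q (k - j)%N v)); last first.
    by apply/funext => v; rewrite big_mkord.
  apply: hpoly_sum => j _; rewrite -[in X in hpoly X](subnKC (ltn_ord j : (j <= k)%N)).
  exact: hpolyM.
- move=> v vs; have Lv : L * `|v| <= 4^-1.
    by apply: le_trans Ls; rewrite ler_pM2l // ltW.
  apply: (@cvg_cauchy_product _ (P^~ v) (Q^~ v) N N) => //.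
  + by move=> k; exact: expands_bound eP Lv.
  + move=> k; apply: (expands_bound k eQ); apply: (le_trans Lv); lra.
  + exact: cP.
  + exact: cQ.
Qed.

End Expansions.

(** * Reciprocals of analytic germs *)

Section Inverse.
Context (R : realType) (m : nat).
Local Notation E := 'rV[R]_m.
Implicit Types (f g : E -> R) (P : nat -> E -> R) (a v : E).

Fixpoint inv_series_rec (c : R) P (fuel k : nat) : E -> R :=
  if fuel isn't fuel'.+1 then fun=> 0 else
  if k == 0%N then fun=> c^-1 else
  fun v => - c^-1 * \sum_(j < k) P (k - j)%N v * inv_series_rec c P fuel' j v.

(* Coefficients Q_k of the inverse of c + P_1 + P_2 + ...:
   c Q_k = - \sum_(j < k) P_(k - j) Q_j. *)
Definition inv_series c P k := inv_series_rec c P k.+1 k.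

Lemma inv_series_recE c P fuel k : (k < fuel)%N ->
  inv_series_rec c P fuel k = inv_series c P k.
Proof.
rewrite /inv_series.
suff H fuel1 fuel2 : (k < fuel1)%N -> (k < fuel2)%N ->
    inv_series_rec c P fuel1 k = inv_series_rec c P fuel2 k.
  by move=> kf; apply: H.
elim/ltn_ind: k fuel1 fuel2 => k ih [//|fuel1] [//|fuel2].
rewrite !ltnS => k1 k2 /=; case: eqP => // _.
apply/funext => v; congr (_ * _); apply: eq_bigr => j _; congr (_ * _).
by rewrite (ih j _ fuel1 fuel2) //; exact: leq_trans (ltn_ord j) _.
Qed.

Lemma inv_series0 c P v : inv_series c P 0 v = c^-1.
Proof. by []. Qed.

Lemma inv_seriesS c P k v : inv_series c P k.+1 v =
  - c^-1 * \sum_(j < k.+1) P (k.+1 - j)%N v * inv_series c P j v.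
Proof.
rewrite -[LHS]/(- c^-1 *
  \sum_(j < k.+1) P (k.+1 - j)%N v * inv_series_rec c P k.+1 j v).
congr (_ * _); apply: eq_bigr => j _.
by rewrite inv_series_recE.
Qed.

(** With t = M / |c| the recursion majorizes the k-th coefficient by t times the sum of K^(k - j)
    L^j over j < k. The ratio L = K (1 + t) is the one with L - K = t K, for which this geometric
    sum is L^k - K^k, hence at most L^k. *)
Lemma inv_series_hpoly c P M K : c != 0 -> 0 < K -> 0 <= M ->
  (forall k, hpoly k (M * K ^+ k) (P k)) ->
  forall k, hpoly k (`|c|^-1 * (K * (1 + M / `|c|)) ^+ k) (inv_series c P k).
Proof.
move=> c0 K0 M0 hP; set t := M / `|c|; set L := K * (1 + t).
have t0 : 0 <= t by rewrite divr_ge0.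
have L0 : 0 <= L by rewrite mulr_ge0 ?addr_ge0 // ltW.
have geom k : t * \sum_(j < k) K ^+ (k - j)%N * L ^+ j <= L ^+ k.
  elim: k => [|k ih]; first by rewrite big_ord0 mulr0 expr0.
  rewrite big_ord_recr /= subSnn expr1.
  have -> : \sum_(i < k) K ^+ (k.+1 - i) * L ^+ i =
      K * \sum_(i < k) K ^+ (k - i) * L ^+ i.
    rewrite mulr_sumr; apply: eq_bigr => i _.
    by rewrite subSn ?(ltnW (ltn_ord i)) // exprS mulrA.
  rewrite mulrDr mulrCA.
  apply: le_trans (lerD (ler_wpM2l (ltW K0) ih) (lexx _)) _.
  by apply: eq_le_real; rewrite exprS /L; ring.
elim/ltn_ind => -[|k] ih.
  rewrite expr0 mulr1; apply: hpoly_eq (hpoly_const _ (c^-1)) _ _ => //.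
  by rewrite normfV.
have -> : inv_series c P k.+1 = (fun v =>
    - c^-1 * \sum_(j < k.+1) P (k.+1 - j)%N v * inv_series c P j v).
  by apply/funext => v; exact: inv_seriesS.
apply: (@hpoly_weaken _ _ _ (`|- c^-1| * \sum_(j < k.+1)
   (M * K ^+ (k.+1 - j)%N) * (`|c|^-1 * L ^+ j))).
  rewrite normrN normfV; apply: ler_wpM2l; first by rewrite invr_ge0.
  apply: le_trans (geom k.+1); rewrite mulr_sumr.
  by apply: ler_sum => j _; apply: eq_le_real; rewrite /t; ring.
apply: hpolyZ; apply: hpoly_sum => j _.
rewrite -[X in hpoly X](subnK (ltnW (ltn_ord j))).
by apply: hpolyM => //; exact: ih.
Qed.

Lemma analytic_germV f a : f a != 0 -> analytic_germ f a ->
  analytic_germ (fun x => (f x)^-1) a.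
Proof.
move=> fa0 [P [M [K [r ef]]]].
have M0 := expands_ge0 ef; have fP := expands_val ef.
have [K0 r0 hP cP] := ef.
set c := f a in fa0 fP *.
have hQ := inv_series_hpoly fa0 K0 M0 hP.
set L := K * _ in hQ.
have KL : K <= L.
  by rewrite /L ler_pMr // lerDl divr_ge0.
have L0 : 0 < L by exact: lt_le_trans KL.
set s := Num.min r (4^-1 / L).
have s0 : 0 < s by rewrite lt_min r0 divr_gt0 ?invr_gt0.
exists (inv_series c P), (`|c|^-1), L, s; split=> // v vs.
have Lv : L * `|v| <= 4^-1.
  rewrite mulrC -ler_pdivlMr //; apply: (le_trans (ltW vs)).
  by rewrite ge_min lexx orbT.
have Kv : K * `|v| <= 4^-1.
  by apply: le_trans Lv; rewrite ler_wpM2r.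
have vr : `|v| < r by apply: (lt_le_trans vs); rewrite ge_min lexx.
have qb k : `|inv_series c P k v| <= `|c|^-1 * 2^-1 ^+ k.
  apply: (le_trans (hpoly_bound (hQ k) v)).
  rewrite -mulrA -exprMn; apply: ler_wpM2l; first by rewrite invr_ge0.
  apply: lerXn2r; rewrite ?nnegrE ?invr_ge0 //; last by apply: (le_trans Lv); lra.
  by rewrite mulr_ge0 // ltW.
have /cvg_ex [/= l ql] : cvgn (series (fun k => inv_series c P k v)).
  by apply: (cvg_series_dominated qb); lra.
have pb k : `|P k v| <= M * 4^-1 ^+ k by exact: expands_bound ef Kv.
have c1 : 0 <= `|c|^-1 by rewrite invr_ge0.
have := cvg_cauchy_product M0 c1 pb qb (cP v vr) ql.
(* By the recursion the Cauchy product has terms 1, 0, 0, ... Comparing limits gives f (a + v) * l =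
   1, which also shows that f has no zero in the smaller ball. *)
have one : series (fun k => \sum_(0 <= j < k.+1) P j v * inv_series c P (k - j) v)
    @ \oo --> (1 : R).
  apply: cvg_near_cst; exists 1%N => //= N N1.
  rewrite /series /= big_ltn // big_nat1 subn0 inv_series0.
  rewrite big_nat_cond big1 ?addr0.
    by rewrite (hpoly_deg0 v (hP 0%N)) // -fP mulfV.
  move=> [|k] //= _; rewrite big_mkord.
  rewrite (reindex_inj rev_ord_inj) /= big_ord_recr /= subSS subnn subn0.
  rewrite inv_seriesS (hpoly_deg0 v (hP 0%N)) // -fP mulNr mulrN mulrA mulfV // mul1r.
  apply/eqP; rewrite subr_eq0; apply/eqP; apply: eq_bigr => j _.
  by rewrite subSS subKn // ltnW // ltnS ltnW.
move=> /(@cvg_unique _ (@Rhausdorff R) _ _ _ _ one) fl.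
suff -> : (f (a + v))^-1 = l by [].
have nz : f (a + v) != 0.
  by apply/eqP => z; move/eqP: fl; rewrite z mul0r oner_eq0.
by apply: (mulfI nz); rewrite -fl mulfV.
Qed.

End Inverse.

(** * Termwise differentiation and vanishing of germs *)

Lemma diff0_quadratic (R : realType) (V W : normedModType R) (f : V -> W) x
    (C delta : R) : 0 < delta ->
  (forall h, `|h| <= delta -> `|f (x + h) - f x| <= C * `|h| ^+ 2) ->
  differentiable f x /\ 'd f x = 0 :> (V -> W).
Proof.
move=> delta0 fC.
have h0 : continuous (0 : V -> W) by move=> y; exact: cst_continuous.
have o0 : f \o shift x = cst (f x) + (0 : V -> W) +o_ 0 id.
  apply/eqaddoP => _/posnumP[e]; near=> h.
  have hd : `|h| <= delta by near: h; exact: nbhs0_le.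
  have he : `|h| <= e%:num / (`|C| + 1).
    by near: h; apply: nbhs0_le; rewrite divr_gt0 // ltr_wpDl.
  rewrite !fctE /= addr0 [h + x]addrC.
  apply: (@le_trans _ _ (`|C| * `|h| ^+ 2)).
    by apply: (le_trans (fC h hd)); rewrite ler_wpM2r ?exprn_ge0 ?ler_norm.
  rewrite expr2 mulrA ler_wpM2r //.
  apply: (@le_trans _ _ ((`|C| + 1) * `|h|)).
    by rewrite ler_wpM2r // lerDl.
  by rewrite mulrC -ler_pdivlMr ?ltr_wpDl.
have d0 : 'd f x = 0 :> (V -> W) by apply/diff_unique.
by split=> //; apply/diff_locallyP; rewrite d0.
Unshelve. all: by end_near. Qed.

Lemma cvg_sum_seq (R : realType) (I : Type) (s : seq I) (f : I -> nat -> R)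
    (l : I -> R) : (forall i, f i @ \oo --> l i) ->
  (fun N => \sum_(i <- s) f i N) @ \oo --> \sum_(i <- s) l i.
Proof.
move=> fl; elim: s => [|i s ih].
  rewrite big_nil; under eq_fun do rewrite big_nil; exact: cvg_cst.
rewrite big_cons; under eq_fun do rewrite big_cons.
by apply: cvgD; [exact: fl|exact: ih].
Qed.

Section Derivatives.
Context (R : realType) (m : nat).
Local Notation E := 'rV[R]_m.
Implicit Types (f g : E -> R) (P : nat -> E -> R) (a v x h : E).

Lemma diff_quadratic f x (c : 'I_m -> R) (C delta : R) : 0 < delta ->
  (forall h, `|h| <= delta ->
     `|f (x + h) - f x - \sum_(i < m) h 0 i * c i| <= C * `|h| ^+ 2) ->
  differentiable f x /\ forall h, 'D_h f x = \sum_(i < m) h 0 i * c i.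
Proof.
move=> delta0 fC.
pose l : E -> R := \sum_(i < m) (fun h => h 0 i * c i).
have lE h : l h = \sum_(i < m) h 0 i * c i by rewrite /l fct_sumE.
have dl y : differentiable l y.
  apply: differentiable_sum => i.
  by apply: differentiableM => //; exact: differentiable_coord.
have Dl h y : 'D_h l y = l h.
  rewrite derive_sum => [|i].
    rewrite lE; apply: eq_bigr => i _.
    rewrite [LHS]deriveMr ?derive_coor // 1?mulrC //.
    by apply: diff_derivable; exact: differentiable_coord.
  apply: diff_derivable; apply: differentiableM => //.
  exact: differentiable_coord.
have lD y z : l (y + z) = l y + l z.
  by rewrite !lE -big_split; apply: eq_bigr => i _; rewrite mxE mulrDl.
have [dF dF0] : differentiable (f - l) x /\ 'd (f - l) x = 0 :> (E -> R).
  apply: (@diff0_quadratic _ _ _ _ _ C delta) => // h /fC.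
  by rewrite -lE !fctE lD; congr (`|_| <= _); ring.
have -> : f = (f - l) + l by rewrite subrK.
split; first exact: differentiableD.
move=> h; rewrite deriveD; [|exact: diff_derivable|exact: diff_derivable].
by rewrite deriveE // dF0 Dl -lE; exact: add0r.
Qed.

(* A termwise derivative; P 0 is constant, whence the shift. *)
Definition series_derive (i : 'I_m) P k : E -> R :=
  'D_(delta_mx 0 i) (P k.+1).

(** The factor k + 1 produced by differentiating degree k + 1 is absorbed by 2^k, and the shift of
    index accounts for the extra K. *)
Lemma series_derive_hpoly i P (M K : R) : 0 < K -> 0 <= M ->
  (forall k, hpoly k (M * K ^+ k) (P k)) ->
  forall k, hpoly k ((M * K) * (2 * K) ^+ k) (series_derive i P k).
Proof.
move=> K0 M0 hP k; apply: (hpoly_weaken _ (hpoly_derive (hP k.+1) i)).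
rewrite exprMn exprS [leRHS](_ : _ = 2 ^+ k * (M * (K * K ^+ k))); last by ring.
apply: ler_wpM2r; first by rewrite !mulr_ge0 ?exprn_ge0 // ltW.
by rewrite -natrX ler_nat ltn_expr2.
Qed.

(** The first-order Taylor remainders of the [P k] are summed directly: by [hpoly_taylor] they form
    a series dominated by a geometric one times |h|^2, and a quadratic remainder gives
    differentiability through [diff_quadratic]. *)
Lemma expands_diff f a P (M K r : R) v : expands f a P M K r -> K * r <= 4^-1 ->
  `|v| < r ->
  exists2 c : 'I_m -> R,
   (forall i, series (fun k => series_derive i P k v) @ \oo --> c i) &
   differentiable f (a + v) /\
   forall h, 'D_h f (a + v) = \sum_(i < m) h 0 i * c i.
Proof.
move=> ef Kr vr; have M0 := expands_ge0 ef.
have [K0 r0 hP cP] := ef.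
have Kv : K * `|v| <= 4^-1 by apply: le_trans Kr; rewrite ler_pM2l // ltW.
have Kv0 : 0 <= K * `|v| by rewrite mulr_ge0 // ltW.
have cD i : cvgn (series (fun k => series_derive i P k v)).
  have hD := series_derive_hpoly i K0 M0 hP.
  apply: (@cvg_series_dominated _ _ (M * K) (2 * K * `|v|)); last 2 first.
  - by rewrite -mulrA mulr_ge0.
  - by apply: (@le_lt_trans _ _ (2 * 4^-1)); [rewrite -mulrA ler_pM2l|lra].
  - move=> k; apply: (le_trans (hpoly_bound (hD k) v)).
    by rewrite -mulrA -exprMn.
pose c i := lim (series (fun k => series_derive i P k v) @ \oo).
exists c => [i|]; first exact: cD.
have Dc h : series (fun k => 'D_h (P k) v) @ \oo --> \sum_(i < m) h 0 i * c i.
  have -> : series (fun k => 'D_h (P k) v) =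
    (fun N => \sum_(i < m) h 0 i * series (fun k => 'D_(delta_mx 0 i) (P k) v) N).
    apply/funext => N; rewrite /series /=.
    under [RHS]eq_bigr do rewrite mulr_sumr.
    rewrite [RHS]exchange_big /=; apply: eq_bigr => k _.
    by rewrite (derive_partials _ (hpoly_differentiable (hP k) v)).
  apply: cvg_sum_seq => i; apply: cvgMl_tmp.
  (* The degree 0 term has zero derivative, so these sums are those of [series_derive] delayed by
     one. *)
  rewrite -cvg_shiftS.
  have -> : (fun N => series (fun k => 'D_(delta_mx 0 i) (P k) v) N.+1) =
      series (fun k => series_derive i P k v).
    apply/funext => N; rewrite /series /= big_nat_recl //=.
    have := hpoly_bound (hpoly_derive (hP 0%N) i) v.
    by rewrite !mul0r normr_le0 => /eqP ->; rewrite add0r.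
  exact: cD.
(* Half the distance to the boundary: v + h stays in the ball of radius r, and the ratio K (|v| +
   delta) of the remainders stays below K r <= 1/4. *)
pose delta := (r - `|v|) / 2.
have delta0 : 0 < delta by rewrite divr_gt0 // subr_gt0.
have rvd : `|v| + delta < r by rewrite /delta; lra.
apply: (@diff_quadratic _ _ _ (2 * M / delta ^+ 2) delta) => // h hd.
have vhr : `|v + h| < r.
  by apply: le_lt_trans rvd; apply: (le_trans (ler_normD _ _)); rewrite lerD2l.
set rem := _ - _.
have crem : (fun N => \sum_(0 <= k < N) (P k (v + h) - P k v - 'D_h (P k) v))
    @ \oo --> rem.
  have -> : (fun N => \sum_(0 <= k < N) (P k (v + h) - P k v - 'D_h (P k) v)) =
     series (fun k => P k (v + h)) - series (fun k => P k v)
     - series (fun k => 'D_h (P k) v).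
    by apply/funext => N; rewrite !fctE /series /= !sumrB.
  apply: cvgB; last exact: Dc.
  by rewrite -addrA; apply: cvgB; exact: cP.
apply: (cvgr_to_le (cvg_norm crem)); near=> N.
apply: (le_trans (ler_norm_sum _ _ _)).
apply: le_trans (_ : \sum_(0 <= k < N)
    M * (`|h| / delta) ^+ 2 * (K * (`|v| + delta)) ^+ k <= _).
  apply: ler_sum => k _.
  apply: (le_trans (hpoly_taylor (hP k) (normr_ge0 v) delta0 (lexx _) hd)).
  by apply: eq_le_real; rewrite [(K * _) ^+ k]exprMn; ring.
rewrite -mulr_sumr [leRHS](_ : _ = M * (`|h| / delta) ^+ 2 * 2); last first.
  by field; rewrite gt_eqF.
apply: ler_wpM2l; first by rewrite mulr_ge0 // sqr_ge0.
apply: sum_geometric_le; first by rewrite mulr_ge0 ?addr_ge0 // ltW.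
apply: (@le_trans _ _ (K * r)); last by apply: (le_trans Kr); lra.
by rewrite ler_wpM2l // ltW.
Unshelve. all: by end_near. Qed.

Lemma analytic_germ_differentiable f a : analytic_germ f a -> differentiable f a.
Proof.
move=> [P [M [K [r ef]]]].
have e0 : 0 < 4^-1 :> R by rewrite invr_gt0.
have [s es Ks] := expands_small e0 ef; have [_ s0 _ _] := es.
have := expands_diff es Ks; move=> /(_ 0); rewrite normr0 addr0.
by move=> /(_ s0) [c _ []].
Qed.

Lemma expands_derive f a P (M K r : R) i : expands f a P M K r ->
  exists r', expands ('D_(delta_mx 0 i) f) a (series_derive i P) (M * K) (2 * K) r'.
Proof.
move=> ef; have M0 := expands_ge0 ef.
have e0 : 0 < 4^-1 :> R by rewrite invr_gt0.
have [s es Ks] := expands_small e0 ef; have [K0 s0 hP _] := es.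
exists s; split=> //; first by rewrite mulr_gt0.
  exact: series_derive_hpoly.
move=> v vs; have [c cD [_ Dc]] := expands_diff es Ks vs.
rewrite Dc (bigD1 i) //= mxE !eqxx mul1r big1 ?addr0 // => j ji.
by rewrite mxE (negPf ji) andbF mul0r.
Qed.

Lemma analytic_germ_partial f a i : analytic_germ f a ->
  analytic_germ ('D_(delta_mx 0 i) f) a.
Proof.
move=> [P [M [K [r ef]]]]; have [r' er'] := expands_derive i ef.
by exists (series_derive i P), (M * K), (2 * K), r'.
Qed.

Lemma analytic_germ_near f g a : (\near a, f a = g a) ->
  analytic_germ f a -> analytic_germ g a.
Proof.
move=> /nbhs_ballP [e /= e0 fg] [P [M [K [r ef]]]].
have [K0 r0 hP cP] := ef.
exists P, M, K, (Num.min r e); split=> //; first by rewrite lt_min r0.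
move=> v; rewrite lt_min => /andP[vr ve]; rewrite -fg; first exact: cP.
by rewrite -ball_normE /ball_ /= opprD addrA subrr sub0r normrN.
Qed.

(** Second partial derivatives at the centre are those of the quadratic part [P 2] at 0, so the
    symmetry reduces to that for polynomials. *)
Lemma analytic_germ_deriveC f a i j : analytic_germ f a ->
  'D_(delta_mx 0 i) ('D_(delta_mx 0 j) f) a =
  'D_(delta_mx 0 j) ('D_(delta_mx 0 i) f) a.
Proof.
move=> [P [M [K [r ef]]]].
have D2 i' j' : 'D_(delta_mx 0 i') ('D_(delta_mx 0 j') f) a =
    'D_(delta_mx 0 i') ('D_(delta_mx 0 j') (P 2%N)) 0.
  have [r' er'] := expands_derive j' ef.
  have [r'' er''] := expands_derive i' er'.
  by rewrite (expands_val er'').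
rewrite !D2; have [_ _ hP _] := ef; exact: hpoly_deriveC (hP 2%N) _ _ _.
Qed.

Definition partials (s : seq 'I_m) f : E -> R :=
  foldr (fun i g => 'D_(delta_mx 0 i) g) f s.

Lemma partials_rcons s i f :
  partials (rcons s i) f = partials s ('D_(delta_mx 0 i) f).
Proof. by rewrite /partials foldr_rcons. Qed.

Lemma analytic_germ_partials s f a :
  analytic_germ f a -> analytic_germ (partials s f) a.
Proof. by move=> hf; elim: s => //= i s; exact: analytic_germ_partial. Qed.

(* Euler's identity recovers P_(k+1) from the series of the partial
   derivatives. *)
Lemma expands_eq0 k f a P (M K r : R) : expands f a P M K r ->
  (forall s, partials s f a = 0) -> forall v, P k v = 0.
Proof.
elim: k f P M K r => [|k ih] f P M K r ef f0 v.
  have [_ _ hP _] := ef.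
  by rewrite (hpoly_deg0 v (hP 0%N)) // -(expands_val ef); exact: f0 [::].
have [_ _ hP _] := ef.
have := hpoly_euler (hP k.+1) v.
rewrite (derive_partials _ (hpoly_differentiable (hP k.+1) v)) big1.
  by move/eqP; rewrite eq_sym mulf_eq0 pnatr_eq0 /= => /eqP.
move=> i _; have [r' er'] := expands_derive i ef.
rewrite -/(series_derive i P k v) (ih _ _ _ _ _ er') ?mulr0 // => s.
by rewrite -partials_rcons.
Qed.

Lemma analytic_germ_eq0 f a : analytic_germ f a ->
  (forall s, partials s f a = 0) -> \forall x \near a, f x = 0.
Proof.
move=> [P [M [K [r ef]]]] f0; have [_ r0 _ cP] := ef.
apply/nbhs_ballP; exists r => //= x.
rewrite -ball_normE /ball_ /= distrC => xr.
have := cP _ xr; rewrite [a + _]addrC subrK => /(@cvg_unique _ (@Rhausdorff R)); apply.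
have -> : series (fun k => P k (x - a)) = cst 0.
  apply/funext => N; rewrite /series /= big1 // => k _.
  exact: expands_eq0 ef f0 _.
exact: cvg_cst.
Qed.

End Derivatives.

(** * Equivalence with absolutely convergent sums over cubes *)

Section CubicSums.
Context (R : realType) (m : nat).
Local Notation E := 'rV[R]_m.
Local Notation multi := {ffun 'I_m -> nat}.
Implicit Types (f : E -> R) (P : nat -> E -> R) (a v : E) (alpha : multi).

Definition degree alpha : nat := (\sum_i alpha i)%N.

Definition multi_monomial alpha v : R := \prod_(i < m) v 0 i ^+ alpha i.

Definition cube N (alpha : {ffun 'I_m -> 'I_N}) : multi :=
  [ffun i => nat_of_ord (alpha i)].

Lemma cube_inj N : injective (@cube N).
Proof.
move=> a b ab; apply/ffunP => i; apply/val_inj.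
by have := congr1 (fun h : multi => h i) ab; rewrite !ffunE.
Qed.

Lemma leq_degree alpha i : (alpha i <= degree alpha)%N.
Proof. by rewrite /degree (bigD1 i) //= leq_addr. Qed.

Lemma cubeK N alpha : (forall i, alpha i < N)%N ->
  exists beta : {ffun 'I_m -> 'I_N}, cube beta = alpha.
Proof.
move=> aN; exists [ffun i => Ordinal (aN i)].
by apply/ffunP => i; rewrite !ffunE.
Qed.

(** The entries of a multi-index of degree k are at most k, so the cube of side k + 1 already
    contains all of them; this makes [homogeneous_part] independent of N. *)
Lemma sum_cube_degree (F : multi -> R) N k : (k < N)%N ->
  \sum_(alpha : {ffun 'I_m -> 'I_N} | degree (cube alpha) == k) F (cube alpha) =
  \sum_(alpha : {ffun 'I_m -> 'I_k.+1} | degree (cube alpha) == k) F (cube alpha).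
Proof.
move=> kN.
pose h (b : {ffun 'I_m -> 'I_k.+1}) := [ffun i => widen_ord kN (b i)].
pose h' (b : {ffun 'I_m -> 'I_N}) : {ffun 'I_m -> 'I_k.+1} := [ffun i => inord (b i)].
have cubeh b : cube (h b) = cube b by apply/ffunP => i; rewrite !ffunE.
rewrite (reindex_onto h h') /=; last first.
  move=> b /eqP bk; apply/ffunP => i; apply/val_inj; rewrite !ffunE /= inordK //.
  by rewrite ltnS -bk; have := leq_degree (cube b) i; rewrite !ffunE.
apply: eq_big => [b|b _]; last by rewrite cubeh.
rewrite cubeh; have -> : h' (h b) = b; last by rewrite eqxx andbT.
by apply/ffunP => i; rewrite !ffunE; apply/val_inj; rewrite /= inordK.
Qed.

Lemma monomialE N (beta : {ffun 'I_m -> 'I_N}) v :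
  monomial beta v = multi_monomial (cube beta) v.
Proof. by apply: eq_bigr => i _; rewrite ffunE. Qed.

Lemma multi_monomial_hpoly alpha : hpoly (degree alpha) 1 (multi_monomial alpha).
Proof.
have hX i k : hpoly k 1 (fun v : E => v 0 i ^+ k).
  elim: k => [|k ih].
    by apply: hpoly_eq (hpoly_const _ (1 : R)) _ _ => //; rewrite normr1.
  by apply: hpoly_eq (hpolyX i ih) _ _ => // v; rewrite exprS.
rewrite /degree /multi_monomial.
elim: (index_enum _) => [|i s ih].
  rewrite big_nil; apply: hpoly_eq (hpoly_const _ (1 : R)) _ _ => [|v].
    by rewrite normr1.
  by rewrite big_nil.
rewrite big_cons; apply: hpoly_eq (hpolyM (hX i _) ih) _ _ => [|v].
  by rewrite mulr1.
by rewrite big_cons.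
Qed.

Lemma multi_monomial_cst alpha (rho : R) :
  multi_monomial alpha (const_mx rho) = rho ^+ degree alpha.
Proof.
by rewrite /degree expr_sum; apply: eq_bigr => i _; rewrite mxE.
Qed.

Lemma multi_monomial_le alpha v (rho q : R) : 0 <= rho -> 0 <= q ->
  `|v| <= q * rho -> `|multi_monomial alpha v| <= q ^+ degree alpha * rho ^+ degree alpha.
Proof.
move=> rho0 q0 vq; apply: (le_trans (hpoly_bound (multi_monomial_hpoly alpha) v)).
rewrite mul1r -exprMn; by apply: lerXn2r; rewrite ?nnegrE ?mulr_ge0.
Qed.

Definition homogeneous_part (c : multi -> R) k v : R :=
  \sum_(alpha : {ffun 'I_m -> 'I_k.+1} | degree (cube alpha) == k)
    c (cube alpha) * multi_monomial (cube alpha) v.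

(** The cube of side N contains every multi-index of degree less than N. What remains of it has
    degree at least N, and each such term gains a factor q^N from |v| <= q rho. *)
Lemma cube_sum_diff (c : multi -> R) (rho q B : R) v N :
  0 <= rho -> 0 <= q -> q <= 1 -> `|v| <= q * rho ->
  \sum_(alpha : {ffun 'I_m -> 'I_N}) `|c (cube alpha)| * rho ^+ degree (cube alpha)
    <= B ->
  `|\sum_(alpha : {ffun 'I_m -> 'I_N}) c (cube alpha) * multi_monomial (cube alpha) v
    - \sum_(0 <= k < N) homogeneous_part c k v| <= B * q ^+ N.
Proof.
move=> rho0 q0 q1 vq cB.
have -> : \sum_(0 <= k < N) homogeneous_part c k v =
   \sum_(alpha : {ffun 'I_m -> 'I_N} | (degree (cube alpha) < N)%N)
      c (cube alpha) * multi_monomial (cube alpha) v.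
  rewrite big_mkord.
  under eq_bigr => k _ do rewrite /homogeneous_part
    -(sum_cube_degree (fun b => c b * multi_monomial b v) (ltn_ord k)) big_mkcond.
  rewrite exchange_big /= [RHS]big_mkcond /=; apply: eq_bigr => b _.
  case: ltnP => bN.
    rewrite (bigD1 (Ordinal bN)) //= eqxx big1 ?addr0 // => k /eqP kb.
    case: eqP => // bk; case: kb; exact/val_inj.
  rewrite big1 // => k _; case: eqP => // bk.
  by move: bN; rewrite bk leqNgt ltn_ord.
rewrite (bigID (fun b => (degree (cube b) < N)%N)) /= addrAC subrr add0r.
apply: (le_trans (ler_norm_sum _ _ _)).
apply: le_trans (_ : \sum_(alpha : {ffun 'I_m -> 'I_N})
   (`|c (cube alpha)| * rho ^+ degree (cube alpha)) * q ^+ N <= _); last first.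
  by rewrite -mulr_suml ler_wpM2r // exprn_ge0.
rewrite [leLHS]big_mkcond /=; apply: ler_sum => b _.
case: ltnP => bN /=; first by rewrite !mulr_ge0 ?exprn_ge0.
rewrite normrM -mulrA; apply: ler_wpM2l => //.
apply: (le_trans (multi_monomial_le _ rho0 q0 vq)).
rewrite mulrC ler_wpM2l ?exprn_ge0 //.
by rewrite -(subnK bN) exprD ler_piMl ?exprn_ge0 ?exprn_ile1.
Qed.

(** Absolute convergence is evaluated at the single point a + (rho, ..., rho) with rho = r / 2,
    where every monomial of degree k equals rho^k. The bound B found there serves as M, with K = 1 /
    rho. *)
Lemma analytic_at_germ f a : analytic_at f a -> analytic_germ f a.
Proof.
move=> [c' [r [r0 hc]]].
pose c (alpha : multi) := c' (fun i => alpha i).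
have cE N (b : {ffun 'I_m -> 'I_N}) :
    c' (fun i => nat_of_ord (b i)) = c (cube b).
  by congr c'; apply/funext => i; rewrite ffunE.
pose rho := r / 2; have rho0 : 0 < rho by rewrite divr_gt0.
have rhor : rho < r by rewrite /rho; lra.
have nrho : `|const_mx rho : E| <= rho.
  rewrite [leLHS]/Num.Def.normr/= mx_normrE bigmax_le ?ltW // => i _.
  by rewrite mxE gtr0_norm.
have [B cB] : exists B : R, forall N, \sum_(alpha : {ffun 'I_m -> 'I_N})
    `|c (cube alpha)| * rho ^+ degree (cube alpha) <= B.
  have [|[B hB] _] := hc (a + const_mx rho).
    by rewrite addrAC subrr add0r (le_lt_trans nrho).
  exists B => N; apply: le_trans (hB N); apply: ler_sum => b _.
  rewrite addrAC subrr add0r monomialE multi_monomial_cst normrM cE.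
  by rewrite (ger0_norm (exprn_ge0 _ (ltW rho0))).
exists (homogeneous_part c), B, rho^-1, rho; split=> //.
- by rewrite invr_gt0.
- move=> k; apply: (@hpoly_weaken _ _ _ (\sum_(alpha : {ffun 'I_m -> 'I_k.+1} |
      degree (cube alpha) == k) `|c (cube alpha)| * 1)).
    rewrite exprVn ler_pdivlMr ?exprn_gt0 // mulr_suml.
    apply: le_trans (cB k.+1); rewrite [leLHS]big_mkcond; apply: ler_sum => b _ /=.
    by case: eqP => [->|_]; rewrite ?mulr1 // mulr_ge0 ?exprn_ge0 // ltW.
  apply: hpoly_sum => b /eqP bk; apply: hpolyZ.
  by rewrite -[X in hpoly X]bk; exact: multi_monomial_hpoly.
- move=> v vrho; pose q := `|v| / rho.
  have q0 : 0 <= q by rewrite divr_ge0 // ltW.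
  have q1 : q < 1 by rewrite ltr_pdivrMr // mul1r.
  have vq : `|v| <= q * rho by rewrite divfK // gt_eqF.
  have [|_] := hc (a + v); first by rewrite addrAC subrr add0r (lt_trans vrho).
  rewrite addrAC subrr add0r => cf.
  set S := (fun N : nat => _) in cf.
  have -> : series (fun k => homogeneous_part c k v) =
      S - (fun N => S N - series (fun k => homogeneous_part c k v) N).
    by apply/funext => N; rewrite !fctE opprB addrC subrK.
  rewrite -[f _]subr0; apply: cvgB => //.
  apply/norm_cvg0P; apply: (@squeeze_cvgr _ _ _ _ (fun=> 0) (fun N => B * q ^+ N)).
  + apply: nearW => N /=; rewrite normr_ge0 /=.
    have -> : S N = \sum_(alpha : {ffun 'I_m -> 'I_N})
        c (cube alpha) * multi_monomial (cube alpha) v.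
      by apply: eq_bigr => b _; rewrite cE monomialE.
    exact: cube_sum_diff (ltW rho0) q0 (ltW q1) vq (cB N).
  + exact: cvg_cst.
  + by apply: (@cvg_geometric R B q); rewrite ger0_norm.
Qed.

(** A list, because a multi-index may occur several times in an [hpoly] derivation; merging
    repetitions, as [analytic_germ_at] does, cannot increase the absolute sum. *)
Lemma hpoly_monomials k M (p : E -> R) : hpoly k M p ->
  exists s : seq (R * multi), [/\ forall x, x \in s -> degree x.2 = k,
    \sum_(x <- s) `|x.1| <= M &
    forall v, p v = \sum_(x <- s) x.1 * multi_monomial x.2 v].
Proof.
elim=> {k M p}.
- move=> c; exists [:: (c, [ffun=> 0%N])]; split.
  + by move=> x; rewrite inE => /eqP ->; rewrite /degree big1 // => i _; rewrite ffunE.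
  + by rewrite big_seq1.
  + move=> v; rewrite big_seq1 /= /multi_monomial big1 ?mulr1 // => i _.
    by rewrite ffunE expr0.
- move=> k M p i _ [s [sk sM ps]].
  pose shift (x : R * multi) := (x.1, [ffun j => (x.2 j + (j == i))%N] : multi).
  exists (map shift s); split.
  + move=> _ /mapP[x /sk xk ->]; rewrite /degree /=.
    under eq_bigr do rewrite ffunE.
    rewrite big_split /= -/(degree x.2) xk (bigD1 i) //= eqxx.
    by rewrite big1 ?addn0 ?addn1 // => j /negPf ->.
  + by rewrite big_map.
  + move=> v; rewrite ps big_map mulr_sumr; apply: eq_bigr => x _ /=.
    rewrite mulrCA; congr (_ * _); rewrite /multi_monomial.
    under [RHS]eq_bigr do rewrite ffunE exprD.
    rewrite big_split /= mulrC; congr (_ * _).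
    rewrite (bigD1 i) //= eqxx expr1 big1 ?mulr1 // => j /negPf ->.
    by rewrite expr0.
- move=> k; exists [::]; split=> //; first by rewrite big_nil.
  by move=> v; rewrite big_nil.
- move=> k M N p p' _ [s [sk sM ps]] _ [s' [sk' sM' ps']].
  exists (s ++ s'); split.
  + by move=> x; rewrite mem_cat => /orP[/sk|/sk'].
  + by rewrite big_cat lerD.
  + by move=> v; rewrite big_cat ps ps'.
- move=> k M N p MN _ [s [sk sM ps]]; exists s; split=> //.
  exact: le_trans MN.
Qed.

(** The coefficient of alpha is read off the polynomial of degree |alpha|. At rho = 1 / (2 K) the
    absolute sum in degree k is at most M 2^-k, whence the bound 2 M for every cube. *)
Lemma analytic_germ_at f a : analytic_germ f a -> analytic_at f a.
Proof.
move=> [P [M [K [r ef]]]]; have M0 := expands_ge0 ef; have [K0 r0 hP cP] := ef.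
have [s hs] := choice (fun k => hpoly_monomials (hP k)).
pose c (alpha : multi) := \sum_(x <- s (degree alpha) | x.2 == alpha) x.1.
have homE k v : homogeneous_part c k v = P k v.
  have [sk _ ->] := hs k.
  under [LHS]eq_bigr => b /eqP bk do rewrite /c bk mulr_suml big_mkcond.
  rewrite exchange_big /= [LHS]big_seq [RHS]big_seq; apply: eq_bigr => x xs.
  have [b bx] : exists b : {ffun 'I_m -> 'I_k.+1}, cube b = x.2.
    by apply: cubeK => i; rewrite ltnS -(sk x xs) leq_degree.
  rewrite (bigD1 b) ?bx ?(sk x xs) ?eqxx //= big1 ?addr0 // => b' /andP[_ b'b].
  case: eqP => // xb'; case/eqP: b'b; apply: cube_inj; by rewrite -xb'.
have cM k N : \sum_(b : {ffun 'I_m -> 'I_N} | degree (cube b) == k) `|c (cube b)|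
    <= M * K ^+ k.
  have [sk sM _] := hs k; apply: le_trans sM.
  apply: le_trans (_ : \sum_(b : {ffun 'I_m -> 'I_N} | degree (cube b) == k)
      \sum_(x <- s k) (if x.2 == cube b then `|x.1| else 0) <= _).
    apply: ler_sum => b /eqP bk; rewrite /c bk -big_mkcond.
    exact: ler_norm_sum.
  rewrite exchange_big /=; apply: ler_sum => x _.
  have [[b bx]|nb] := pselect (exists b : {ffun 'I_m -> 'I_N}, cube b = x.2).
    rewrite big_mkcond (bigD1 b) //= big1 ?addr0; last first.
      move=> b' b'b; case: ifP => // _; case: eqP => // xb'.
      by case/eqP: b'b; apply: cube_inj; rewrite -xb'.
    by case: ifP => // _; case: ifP.
  by rewrite big1 // => b _; case: eqP => // bx; case: nb; exists b.
pose rho := 2^-1 / K; have rho0 : 0 < rho by rewrite divr_gt0 // invr_gt0.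
have cB N : \sum_(b : {ffun 'I_m -> 'I_N}) `|c (cube b)| * rho ^+ degree (cube b)
    <= 2 * M.
  (* A number above every degree in the cube, used to sort the finite sum by degree. *)
  pose D := (\sum_(b : {ffun 'I_m -> 'I_N}) degree (cube b)).+1%N.
  have bD (b : {ffun 'I_m -> 'I_N}) : (degree (cube b) < D)%N.
    by rewrite ltnS (bigD1 b) //= leq_addr.
  have -> : \sum_(b : {ffun 'I_m -> 'I_N}) `|c (cube b)| * rho ^+ degree (cube b) =
    \sum_(k < D) \sum_(b : {ffun 'I_m -> 'I_N} | degree (cube b) == k)
      `|c (cube b)| * rho ^+ k.
    under [RHS]eq_bigr do rewrite big_mkcond.
    rewrite [RHS]exchange_big /=; apply: eq_bigr => b _.
    rewrite (bigD1 (Ordinal (bD b))) //= eqxx big1 ?addr0 // => k /eqP kb.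
    by case: eqP => // bk; case: kb; exact/val_inj.
  apply: le_trans (_ : \sum_(k < D) M * 2^-1 ^+ k <= _).
    apply: ler_sum => k _; rewrite -mulr_suml.
    apply: (le_trans (ler_wpM2r (exprn_ge0 _ (ltW rho0)) (cM k N))).
    rewrite -mulrA -exprMn /rho mulrCA mulfV ?gt_eqF // mulr1.
    exact: lexx.
  rewrite -mulr_sumr mulrC ler_wpM2r // -(big_mkord xpredT (fun k => 2^-1 ^+ k)).
  by apply: sum_geometric_le; rewrite ?invr_ge0.
exists (fun g => c [ffun i => g i]), (Num.min r rho).
have cE N (b : {ffun 'I_m -> 'I_N}) :
  c [ffun i => nat_of_ord (b i)] = c (cube b) by [].
split; first by rewrite lt_min r0.
move=> x; rewrite lt_min => /andP[xr xrho]; set v := x - a in xr xrho *.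
pose q := `|v| / rho.
have q0 : 0 <= q by rewrite divr_ge0 // ltW.
have q1 : q < 1 by rewrite ltr_pdivrMr // mul1r.
have vq : `|v| <= q * rho by rewrite divfK // gt_eqF.
split.
  exists (2 * M) => N; apply: le_trans (cB N); apply: ler_sum => b _.
  rewrite cE monomialE normrM ler_wpM2l //.
  apply: (le_trans (multi_monomial_le _ (ltW rho0) q0 vq)).
  by rewrite ler_piMl ?exprn_ge0 ?exprn_ile1 // ltW.
set S := fun N : nat => _.
have -> : S = series (fun k => P k v) + (fun N => S N - series (fun k => P k v) N).
  by apply/funext => N; rewrite !fctE addrC subrK.
rewrite -[f x]addr0; apply: cvgD.
  by have := cP v xr; rewrite /v [a + _]addrC subrK.
apply/norm_cvg0P; apply: (@squeeze_cvgr _ _ _ _ (fun=> 0) (fun N => 2 * M * q ^+ N)).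
- apply: nearW => N /=; rewrite normr_ge0 /=.
  have -> : S N = \sum_(alpha : {ffun 'I_m -> 'I_N})
      c (cube alpha) * multi_monomial (cube alpha) v.
    by apply: eq_bigr => b _; rewrite cE monomialE.
  have -> : series (fun k => P k v) N = \sum_(0 <= k < N) homogeneous_part c k v.
    by rewrite /series /=; apply: eq_bigr => k _; rewrite homE.
  exact: cube_sum_diff (ltW rho0) q0 (ltW q1) vq (cB N).
- exact: cvg_cst.
- by apply: (@cvg_geometric R (2 * M) q); rewrite ger0_norm.
Qed.

Lemma analytic_atE f a : analytic_at f a <-> analytic_germ f a.
Proof. by split; [exact: analytic_at_germ|exact: analytic_germ_at]. Qed.

End CubicSums.

(** * Analytic functions on open sets *)

(* Sealed, because conversion tests between unsealed derivatives unfold the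
   limits and do not terminate in practice. *)
HB.lock Definition pd (R : realType) (m : nat) (W : normedModType R)
  (v : 'rV[R]_m) (F : 'rV[R]_m -> W) (z : 'rV[R]_m) : W := 'D_v F z.

Lemma pdE (R : realType) (m : nat) (W : normedModType R) (v : 'rV[R]_m)
  (F : 'rV[R]_m -> W) : pd v F = 'D_v F.
Proof. by rewrite unlock. Qed.

Record open_domain (R : realType) (m : nat) := OpenDomain {
  domain_set :> 'rV[R]_m -> Prop;
  domain_open : open (domain_set : set 'rV[R]_m) }.

(** Sealing keeps the matrix products folded, so that [ring] and [field] see a pairing as one
    atom. *)
HB.lock Definition bl (R : realType) (k : nat) (M : 'M[R]_k) (v w : 'rV[R]_k) : R :=
  bil M v w.

Lemma blE (R : realType) (k : nat) : @bl R k = @bil R k.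
Proof. by rewrite unlock. Qed.

Section Calculus.
Context (R : realType) (m : nat) (Omega : open_domain R m).
Local Notation E := 'rV[R]_m.
Implicit Types (f g : E -> R) (v w z : E).

Definition an f := forall z, Omega z -> analytic_germ f z.
Definition anm a b (F : E -> 'M[R]_(a, b)) :=
  forall i j, an (fun z => F z i j).

Lemma Omega_near z : Omega z -> \forall y \near z, Omega y.
Proof. by move=> Oz; apply: open_nbhs_nbhs; split => //; exact: domain_open. Qed.

Lemma an_eq f g : (forall z, Omega z -> f z = g z) -> an f -> an g.
Proof.
move=> fg fa z Oz; apply: analytic_germ_near (fa z Oz).
by apply: filterS (Omega_near Oz) => y; exact: fg.
Qed.

Lemma eq_derive_on (V : normedModType R) (f g : E -> V) v z :
  (forall z, Omega z -> f z = g z) -> Omega z -> pd v f z = pd v g z.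
Proof.
move=> fg Oz; rewrite !pdE; apply: near_eq_derive.
by apply: filterS (Omega_near Oz) => y; exact: fg.
Qed.

Lemma an_cst (c : R) : an (fun=> c).
Proof. by move=> z _; exact: analytic_germ_cst. Qed.

Lemma anD f g : an f -> an g -> an (fun z => f z + g z).
Proof. by move=> fa ga z Oz; apply: analytic_germD; [exact: fa|exact: ga]. Qed.

Lemma anM f g : an f -> an g -> an (fun z => f z * g z).
Proof. by move=> fa ga z Oz; apply: analytic_germM; [exact: fa|exact: ga]. Qed.

Lemma anN f : an f -> an (fun z => - f z).
Proof.
move=> fa; apply: an_eq (anM (an_cst (- 1)) fa) => z _; exact: mulN1r.
Qed.

Lemma anB f g : an f -> an g -> an (fun z => f z - g z).
Proof. by move=> fa ga; apply: anD => //; exact: anN. Qed.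

Lemma anX f k : an f -> an (fun z => f z ^+ k).
Proof.
move=> fa; elim: k => [|k ih]; first exact: an_cst.
by apply: an_eq (anM fa ih) => z _; rewrite exprS.
Qed.

Lemma anV f : (forall z, Omega z -> f z != 0) -> an f -> an (fun z => (f z)^-1).
Proof. by move=> f0 fa z Oz; apply: analytic_germV; [exact: f0|exact: fa]. Qed.

Lemma an_sum (I : Type) (s : seq I) (P : pred I) (F : I -> E -> R) :
  (forall i, an (F i)) -> an (fun z => \sum_(i <- s | P i) F i z).
Proof.
move=> Fa; elim: s => [|i s ih].
  by apply: an_eq (an_cst 0) => z _; rewrite big_nil.
have [Pi|nPi] := boolP (P i).
  by apply: an_eq (anD (Fa i) ih) => z _; rewrite big_cons Pi.
by apply: an_eq ih => z _; rewrite big_cons (negPf nPi).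
Qed.

Lemma an_prod (I : Type) (s : seq I) (F : I -> E -> R) :
  (forall i, an (F i)) -> an (fun z => \prod_(i <- s) F i z).
Proof.
move=> Fa; elim: s => [|i s ih].
  by apply: an_eq (an_cst 1) => z _; rewrite big_nil.
by apply: an_eq (anM (Fa i) ih) => z _; rewrite big_cons.
Qed.

Lemma an_differentiable f z : an f -> Omega z -> differentiable f z.
Proof. by move=> fa Oz; exact: analytic_germ_differentiable (fa z Oz). Qed.

Lemma an_derivable f z v : an f -> Omega z -> derivable f z v.
Proof. by move=> fa Oz; apply: diff_derivable; exact: an_differentiable. Qed.

Lemma pd_cst (W : normedModType R) (c : W) v z : pd v (fun=> c) z = 0.
Proof. by rewrite pdE derive_cst. Qed.

Lemma pd0 (W : normedModType R) (F : E -> W) z : pd 0 F z = 0.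
Proof. by rewrite pdE derive0. Qed.

Lemma pd_partials f v z : an f -> Omega z ->
  pd v f z = \sum_(i < m) v 0 i * pd (delta_mx 0 i) f z.
Proof.
move=> fa Oz; rewrite pdE (derive_partials _ (an_differentiable fa Oz)).
by apply: eq_bigr => i _; rewrite pdE.
Qed.

Lemma an_derive f v : an f -> an (pd v f).
Proof.
move=> fa.
have pa i : an (pd (delta_mx 0 i) f).
  by move=> z Oz; rewrite pdE; exact: analytic_germ_partial (fa z Oz).
apply: an_eq (an_sum (index_enum _) predT
  (fun i => anM (an_cst (v 0 i)) (pa i))) => z Oz /=.
by rewrite (pd_partials _ fa Oz).
Qed.

Lemma an_deriveD f g v z : an f -> an g -> Omega z ->
  pd v (fun y => f y + g y) z = pd v f z + pd v g z.
Proof. by move=> fa ga Oz; rewrite !pdE [LHS]deriveD //; exact: an_derivable. Qed.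

Lemma an_deriveN f v z : an f -> Omega z ->
  pd v (fun y => - f y) z = - pd v f z.
Proof. by move=> fa Oz; rewrite !pdE [LHS]deriveN //; exact: an_derivable. Qed.

Lemma an_deriveB f g v z : an f -> an g -> Omega z ->
  pd v (fun y => f y - g y) z = pd v f z - pd v g z.
Proof. by move=> fa ga Oz; rewrite !pdE [LHS]deriveB //; exact: an_derivable. Qed.

Lemma an_deriveM f g v z : an f -> an g -> Omega z ->
  pd v (fun y => f y * g y) z = pd v f z * g z + f z * pd v g z.
Proof.
move=> fa ga Oz; rewrite !pdE [LHS]deriveM; try exact: an_derivable.
by rewrite /GRing.scale /= addrC [g z * _]mulrC.
Qed.

Lemma an_deriveV f v z : an f -> f z != 0 -> Omega z ->
  pd v (fun y => (f y)^-1) z = - (f z ^- 2) * pd v f z.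
Proof. by move=> fa f0 Oz; rewrite !pdE [LHS]deriveV //; exact: an_derivable. Qed.

Lemma an_derive_sum (I : Type) (s : seq I) (F : I -> E -> R) v z :
  (forall i, an (F i)) -> Omega z ->
  pd v (fun y => \sum_(i <- s) F i y) z = \sum_(i <- s) pd v (F i) z.
Proof.
move=> Fa Oz; elim: s => [|i s ih].
  rewrite big_nil -[RHS](pd_cst (0 : R) v z); congr (pd v _ z).
  by apply/funext => y; rewrite big_nil.
rewrite big_cons -ih -an_deriveD //; last exact: an_sum.
by congr (pd v _ z); apply/funext => y; rewrite big_cons.
Qed.

Lemma an_derive_dirD f v w z : an f -> Omega z ->
  pd (v + w) f z = pd v f z + pd w f z.
Proof.
move=> fa Oz; have df := an_differentiable fa Oz.
by rewrite !pdE !deriveE // linearD.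
Qed.

Lemma an_derive_dirZ f (c : R) v z : an f -> Omega z ->
  pd (c *: v) f z = c * pd v f z.
Proof.
move=> fa Oz; have df := an_differentiable fa Oz.
by rewrite !pdE !deriveE // linearZ.
Qed.

Lemma an_deriveC f v w z : an f -> Omega z ->
  pd v (pd w f) z = pd w (pd v f) z.
Proof.
move=> fa Oz.
have dE v' w' : pd v' (pd w' f) z = \sum_(i < m) \sum_(j < m)
    v' 0 i * (w' 0 j * pd (delta_mx 0 i) (pd (delta_mx 0 j) f) z).
  rewrite (pd_partials _ (an_derive w' fa) Oz).
  apply: eq_bigr => i _; rewrite -mulr_sumr; congr (_ * _).
  rewrite (@eq_derive_on R _
     (fun y => \sum_(j < m) w' 0 j * pd (delta_mx 0 j) f y)) //; last first.
    by move=> y Oy; rewrite (pd_partials _ fa Oy).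
  rewrite an_derive_sum // => [|j]; last first.
    by apply: anM; [exact: an_cst|exact: an_derive].
  apply: eq_bigr => j _; rewrite an_deriveM //.
  - by rewrite pd_cst mul0r add0r.
  - exact: an_cst.
  - exact: an_derive.
rewrite !dE exchange_big /=; apply: eq_bigr => i _; apply: eq_bigr => j _.
by rewrite !pdE (analytic_germ_deriveC i j (fa z Oz)); ring.
Qed.

Section Matrices.
Context (a b : nat).
Implicit Types (F H : E -> 'M[R]_(a, b)).

Lemma anm_eq F H : (forall z, Omega z -> F z = H z) -> anm F -> anm H.
Proof. by move=> FH Fa i j; apply: an_eq (Fa i j) => z Oz; rewrite FH. Qed.

Lemma anm_derivable F v z : anm F -> Omega z -> derivable F z v.
Proof. by move=> Fa Oz; apply/derivable_mxP => i j; exact: an_derivable. Qed.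

Lemma anm_deriveE F v z i j : anm F -> Omega z ->
  pd v F z i j = pd v (fun y => F y i j) z.
Proof.
by move=> Fa Oz; rewrite !pdE (derive_mx (anm_derivable Fa Oz)) mxE.
Qed.

Lemma anm_derive F v : anm F -> anm (pd v F).
Proof.
move=> Fa i j; apply: an_eq (an_derive v (Fa i j)) => z Oz.
by rewrite anm_deriveE.
Qed.

Lemma anm_cst (M : 'M[R]_(a, b)) : anm (fun=> M).
Proof. by move=> i j; exact: an_cst. Qed.

Lemma anmD F H : anm F -> anm H -> anm (fun z => F z + H z).
Proof.
by move=> Fa Ha i j; apply: an_eq (anD (Fa i j) (Ha i j)) => z _; rewrite mxE.
Qed.

Lemma anmN F : anm F -> anm (fun z => - F z).
Proof.
by move=> Fa i j; apply: an_eq (anN (Fa i j)) => z _; rewrite mxE.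
Qed.

Lemma anmB F H : anm F -> anm H -> anm (fun z => F z - H z).
Proof. by move=> Fa Ha; apply: anmD => //; exact: anmN. Qed.

Lemma anmZ f F : an f -> anm F -> anm (fun z => f z *: F z).
Proof.
by move=> fa Fa i j; apply: an_eq (anM fa (Fa i j)) => z _; rewrite mxE.
Qed.

Lemma anm_deriveD F H v z : anm F -> anm H -> Omega z ->
  pd v (fun y => F y + H y) z = pd v F z + pd v H z.
Proof. by move=> Fa Ha Oz; rewrite !pdE [LHS]deriveD //; exact: anm_derivable. Qed.

Lemma anm_deriveN F v z : anm F -> Omega z ->
  pd v (fun y => - F y) z = - pd v F z.
Proof. by move=> Fa Oz; rewrite !pdE [LHS]deriveN //; exact: anm_derivable. Qed.

Lemma anm_deriveB F H v z : anm F -> anm H -> Omega z ->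
  pd v (fun y => F y - H y) z = pd v F z - pd v H z.
Proof. by move=> Fa Ha Oz; rewrite !pdE [LHS]deriveB //; exact: anm_derivable. Qed.

Lemma anm_deriveZ f F v z : an f -> anm F -> Omega z ->
  pd v (fun y => f y *: F y) z = pd v f z *: F z + f z *: pd v F z.
Proof.
move=> fa Fa Oz; apply/matrixP => i j.
rewrite anm_deriveE //; last exact: anmZ.
rewrite !mxE anm_deriveE // -an_deriveM //.
by congr (pd v _ z); apply/funext => y; rewrite mxE.
Qed.

Lemma anm_derive_dirD F v w z : anm F -> Omega z ->
  pd (v + w) F z = pd v F z + pd w F z.
Proof.
move=> Fa Oz; apply/matrixP => i j; rewrite mxE.
apply: etrans (anm_deriveE _ i j Fa Oz) _.
apply: etrans (an_derive_dirD v w (Fa i j) Oz) _.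
by congr (_ + _); apply/esym/anm_deriveE.
Qed.

Lemma anm_derive_dirZ F (c : R) v z : anm F -> Omega z ->
  pd (c *: v) F z = c *: pd v F z.
Proof.
move=> Fa Oz; apply/matrixP => i j; rewrite mxE.
apply: etrans (anm_deriveE _ i j Fa Oz) _.
apply: etrans (an_derive_dirZ c v (Fa i j) Oz) _.
by congr (_ * _); apply/esym/anm_deriveE.
Qed.

Lemma anm_deriveC F v w z : anm F -> Omega z ->
  pd v (pd w F) z = pd w (pd v F) z.
Proof.
move=> Fa Oz; apply/matrixP => i j.
have dE v' w' : pd v' (pd w' F) z i j = pd v' (pd w' (fun y => F y i j)) z.
  rewrite anm_deriveE //; last exact: anm_derive.
  by apply: (@eq_derive_on R) => // y Oy; rewrite anm_deriveE.
apply: etrans (dE v w) _; apply: etrans (esym (dE w v)).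
exact: an_deriveC.
Qed.

End Matrices.

Lemma anm_mulmx a b c (F : E -> 'M[R]_(a, b)) (H : E -> 'M[R]_(b, c)) :
  anm F -> anm H -> anm (fun z => F z *m H z).
Proof.
move=> Fa Ha i j.
apply: an_eq (an_sum (index_enum _) predT (fun k => anM (Fa i k) (Ha k j))) => z _.
by rewrite mxE.
Qed.

Lemma anm_deriveM a b c (F : E -> 'M[R]_(a, b)) (H : E -> 'M[R]_(b, c)) v z :
  anm F -> anm H -> Omega z ->
  pd v (fun y => F y *m H y) z = pd v F z *m H z + F z *m pd v H z.
Proof.
move=> Fa Ha Oz; apply/matrixP => i j.
rewrite anm_deriveE //; last exact: anm_mulmx.
rewrite !mxE -big_split /=.
rewrite (_ : (fun y => _) = (fun y => \sum_k F y i k * H y k j)); last first.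
  by apply/funext => y; rewrite mxE.
rewrite an_derive_sum // => [|k]; last exact: anM.
by apply: eq_bigr => k _; rewrite an_deriveM // !anm_deriveE.
Qed.

Lemma anm_tr a b (F : E -> 'M[R]_(a, b)) : anm F -> anm (fun z => (F z)^T).
Proof.
by move=> Fa i j; apply: an_eq (Fa j i) => z _; rewrite mxE.
Qed.

Lemma anm_deriveT a b (F : E -> 'M[R]_(a, b)) v z : anm F -> Omega z ->
  pd v (fun y => (F y)^T) z = (pd v F z)^T.
Proof.
move=> Fa Oz; apply/matrixP => i j.
rewrite anm_deriveE //; last exact: anm_tr.
rewrite mxE anm_deriveE //; congr (pd v _ z).
by apply/funext => y; rewrite mxE.
Qed.

Lemma an_det k (F : E -> 'M[R]_k) : anm F -> an (fun z => \det (F z)).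
Proof.
move=> Fa; apply: an_sum => s; apply: anM; first exact: an_cst.
by apply: an_prod => i; exact: Fa.
Qed.

Lemma anm_inv k (F : E -> 'M[R]_k) : (forall z, Omega z -> F z \in unitmx) ->
  anm F -> anm (fun z => invmx (F z)).
Proof.
move=> uF Fa.
apply: (@anm_eq _ _ (fun z => (\det (F z))^-1 *: \adj (F z))).
  by move=> z Oz; rewrite /invmx uF.
apply: anmZ.
  apply: anV; last exact: an_det.
  by move=> z /uF; rewrite unitmxE unitfE.
move=> i j; apply: (@an_eq (fun z => cofactor (F z) j i)).
  by move=> z _; rewrite mxE.
apply: anM; first exact: an_cst.
by apply: an_det => i' j'; apply: an_eq (Fa (lift j i') (lift i j')) => z _; rewrite !mxE.
Qed.

Lemma an_bil k (F : E -> 'M[R]_k) (X Y : E -> 'rV[R]_k) :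
  anm F -> anm X -> anm Y -> an (fun z => bl (F z) (X z) (Y z)).
Proof.
move=> Fa Xa Ya; rewrite blE.
have := anm_mulmx (anm_mulmx Xa Fa) (anm_tr Ya); exact.
Qed.

Lemma an_derive_bil k (F : E -> 'M[R]_k) (X Y : E -> 'rV[R]_k) v z :
  anm F -> anm X -> anm Y -> Omega z ->
  pd v (fun y => bl (F y) (X y) (Y y)) z =
    bl (pd v F z) (X z) (Y z) + bl (F z) (pd v X z) (Y z)
    + bl (F z) (X z) (pd v Y z).
Proof.
move=> Fa Xa Ya Oz; rewrite blE.
rewrite -(anm_deriveE v 0 0 (anm_mulmx (anm_mulmx Xa Fa) (anm_tr Ya)) Oz).
rewrite anm_deriveM //; [|exact: anm_mulmx|exact: anm_tr].
rewrite anm_deriveM // anm_deriveT // mulmxDl [pd v X z *m F z *m _ + _]addrC.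
by rewrite /bil ![in RHS]mxE mxE [X in X + _]mxE ![in LHS]mxE.
Qed.

Lemma an_dir f (w : E -> E) : an f -> anm w -> an (fun z => pd (w z) f z).
Proof.
move=> fa wa; apply: an_eq (an_sum (index_enum _) predT
  (fun i => anM (wa 0 i) (an_derive (delta_mx 0 i) fa))) => z Oz /=.
by rewrite (pd_partials _ fa Oz).
Qed.

Lemma anm_dir a b (F : E -> 'M[R]_(a, b)) (w : E -> E) : anm F -> anm w ->
  anm (fun z => pd (w z) F z).
Proof.
move=> Fa wa i j; apply: an_eq (an_dir (Fa i j) wa) => z Oz.
by rewrite anm_deriveE.
Qed.

Lemma an_derive_dir f (w : E -> E) v z : an f -> anm w -> Omega z ->
  pd v (fun y => pd (w y) f y) z =
    pd (pd v w z) f z + pd (w z) (pd v f) z.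
Proof.
move=> fa wa Oz.
rewrite (@eq_derive_on R _
   (fun y => \sum_(j < m) w y 0 j * pd (delta_mx 0 j) f y)) //; last first.
  by move=> y Oy; rewrite (pd_partials _ fa Oy).
rewrite an_derive_sum // => [|j]; last first.
  by apply: anM; [exact: wa|exact: an_derive].
rewrite [X in _ = X + _](pd_partials _ fa Oz).
rewrite [X in _ = _ + X](pd_partials _ (an_derive v fa) Oz).
rewrite -big_split; apply: eq_bigr => j _ /=.
rewrite (an_deriveM v (wa 0 j) (an_derive (delta_mx 0 j) fa) Oz).
by rewrite (anm_deriveE v 0 j wa Oz) (an_deriveC v _ fa Oz).
Qed.

Lemma anm_derive_dir a b (F : E -> 'M[R]_(a, b)) (w : E -> E) v z :
  anm F -> anm w -> Omega z ->
  pd v (fun y => pd (w y) F y) z = pd (pd v w z) F z + pd (w z) (pd v F) z.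
Proof.
move=> Fa wa Oz; apply/matrixP => i j.
rewrite mxE; apply: etrans (anm_deriveE v i j (anm_dir Fa wa) Oz) _.
apply: etrans (_ : pd v (fun y => pd (w y) (fun x => F x i j) y) z = _).
  by apply: (@eq_derive_on R) => // y Oy; exact: anm_deriveE.
apply: etrans (an_derive_dir v (Fa i j) wa Oz) _; congr (_ + _); apply/esym.
  exact: anm_deriveE.
apply: etrans (anm_deriveE _ i j (anm_derive v Fa) Oz) _.
by apply: (@eq_derive_on R) => // y Oy; exact: anm_deriveE.
Qed.

End Calculus.

Arguments an_cst {R m Omega} c.
Arguments anm_cst {R m Omega a b} M.

(** * Order of vanishing on a slice and the identity theorem *)

Section Uniqueness.
Context (R : realType) (m : nat) (Omega : open_domain R m).
Variable i0 : 'I_m.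
Local Notation E := 'rV[R]_m.
Local Notation an := (an Omega).
Local Notation anm := (anm Omega).
Local Notation e0 := (delta_mx 0 i0 : E).
Implicit Types (f g : E -> R) (v w z : E).

(** The derivatives of order less than k in the direction [e0] transversal to the slice vanish on
    it. Derivatives along the slice are not recorded, since [flat_derive] recovers them. *)
Fixpoint flat k f : Prop :=
  if k is k'.+1 then
    [/\ an f, forall z, Omega z -> z 0 i0 = 0 -> f z = 0 & flat k' (pd e0 f)]
  else an f.

Lemma flat_an k f : flat k f -> an f.
Proof. by case: k => [|k] // []. Qed.

Lemma flat_eq k f g : (forall z, Omega z -> f z = g z) -> flat k f -> flat k g.
Proof.
elim: k f g => [|k ih] f g fg; first by move=> /= fa; exact: an_eq fa.
move=> [fa f0 fk]; split; first exact: an_eq fa.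
  by move=> z Oz z0; rewrite -fg // f0.
  apply: ih fk => z Oz. exact: eq_derive_on fg Oz.
Qed.

Lemma flatW k f : flat k.+1 f -> flat k f.
Proof.
elim: k f => [|k ih] f; first by case.
by move=> [fa f0 fk]; split => //; exact: ih.
Qed.

Lemma flat0 k : flat k (fun=> 0).
Proof.
elim: k => [|k ih]; first exact: an_cst.
split=> //; first exact: an_cst.
by apply: flat_eq ih => z _; rewrite pd_cst.
Qed.

Lemma flatD k f g : flat k f -> flat k g -> flat k (fun z => f z + g z).
Proof.
elim: k f g => [|k ih] f g; first exact: anD.
move=> [fa f0 fk] [ga g0 gk]; split; first exact: anD.
  by move=> z Oz z0; rewrite f0 // g0 // addr0.
by apply: flat_eq (ih _ _ fk gk) => z Oz; rewrite (an_deriveD _ fa ga Oz).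
Qed.

Lemma flatM k a f : an a -> flat k f -> flat k (fun z => a z * f z).
Proof.
elim: k a f => [|k ih] a f aa; first exact: anM.
move=> hf; have [fa f0 fk] := hf; split; first exact: anM.
  by move=> z Oz z0; rewrite f0 // mulr0.
apply: flat_eq (flatD (ih _ _ (an_derive e0 aa) (flatW hf)) (ih _ _ aa fk)).
by move=> z Oz; rewrite (an_deriveM _ aa fa Oz).
Qed.

Lemma flatMr k a f : an a -> flat k f -> flat k (fun z => f z * a z).
Proof.
by move=> aa fk; apply: flat_eq (flatM aa fk) => z _; rewrite mulrC.
Qed.

Lemma flatN k f : flat k f -> flat k (fun z => - f z).
Proof.
move=> fk; apply: flat_eq (flatM (an_cst (- 1)) fk) => z _.
exact: mulN1r.
Qed.

Lemma flatB k f g : flat k f -> flat k g -> flat k (fun z => f z - g z).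
Proof. by move=> fk gk; apply: flatD => //; exact: flatN. Qed.

Lemma flat_sum k (I : Type) (s : seq I) (F : I -> E -> R) :
  (forall i, flat k (F i)) -> flat k (fun z => \sum_(i <- s) F i z).
Proof.
move=> Fk; elim: s => [|i s ih].
  by apply: flat_eq (flat0 k) => z _; rewrite big_nil.
by apply: flat_eq (flatD (Fk i) ih) => z _; rewrite big_cons.
Qed.

Lemma derive_slice0 f v z : (forall z, Omega z -> z 0 i0 = 0 -> f z = 0) ->
  v 0 i0 = 0 -> Omega z -> z 0 i0 = 0 -> pd v f z = 0.
Proof.
move=> f0 v0 Oz z0; rewrite pdE; apply: cvg_lim => //; apply: cvg_near_cst.
have cz : (fun h : R => h *: v + z) @ 0 --> z.
  rewrite -[X in _ --> X]add0r -(scale0r v); apply: cvgD; last exact: cvg_cst.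
  by apply: cvgZr_tmp; exact: cvg_id.
have := cz _ (Omega_near Oz) => On.
have {}On : \forall h \near (0 : R)^', Omega (h *: v + z).
  exact: (@nbhs_dnbhs _ (0 : R)).
near=> h; rewrite /= f0 ?[f z]f0 ?subr0 ?scaler0 //.
  by near: h; exact: On.
by rewrite !mxE v0 z0 mulr0 addr0.
Unshelve. all: by end_near. Qed.

(** A function that vanishes on the slice has zero derivatives along it, and these commute with the
    transversal derivative. That no order is lost is what allows spatial derivatives in the
    evolution system. *)
Lemma flat_derive k f v : v 0 i0 = 0 -> flat k f -> flat k (pd v f).
Proof.
move=> v0; elim: k f => [|k ih] f; first exact: an_derive.
move=> [fa f0 fk]; split; first exact: an_derive.
  by move=> z Oz z0; exact: derive_slice0.
by apply: flat_eq (ih _ fk) => z Oz; rewrite (an_deriveC _ _ fa Oz).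
Qed.

(** A transversal partial derivative lowers the order by one and a tangential one keeps it, so
    flatness of all orders survives any word of partial derivatives. *)
Lemma flat_slice f : (forall k, flat k f) -> forall s z, Omega z -> z 0 i0 = 0 ->
  partials s f z = 0.
Proof.
move=> fk s; have : forall k, flat k (partials s f).
  elim: s => //= i s ih k; rewrite -pdE; have [->|ii0] := eqVneq i i0.
    by have [] := ih k.+1.
  by apply: flat_derive => //; rewrite mxE eq_sym (negPf ii0) andbF.
by move=> /(_ 1%N) [].
Qed.

Lemma flat_eq0 f z : (forall k, flat k f) -> Omega z -> z 0 i0 = 0 ->
  \forall y \near z, f y = 0.
Proof.
move=> fk Oz z0; apply: analytic_germ_eq0.
  exact: (flat_an (fk 0%N)).
by move=> s; exact: flat_slice.
Qed.

Definition flatm k a b (F : E -> 'M[R]_(a, b)) :=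
  forall i j, flat k (fun z => F z i j).

Lemma flatm_anm k a b (F : E -> 'M[R]_(a, b)) : flatm k F -> anm F.
Proof. by move=> Fk i j; exact: flat_an (Fk i j). Qed.

Lemma flatmMl k a b c (F : E -> 'M[R]_(a, b)) (H : E -> 'M[R]_(b, c)) :
  flatm k F -> anm H -> flatm k (fun z => F z *m H z).
Proof.
move=> Fk Ha i j; apply: flat_eq (flat_sum (index_enum _)
  (fun l => flatMr (Ha l j) (Fk i l))) => z _; by rewrite mxE.
Qed.

Lemma flatmMr k a b c (F : E -> 'M[R]_(a, b)) (H : E -> 'M[R]_(b, c)) :
  anm F -> flatm k H -> flatm k (fun z => F z *m H z).
Proof.
move=> Fa Hk i j; apply: flat_eq (flat_sum (index_enum _)
  (fun l => flatM (Fa i l) (Hk l j))) => z _; by rewrite mxE.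
Qed.

Lemma flatm_tr k a b (F : E -> 'M[R]_(a, b)) :
  flatm k F -> flatm k (fun z => (F z)^T).
Proof. by move=> Fk i j; apply: flat_eq (Fk j i) => z _; rewrite mxE. Qed.

Lemma flatm_derive k a b (F : E -> 'M[R]_(a, b)) v : v 0 i0 = 0 ->
  flatm k F -> flatm k (pd v F).
Proof.
move=> v0 Fk i j; apply: flat_eq (flat_derive v0 (Fk i j)) => z Oz.
by rewrite (anm_deriveE _ _ _ (flatm_anm Fk) Oz).
Qed.

Lemma flat_bill k l (F : E -> 'M[R]_l) (X Y : E -> 'rV[R]_l) :
  anm F -> flatm k X -> anm Y -> flat k (fun z => bl (F z) (X z) (Y z)).
Proof.
move=> Fa Xk Ya; rewrite blE; exact: (flatmMl (flatmMl Xk Fa) (anm_tr Ya) 0 0).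
Qed.

Lemma flat_bilr k l (F : E -> 'M[R]_l) (X Y : E -> 'rV[R]_l) :
  anm F -> anm X -> flatm k Y -> flat k (fun z => bl (F z) (X z) (Y z)).
Proof.
move=> Fa Xa Yk; rewrite blE.
exact: (flatmMr (anm_mulmx Xa Fa) (flatm_tr Yk) 0 0).
Qed.

Lemma flat_dir k f (w : E -> E) : an f -> flatm k w ->
  flat k (fun z => pd (w z) f z).
Proof.
move=> fa wk; apply: flat_eq (flat_sum (index_enum _)
  (fun i => flatMr (an_derive (delta_mx 0 i) fa) (wk 0 i))) => z Oz /=.
by rewrite (pd_partials _ fa Oz).
Qed.

Lemma flatm_dir k a b (F : E -> 'M[R]_(a, b)) (w : E -> E) :
  anm F -> flatm k w -> flatm k (fun z => pd (w z) F z).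
Proof.
move=> Fa wk i j; apply: flat_eq (flat_dir (Fa i j) wk) => z Oz.
by rewrite (anm_deriveE _ _ _ Fa Oz).
Qed.

(** Counterpart of [flat_dir], where the direction is the flat object. Here the function is flat,
    and a field tangent to the slice never differentiates in the direction [e0]. *)
Lemma flat_along k f (w : E -> E) : (forall z, w z 0 i0 = 0) -> anm w ->
  flat k f -> flat k (fun z => pd (w z) f z).
Proof.
move=> w0 wa fk.
pose F i z := if i == i0 then 0 else w z 0 i * pd (delta_mx 0 i) f z.
have Fk i : flat k (F i).
  rewrite /F; case: eqP => [_|/eqP ii0]; first exact: flat0.
  apply: flatM; first exact: wa.
  by apply: flat_derive => //; rewrite mxE eq_sym (negPf ii0) andbF.
apply: flat_eq (flat_sum (index_enum _) Fk) => z Oz.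
rewrite (pd_partials _ (flat_an fk) Oz).
by apply: eq_bigr => i _; rewrite /F; case: eqP => // ->; rewrite w0 mul0r.
Qed.

Lemma flatm_along k a b (F : E -> 'M[R]_(a, b)) (w : E -> E) :
  (forall z, w z 0 i0 = 0) -> anm w -> flatm k F ->
  flatm k (fun z => pd (w z) F z).
Proof.
move=> w0 wa Fk i j; apply: flat_eq (flat_along w0 wa (Fk i j)) => z Oz.
by rewrite (anm_deriveE _ _ _ (flatm_anm Fk) Oz).
Qed.

(** Every iterated partial derivative is continuous at z and vanishes at points y arbitrarily close
    to z, hence at z itself; the power series at z is then zero. *)
Lemma an_eq0_closure f z : an f -> Omega z ->
  (forall N, nbhs z N -> exists2 y, N y & \forall x \near y, f x = 0) ->
  \forall x \near z, f x = 0.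
Proof.
move=> fa Oz fz; apply: analytic_germ_eq0; first exact: fa.
have p0 s y : (\forall x \near y, f x = 0) -> partials s f y = 0.
  move=> fy; have : \forall x \near y, partials s f x = 0.
    elim: s => //= i s ih.
    have /nbhs_interior := ih; apply: filterS => x fx.
    rewrite (@near_eq_derive _ _ _ _ (fun=> 0)) ?derive_cst //.
  exact: nbhs_singleton.
move=> s; apply/eqP; apply: contrapT => /negP pz.
have /differentiable_continuous cp :=
  analytic_germ_differentiable (analytic_germ_partials s (fa z Oz)).
have /fz [y py] : \forall x \near z, partials s f x != 0.
  exact: (cvgr_neq0 _ cp pz).
by move=> /p0 h; rewrite h eqxx in py.
Qed.

End Uniqueness.

(** * The evolution of the parallelism defects *)

Section Bilinear.
Context (R : realType) (n : nat).
Implicit Types (M N : 'M[R]_n) (v w : 'rV[R]_n).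

Lemma bilDl M v v' w : bl M (v + v') w = bl M v w + bl M v' w.
Proof. by rewrite !blE /bil !mulmxDl mxE. Qed.
Lemma bilDr M v w w' : bl M v (w + w') = bl M v w + bl M v w'.
Proof. by rewrite !blE /bil linearD mulmxDr mxE. Qed.
Lemma bilZl M a v w : bl M (a *: v) w = a * bl M v w.
Proof. by rewrite !blE /bil -!scalemxAl mxE. Qed.
Lemma bilZr M a v w : bl M v (a *: w) = a * bl M v w.
Proof. by rewrite !blE /bil linearZ -scalemxAr mxE. Qed.
Lemma bilNl M v w : bl M (- v) w = - bl M v w.
Proof. by rewrite -scaleN1r bilZl mulN1r. Qed.
Lemma bilNr M v w : bl M v (- w) = - bl M v w.
Proof. by rewrite -scaleN1r bilZr mulN1r. Qed.
Lemma bilBl M v v' w : bl M (v - v') w = bl M v w - bl M v' w.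
Proof. by rewrite bilDl bilNl. Qed.
Lemma bilBr M v w w' : bl M v (w - w') = bl M v w - bl M v w'.
Proof. by rewrite bilDr bilNr. Qed.
Lemma bilDm M N v w : bl (M + N) v w = bl M v w + bl N v w.
Proof. by rewrite !blE /bil mulmxDr mulmxDl mxE. Qed.
Lemma bilZm M a v w : bl (a *: M) v w = a * bl M v w.
Proof. by rewrite !blE /bil -scalemxAr -scalemxAl mxE. Qed.
Lemma bil0l M w : bl M 0 w = 0.
Proof. by rewrite !blE /bil !mul0mx mxE. Qed.
Lemma bil0r M v : bl M v 0 = 0.
Proof. by rewrite !blE /bil trmx0 mulmx0 mxE. Qed.
Lemma bil0m v w : bl (0 : 'M[R]_n) v w = 0.
Proof. by rewrite !blE /bil mulmx0 mul0mx mxE. Qed.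
Definition bil_lin := (bilDl, bilDr, bilBl, bilBr, bilZl, bilZr, bilNl, bilNr,
  bilDm, bilZm).

Lemma bl_sym M v w : M^T = M -> bl M v w = bl M w v.
Proof. by rewrite blE; exact: bil_sym. Qed.

Lemma bil_sumr M v w : bl M v w = \sum_k w 0 k * bl M v (delta_mx 0 k).
Proof.
rewrite {1}[w]row_sum_delta; elim: (index_enum _) => [|k s ih].
  by rewrite !big_nil bil0r.
by rewrite !big_cons bilDr bilZr ih.
Qed.

Lemma bil_row (F : 'I_n -> R) M w : M \in unitmx ->
  bl M ((\row_k F k) *m invmx M) w = \sum_k w 0 k * F k.
Proof.
move=> uM; rewrite !blE /bil mulmxKV // mxE; apply: eq_bigr => k _.
by rewrite !mxE mulrC.
Qed.

Lemma bil_inj M v v' : M \in unitmx -> (forall w, bl M v w = bl M v' w) ->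
  v = v'.
Proof.
move=> uM vv; suff H : v *m M = v' *m M by rewrite -(mulmxK uM v) H mulmxK.
apply/rowP => k; have := vv (delta_mx 0 k).
by rewrite !blE /bil trmx_delta -!colE !mxE.
Qed.

Lemma bil_sharpl (G H : 'M[R]_n) v w : G \in unitmx -> G^T = G -> H^T = H ->
  bl G (v *m sharp G H) w = bl H v w.
Proof. by move=> uG sG sH; rewrite bl_sym // blE sharpP // -blE bl_sym. Qed.
End Bilinear.

Section Geometry.
Context (R : realType) (n : nat) (Omega : open_domain R (1 + n)).
Local Notation Z := 'rV[R]_(1 + n).
Local Notation V := 'rV[R]_n.
Context (G : Z -> 'M[R]_n) (U : Z -> V) (u l : Z -> R).
Hypothesis Ga : anm Omega G.
Hypothesis Ua : anm Omega U.
Hypothesis ua : an Omega u.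
Hypothesis la : an Omega l.
Hypothesis Gsym : forall z, Omega z -> (G z)^T = G z.
Hypothesis Gunit : forall z, Omega z -> G z \in unitmx.
Hypothesis u0 : forall z, Omega z -> u z != 0.
Hypothesis l0 : forall z, Omega z -> l z != 0.
Implicit Types (z : Z) (v w X Y : V).

(* Coordinate 0 of z is the time t; G, U, u, l stand for g_t, U_t, u_t, lambda.
   et is d/dt and sp v is the vector v of M, so that pd et is the dot, while
   Gam is the Christoffel vector of g_t. *)
Definition sp v : Z := row_mx 0 v.
Definition et : Z := row_mx 1%:M 0.

Lemma spD v w : sp (v + w) = sp v + sp w.
Proof. by rewrite /sp add_row_mx addr0. Qed.
Lemma spZ a v : sp (a *: v) = a *: sp v.
Proof. by rewrite /sp scale_row_mx scaler0. Qed.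

Lemma sp0 : sp 0 = 0.
Proof. by rewrite /sp row_mx0. Qed.

Lemma anm_row_mx (p q : nat) (F : Z -> 'rV[R]_p) (H : Z -> 'rV[R]_q) :
  anm Omega F -> anm Omega H -> anm Omega (fun z => row_mx (F z) (H z)).
Proof.
move=> Fa Ha i j; case E: (fintype.split j) => [k|k].
  by apply: an_eq (Fa i k) => z _; rewrite mxE E.
by apply: an_eq (Ha i k) => z _; rewrite mxE E.
Qed.

Lemma sp_an (X : Z -> V) : anm Omega X -> anm Omega (fun z => sp (X z)).
Proof. by move=> Xa; apply: anm_row_mx => //; exact: anm_cst. Qed.

Lemma sp_derive (X : Z -> V) (w : Z) z : anm Omega X -> Omega z ->
  pd w (fun y => sp (X y)) z = sp (pd w X z).
Proof.
move=> Xa Oz; apply/rowP => j.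
rewrite (anm_deriveE _ _ _ (sp_an Xa) Oz) mxE; case E: (fintype.split j) => [k|k].
  rewrite mxE -[RHS](pd_cst (0 : R) w z).
  by congr (pd w _ z); apply/funext => y; rewrite mxE E mxE.
rewrite (anm_deriveE _ _ _ Xa Oz).
by congr (pd w _ z); apply/funext => y; rewrite mxE E.
Qed.

Definition time_index : 'I_(1 + n) := lshift n ord0.

Lemma etE : et = delta_mx 0 time_index.
Proof.
rewrite /et; apply/rowP => j; rewrite [LHS]mxE [RHS]mxE eqxx /=.
case: (splitP j) => k jk.
  by rewrite (ord1 k) mxE eqxx; case: eqP => // h; case: h; apply/val_inj; rewrite /= jk (ord1 k).
by rewrite mxE; case: eqP => // jt; move: jk; rewrite jt.
Qed.

Lemma sp_time v : sp v 0 time_index = 0.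
Proof. by rewrite /sp /time_index row_mxEl mxE. Qed.

Local Opaque sp et.

(** The form H is arbitrary because the t-derivative of the Christoffel vector involves the same
    expression with [Gd] in place of the metric. *)
Definition koszul (H : Z -> 'M[R]_n) z v w y : R :=
  2^-1 * (bl (pd (sp v) H z) w y + bl (pd (sp w) H z) v y
          - bl (pd (sp y) H z) v w).

Definition Gam z v w : V :=
  (\row_k koszul G z v w (delta_mx 0 k)) *m invmx (G z).

Lemma dspD (a b : nat) (F : Z -> 'M[R]_(a, b)) v w z : anm Omega F -> Omega z ->
  pd (sp (v + w)) F z = pd (sp v) F z + pd (sp w) F z.
Proof. by move=> Fa Oz; rewrite spD (anm_derive_dirD _ _ Fa Oz). Qed.

Lemma dspZ (a b : nat) (F : Z -> 'M[R]_(a, b)) c v z : anm Omega F -> Omega z ->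
  pd (sp (c *: v)) F z = c *: pd (sp v) F z.
Proof. by move=> Fa Oz; rewrite spZ (anm_derive_dirZ _ _ Fa Oz). Qed.

Lemma dsp_scD (f : Z -> R) v w z : an Omega f -> Omega z ->
  pd (sp (v + w)) f z = pd (sp v) f z + pd (sp w) f z.
Proof. by move=> fa Oz; rewrite spD (an_derive_dirD _ _ fa Oz). Qed.

Lemma dsp_scZ (f : Z -> R) c v z : an Omega f -> Omega z ->
  pd (sp (c *: v)) f z = c * pd (sp v) f z.
Proof. by move=> fa Oz; rewrite spZ (an_derive_dirZ _ _ fa Oz). Qed.

Lemma dsp_scB (f : Z -> R) v w z : an Omega f -> Omega z ->
  pd (sp (v - w)) f z = pd (sp v) f z - pd (sp w) f z.
Proof.
by move=> fa Oz; rewrite -scaleN1r (dsp_scD _ _ fa Oz) (dsp_scZ _ _ fa Oz) mulN1r.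
Qed.

Lemma dsp_sum (a b : nat) (F : Z -> 'M[R]_(a, b)) v z : anm Omega F -> Omega z ->
  pd (sp v) F z = \sum_k v 0 k *: pd (sp (delta_mx 0 k)) F z.
Proof.
move=> Fa Oz; rewrite {1}[v]row_sum_delta; elim: (index_enum _) => [|k s ih].
  by rewrite !big_nil sp0 pd0.
by rewrite !big_cons (dspD _ _ Fa Oz) (dspZ _ _ Fa Oz) ih.
Qed.

Lemma dsp_sc_sum (f : Z -> R) v z : an Omega f -> Omega z ->
  pd (sp v) f z = \sum_k v 0 k * pd (sp (delta_mx 0 k)) f z.
Proof.
move=> fa Oz; rewrite {1}[v]row_sum_delta; elim: (index_enum _) => [|k s ih].
  by rewrite !big_nil sp0 pd0.
by rewrite !big_cons (dsp_scD _ _ fa Oz) (dsp_scZ _ _ fa Oz) ih.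
Qed.

Lemma koszul_sum H z v w y : anm Omega H -> Omega z ->
  koszul H z v w y = \sum_k y 0 k * koszul H z v w (delta_mx 0 k).
Proof.
move=> Ha Oz; rewrite /koszul.
have -> : bl (pd (sp y) H z) v w =
    \sum_k y 0 k * bl (pd (sp (delta_mx 0 k)) H z) v w.
  rewrite (dsp_sum y Ha Oz); elim: (index_enum _) => [|k s ih].
    by rewrite !big_nil bil0m.
  by rewrite !big_cons bilDm bilZm ih.
move: (pd (sp v) H z) (pd (sp w) H z) => M1 M2.
rewrite (bil_sumr M1 w y) (bil_sumr M2 v y) -big_split -sumrB mulr_sumr /=.
by apply: eq_bigr => k _; ring.
Qed.

Lemma GamE z v w y : Omega z -> bl (G z) (Gam z v w) y = koszul G z v w y.
Proof.
by move=> Oz; rewrite (koszul_sum _ _ _ Ga Oz) /Gam bil_row //; exact: Gunit.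
Qed.

Lemma derive_sym (w : Z) (H : Z -> 'M[R]_n) z : anm Omega H ->
  (forall z, Omega z -> (H z)^T = H z) -> Omega z ->
  (pd w H z)^T = pd w H z.
Proof.
by move=> Ha Hs Oz; rewrite -(anm_deriveT _ Ha Oz); exact: eq_derive_on Hs Oz.
Qed.

Lemma dG_compat z v p q : Omega z ->
  bl (pd (sp v) G z) p q = bl (G z) (Gam z v p) q + bl (G z) p (Gam z v q).
Proof.
move=> Oz; rewrite [bl (G z) p _]bl_sym ?Gsym // !GamE // /koszul.
rewrite [bl (pd (sp v) G z) q p]bl_sym ?derive_sym //.
rewrite [bl (pd (sp p) G z) v q]bl_sym ?derive_sym //.
by rewrite [bl (pd (sp p) G z) q v]bl_sym ?derive_sym //; field.
Qed.

Lemma GamC z v w : Omega z -> Gam z v w = Gam z w v.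
Proof.
move=> Oz; apply: (bil_inj (Gunit Oz)) => y; rewrite !GamE // /koszul.
by rewrite [bl (pd (sp y) G z) v w]bl_sym ?derive_sym //; ring.
Qed.

Lemma GamDr z v w w' : Omega z -> Gam z v (w + w') = Gam z v w + Gam z v w'.
Proof.
move=> Oz; apply: (bil_inj (Gunit Oz)) => y; rewrite bilDl !GamE // /koszul.
by rewrite !bilDl !bilDr (dspD _ _ Ga Oz) !bilDm; ring.
Qed.

Lemma GamZr z v a w : Omega z -> Gam z v (a *: w) = a *: Gam z v w.
Proof.
move=> Oz; apply: (bil_inj (Gunit Oz)) => y; rewrite bilZl !GamE // /koszul.
by rewrite !bilZl !bilZr (dspZ _ _ Ga Oz) !bilZm; ring.
Qed.

Lemma GamDl z v v' w : Omega z -> Gam z (v + v') w = Gam z v w + Gam z v' w.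
Proof. by move=> Oz; rewrite GamC // GamDr // !(GamC w). Qed.

Lemma GamZl z a v w : Omega z -> Gam z (a *: v) w = a *: Gam z v w.
Proof. by move=> Oz; rewrite GamC // GamZr // GamC. Qed.

Lemma Gam0l z w : Omega z -> Gam z 0 w = 0.
Proof. by move=> Oz; rewrite -[X in Gam z X](scale0r (0 : V)) GamZl // scale0r. Qed.

Lemma GamBr z v w w' : Omega z -> Gam z v (w - w') = Gam z v w - Gam z v w'.
Proof. by move=> Oz; rewrite GamDr // -scaleN1r GamZr // scaleN1r. Qed.

Lemma koszul_an H (X1 X2 X3 : Z -> V) : anm Omega H -> anm Omega X1 ->
  anm Omega X2 -> anm Omega X3 ->
  an Omega (fun z => koszul H z (X1 z) (X2 z) (X3 z)).
Proof.
move=> Ha a1 a2 a3; apply: anM; first exact: an_cst.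
by apply: anB; [apply: anD|]; apply: an_bil => //; apply: anm_dir => //; exact: sp_an.
Qed.

Lemma invG_an : anm Omega (fun z => invmx (G z)).
Proof. exact: anm_inv. Qed.

Lemma anm_row k (F : Z -> 'I_k -> R) : (forall i, an Omega (fun z => F z i)) ->
  anm Omega (fun z => \row_i F z i).
Proof. by move=> Fa i j; apply: an_eq (Fa j) => z _; rewrite mxE. Qed.

Lemma Gam_an (X1 X2 : Z -> V) : anm Omega X1 -> anm Omega X2 ->
  anm Omega (fun z => Gam z (X1 z) (X2 z)).
Proof.
move=> a1 a2; apply: anm_mulmx; last exact: invG_an.
by apply: anm_row => k; apply: koszul_an => //; exact: anm_cst.
Qed.

Definition nablaU z v : V := pd (sp v) U z + Gam z v (U z).
(** The endomorphism nabla U as a matrix acting on row vectors, which can be differentiated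
    entrywise. *)
Definition NM z : 'M[R]_n := \matrix_i nablaU z (delta_mx 0 i).

Lemma nablaUM z v : Omega z -> nablaU z v = v *m NM z.
Proof.
move=> Oz; apply/rowP => j; rewrite [RHS]mxE.
have -> : nablaU z v = \sum_k v 0 k *: nablaU z (delta_mx 0 k).
  rewrite {1}[v]row_sum_delta; elim: (index_enum _) => [|k s ih].
    rewrite !big_nil /nablaU sp0 pd0 add0r.
    by rewrite Gam0l.
  rewrite !big_cons -ih /nablaU (dspD _ _ Ua Oz) (dspZ _ _ Ua Oz) GamDl // GamZl //.
  by rewrite scalerDr addrACA.
by rewrite summxE; apply: eq_bigr => k _; rewrite !mxE.
Qed.

Lemma nablaU_an (X : Z -> V) : anm Omega X -> anm Omega (fun z => nablaU z (X z)).
Proof.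
move=> Xa; apply: anmD; last exact: Gam_an.
by apply: anm_dir => //; exact: sp_an.
Qed.

Lemma NM_an : anm Omega NM.
Proof.
move=> i j; have Na := nablaU_an (anm_cst (delta_mx 0 i)).
by apply: an_eq (Na 0 j) => z _; rewrite [in RHS]mxE.
Qed.

(** [Gd], [S], [h] and [L] are g_t', its endomorphism g_t'^#, the form g_t' / lambda and grad^t
    lambda. *)
Definition Gd := pd et G.
Definition S z := sharp (G z) (Gd z).
Definition h z := (l z)^-1 *: Gd z.
Definition L z : V := (\row_k pd (sp (delta_mx 0 k)) l z) *m invmx (G z).

Lemma Gd_an : anm Omega Gd. Proof. exact: anm_derive. Qed.
Lemma Gd_sym z : Omega z -> (Gd z)^T = Gd z.
Proof. by move=> Oz; exact: derive_sym. Qed.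
Lemma il_an : an Omega (fun z => (l z)^-1). Proof. exact: anV. Qed.
Lemma h_an : anm Omega h. Proof. exact: anmZ il_an Gd_an. Qed.
Lemma S_an : anm Omega S.
Proof. by apply: anm_tr; apply: anm_mulmx; [exact: invG_an|exact: Gd_an]. Qed.
Lemma L_an : anm Omega L.
Proof.
apply: anm_mulmx; last exact: invG_an.
by apply: anm_row => k; exact: an_derive.
Qed.

Lemma LE z v : Omega z -> bl (G z) (L z) v = pd (sp v) l z.
Proof.
by move=> Oz; rewrite (dsp_sc_sum _ la Oz) /L bil_row //; exact: Gunit.
Qed.

Lemma SE z v w : Omega z -> bl (G z) (v *m S z) w = bl (Gd z) v w.
Proof. by move=> Oz; apply: bil_sharpl; [exact: Gunit|exact: Gsym|exact: Gd_sym]. Qed.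

(* With D the Levi-Civita connection of -lambda^2 dt^2 + g_t, the tangential and
   normal parts of D_X V are, up to sign and factors of lambda, X *m AM and
   Bd X, those of D_(d/dt) V are Cd and cd. *)
Definition AM z : 'M[R]_n := NM z - (u z / (2 * l z)) *: S z.
Definition Bd z v : R := pd (sp v) u z - (2 * l z)^-1 * bl (Gd z) v (U z).
Definition cd z : R := pd et u z - pd (sp (U z)) l z.
Definition Cd z : V := pd et U z - u z *: L z + 2^-1 *: (U z *m S z).

Lemma ul_an : an Omega (fun z => u z / (2 * l z)).
Proof.
apply: anM => //; apply: anV; last by apply: anM => //; exact: an_cst.
by move=> z Oz; rewrite mulf_neq0 ?l0 // pnatr_eq0.
Qed.

Lemma AM_an : anm Omega AM.
Proof. by apply: anmB; [exact: NM_an|apply: anmZ; [exact: ul_an|exact: S_an]]. Qed.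

Lemma US_an : anm Omega (fun z => U z *m S z).
Proof. by apply: anm_mulmx => //; exact: S_an. Qed.

Lemma uL_an : anm Omega (fun z => u z *: L z).
Proof. by apply: anmZ => //; exact: L_an. Qed.

Lemma US2_an : anm Omega (fun z => 2^-1 *: (U z *m S z)).
Proof. by apply: anmZ; [exact: an_cst|exact: US_an]. Qed.

Lemma Ud_an : anm Omega (pd et U). Proof. exact: anm_derive. Qed.

Lemma Cd_an : anm Omega Cd.
Proof. by apply: anmD; [apply: anmB; [exact: Ud_an|exact: uL_an]|exact: US2_an]. Qed.

(* (nabla_p H)(q, w) *)
Definition Tn (H : Z -> 'M[R]_n) z p q w : R :=
  bl (pd (sp p) H z) q w - bl (H z) (Gam z p q) w - bl (H z) q (Gam z p w).
Definition dn z p q w : R := Tn h z p q w - Tn h z q p w.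
Definition Hs z p q : R :=
  pd (sp p) (pd (sp q) l) z - pd (sp (Gam z p q)) l z.
(** R_t(X, U, U, Y) for X with constant components, so that the bracket [X, U] is the derivative of
    U along X. *)
Definition Rm z X Y : R :=
  bl (G z) (pd (sp X) (fun y => nablaU y (U y)) z + Gam z X (nablaU z (U z))
    - (pd (sp (U z)) (fun y => nablaU y X) z + Gam z (U z) (nablaU z X))
    - nablaU z (pd (sp X) U z)) Y.

(** This is g((nabla_X A)U - (nabla_U A)X, Y): the terms A(Gam(X, U)) of the two covariant
    derivatives cancel by symmetry of [Gam]. Spatial derivatives of A enter the evolution of the
    defects only in this combination. *)
Definition QA z X Y : R :=
  bl (G z) (U z *m pd (sp X) AM z + Gam z X (U z *m AM z)
    - X *m pd (sp (U z)) AM z - Gam z (U z) (X *m AM z)) Y.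

(** * Curvature in terms of the defects *)

Lemma derive_cstM (k1 k2 k3 : nat) (M : 'M[R]_(k1, k2)) (F : Z -> 'M[R]_(k2, k3)) (w : Z) z :
  anm Omega F -> Omega z -> pd w (fun y => M *m F y) z = M *m pd w F z.
Proof.
move=> Fa Oz; rewrite (anm_deriveM _ (anm_cst M) Fa Oz).
by rewrite pd_cst mul0mx add0r.
Qed.

(** The Ricci identity R(X, U)U = (nabla_X N)U - (nabla_U N)X for N = nabla U, in the shape of [QA].
    The bracket term cancels the derivative of U in the product U N. *)
Lemma Rm_NM z X Y : Omega z -> Rm z X Y =
  bl (G z) (U z *m pd (sp X) NM z + Gam z X (U z *m NM z)
    - X *m pd (sp (U z)) NM z - Gam z (U z) (X *m NM z)) Y.
Proof.
move=> Oz; rewrite /Rm !nablaUM //.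
have -> : pd (sp X) (fun y => nablaU y (U y)) z = pd (sp X) (fun y => U y *m NM y) z.
  by apply: eq_derive_on Oz => y Oy; exact: nablaUM.
have -> : pd (sp (U z)) (fun y => nablaU y X) z = pd (sp (U z)) (fun y => X *m NM y) z.
  by apply: eq_derive_on Oz => y Oy; exact: nablaUM.
rewrite (derive_cstM _ _ NM_an Oz) (anm_deriveM _ Ua NM_an Oz).
congr (bl _ _ _); have aux (a b c d e : V) :
    a + b + c - (d + e) - a = b + c - d - e.
  by rewrite -(addrA a) addrAC [a + _]addrC addrK opprD addrA.
exact: aux.
Qed.

(** The endomorphism of [h]. With N = A + (u / 2) Hm, differentiating N yields d^nabla (g' / lambda)
    exactly as it stands in the evolution equations, with no separate derivative of lambda. *)
Definition Hm z := (l z)^-1 *: S z.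
Lemma Hm_an : anm Omega Hm. Proof. by apply: anmZ; [exact: il_an|exact: S_an]. Qed.
Lemma HmE z v w : Omega z -> bl (G z) (v *m Hm z) w = bl (h z) v w.
Proof. by move=> Oz; rewrite /Hm -scalemxAr bilZl SE // /h bilZm. Qed.

Lemma dHmE z (x : Z) v w : Omega z ->
  bl (G z) (v *m pd x Hm z) w = bl (pd x h z) v w - bl (pd x G z) (v *m Hm z) w.
Proof.
move=> Oz; apply/eqP; rewrite -subr_eq opprK eq_sym; apply/eqP.
have := an_derive_bil x h_an (anm_cst v) (anm_cst w) Oz.
have := an_derive_bil x Ga (anm_mulmx (anm_cst v) Hm_an) (anm_cst w) Oz.
rewrite !pd_cst !bil0l !bil0r !addr0 (derive_cstM _ _ Hm_an Oz) addrC => <- <-.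
by apply: eq_derive_on Oz => y Oy; rewrite HmE.
Qed.

Lemma NME z : Omega z -> NM z = AM z + (u z / 2) *: Hm z.
Proof.
move=> Oz; rewrite /AM /Hm scalerA -addrA [X in _ + X]addrC.
by rewrite (_ : u z / 2 / l z = u z / (2 * l z)) ?subrr ?addr0 //; field; exact: l0.
Qed.

Lemma u2_an : an Omega (fun z => u z / 2).
Proof. by apply: anM => //; exact: an_cst. Qed.

Lemma dNME (x : Z) z : Omega z ->
  pd x NM z = pd x AM z + ((pd x u z / 2) *: Hm z + (u z / 2) *: pd x Hm z).
Proof.
move=> Oz; rewrite (eq_derive_on _ NME Oz).
rewrite (anm_deriveD _ AM_an (anmZ u2_an Hm_an) Oz); congr (_ + _).
rewrite (anm_deriveZ _ u2_an Hm_an Oz); congr (_ *: _ + _).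
by rewrite (an_deriveM _ ua (an_cst _) Oz) pd_cst mulr0 addr0.
Qed.

Lemma nabla_Hm z X v Y : Omega z ->
  bl (G z) (v *m pd (sp X) Hm z + Gam z X (v *m Hm z)) Y =
  Tn h z X v Y + bl (h z) (Gam z X v) Y.
Proof.
move=> Oz; rewrite bilDl dHmE // dG_compat // /Tn HmE //; ring.
Qed.

(** Insert N = A + (u / 2) Hm in [Rm_NM]: A contributes [QA], the factor u / 2 the two terms in du,
    and the covariant derivatives of Hm the term [dn]. For A = 0 this is a Codazzi equation. *)
Lemma RmE z X Y : Omega z -> Rm z X Y = QA z X Y
  + 2^-1 * pd (sp X) u z * bl (h z) (U z) Y
  - 2^-1 * pd (sp (U z)) u z * bl (h z) X Y
  + u z / 2 * dn z X (U z) Y.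
Proof.
move=> Oz; rewrite Rm_NM // /QA /dn.
have := nabla_Hm X (U z) Y Oz; have := nabla_Hm (U z) X Y Oz.
rewrite [Gam z (U z) X]GamC // !bilDl => h1 h2.
have HE v w := HmE v w Oz.
rewrite !dNME // NME //; move: HE h1 h2.
move: (AM z) (Hm z) (pd (sp X) AM z) (pd (sp (U z)) AM z) (pd (sp X) Hm z)
  (pd (sp (U z)) Hm z) (h z) => A0 H0 A1 A2 H1 H2 hz HE h1 h2.
rewrite !mulmxDr -!scalemxAr !GamDr // !GamZr // !bil_lin !HE.
move: h1 h2.
set a1 := bl (G z) (X *m H2) Y.
set a2 := bl (G z) (U z *m H1) Y.
set b1 := bl (G z) (Gam z (U z) (X *m H0)) Y.
set b2 := bl (G z) (Gam z X (U z *m H0)) Y.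
move=> h1 h2.
have -> : a1 = Tn h z (U z) X Y + bl hz (Gam z X (U z)) Y - b1 by rewrite -h1 addrK.
have -> : a2 = Tn h z X (U z) Y + bl hz (Gam z X (U z)) Y - b2 by rewrite -h2 addrK.
by field.
Qed.

Lemma d_compat v (P Q : Z -> V) z : anm Omega P -> anm Omega Q -> Omega z ->
  pd (sp v) (fun y => bl (G y) (P y) (Q y)) z =
  bl (G z) (pd (sp v) P z + Gam z v (P z)) (Q z)
  + bl (G z) (P z) (pd (sp v) Q z + Gam z v (Q z)).
Proof.
move=> Pa Qa Oz; rewrite (an_derive_bil _ Ga Pa Qa Oz) dG_compat // bilDl bilDr.
by ring.
Qed.

Definition halfnorm z : R := 2^-1 * bl (G z) (U z) (U z).

Lemma halfnorm_an : an Omega halfnorm.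
Proof. by apply: anM; [exact: an_cst|exact: an_bil]. Qed.

Lemma d_halfnorm v z : Omega z ->
  pd (sp v) halfnorm z = bl (G z) (nablaU z v) (U z).
Proof.
move=> Oz; rewrite /halfnorm (an_deriveM _ (an_cst _) (an_bil Ga Ua Ua) Oz).
rewrite pd_cst mul0r add0r d_compat // -/(nablaU z v).
by rewrite [bl (G z) (U z) _]bl_sym ?Gsym //; field.
Qed.

(* The symmetry R(X, U, U, U) = 0, from the symmetry of the second derivatives
   of g(U, U) / 2. *)
Lemma Rm_skew z X : Omega z -> Rm z X (U z) = 0.
Proof.
move=> Oz; have Na := nablaU_an Ua.
have Xa : anm Omega (fun z => nablaU z X) by apply: nablaU_an; exact: anm_cst.
have := d_compat X Na Ua Oz; have := d_compat (U z) Xa Ua Oz.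
have -> : pd (sp X) (fun y => bl (G y) (nablaU y (U y)) (U y)) z =
    pd (sp X) (fun y => pd (sp (U y)) halfnorm y) z.
  by apply: eq_derive_on Oz => y Oy; rewrite d_halfnorm.
have -> : pd (sp (U z)) (fun y => bl (G y) (nablaU y X) (U y)) z =
    pd (sp (U z)) (pd (sp X) halfnorm) z.
  by apply: eq_derive_on Oz => y Oy; rewrite d_halfnorm.
rewrite (an_derive_dir _ halfnorm_an (sp_an Ua) Oz) (sp_derive _ Ua Oz).
rewrite d_halfnorm // -!/(nablaU z _) => h1 h2.
rewrite /Rm; set a := pd (sp X) _ z + _ in h2 *.
set b := pd (sp (U z)) _ z + _ in h1 *.
rewrite !bilBl.
move: h1 h2; rewrite [bl (G z) (nablaU z X) _]bl_sym ?Gsym //.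
set A1 := bl (G z) a _; set A2 := bl (G z) b _; set A3 := bl _ (nablaU z (pd _ _ _)) _.
set A4 := bl (G z) (nablaU z (U z)) _; set A5 := pd (sp (U z)) (pd _ _) z.
move=> h1 h2; have -> : A3 = A1 + A4 - A5 by rewrite -h2 addrK.
by rewrite h1; ring.
Qed.

Lemma Rm_U z Y : Omega z -> Rm z (U z) Y = 0.
Proof.
move=> Oz; rewrite Rm_NM //.
by rewrite -addrA -opprD subrr bil0l.
Qed.

Lemma HsE z X Y : Omega z ->
  bl (G z) (pd (sp X) L z + Gam z X (L z)) Y = Hs z X Y.
Proof.
move=> Oz; have := d_compat X L_an (anm_cst Y) Oz.
rewrite pd_cst add0r LE // => /eqP; rewrite -subr_eq => /eqP <-.
by rewrite /Hs; congr (_ - _); apply: eq_derive_on Oz => y Oy; rewrite LE.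
Qed.

Lemma dtLE z v : Omega z ->
  pd (sp v) (pd et l) z = bl (Gd z) (L z) v + bl (G z) (pd et L z) v.
Proof.
move=> Oz; rewrite (an_deriveC _ _ la Oz).
have -> : pd et (pd (sp v) l) z = pd et (fun y => bl (G y) (L y) v) z.
  by apply: eq_derive_on Oz => y Oy; rewrite LE.
rewrite (an_derive_bil _ Ga L_an (anm_cst v) Oz) pd_cst bil0r addr0.
by [].
Qed.

Definition dlog z := pd et l z / l z.

Definition metric_defect z X Y : R := bl (pd et Gd z) X Y -
  (l z ^+ 2 / u z * (dn z (U z) X Y + dn z (U z) Y X)
  + 2^-1 * bl (Gd z) X (Y *m S z)
  + dlog z * bl (Gd z) X Y
  + 2 * l z * Hs z X Y
  + 2 * (l z ^+ 2 / u z ^+ 2) * Rm z X Y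
  + (2 * u z ^+ 2)^-1
      * (bl (Gd z) X Y * bl (Gd z) (U z) (U z)
         - bl (Gd z) X (U z) * bl (Gd z) Y (U z))).

Definition vector_defect z X : R := bl (G z) (pd et (pd et U) z) X -
  (- (l z ^+ 2 / (2 * u z)) * dn z (U z) X (U z)
  - 2^-1 * dlog z * bl (Gd z) (U z) X
  - l z * Hs z (U z) X
  - bl (Gd z) (pd et U z) X
  + u z * bl (G z) (pd et L z) X
  + u z / 2 * bl (Gd z) (L z) X
  + (2 * pd et u z - pd (sp (U z)) l z) * pd (sp X) l z).

Definition function_defect z : R := pd et (pd et u) z -
  (bl (G z) (pd et L z) (U z)
  + 2 * pd (sp (pd et U z)) l z
  + 3 / 2 * bl (Gd z) (L z) (U z)
  - u z * bl (G z) (L z) (L z)).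

(** * Time derivatives of the defects *)

Lemma cd_an : an Omega cd.
Proof.
by apply: anB; [exact: an_derive|apply: an_dir => //; exact: sp_an].
Qed.

(** This accounts for the coefficients of the third equation: differentiating d lambda(U) gives
    g(L', U), one g'(L, U) and one d lambda(U'), and d lambda(C) supplies another d lambda(U'), a
    further half of g'(L, U) and the norm of the gradient. *)
Lemma dt_cd z : Omega z -> pd et cd z = pd (sp (Cd z)) l z + function_defect z.
Proof.
move=> Oz; rewrite /cd (an_deriveB _ (an_derive et ua) (an_dir la (sp_an Ua)) Oz).
rewrite (an_derive_dir _ la (sp_an Ua) Oz) (sp_derive _ Ua Oz) dtLE //.
rewrite -!LE // /Cd /function_defect -LE //.
move: (pd et (pd et u) z) (pd et U z) (pd et L z) => uu Ut Lt.
rewrite !bil_lin [bl (G z) (L z) (U z *m S z)]bl_sym ?Gsym // SE //.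
by rewrite [bl (Gd z) (U z) _]bl_sym ?Gd_sym //; field.
Qed.

Lemma SS z X Y : Omega z -> bl (Gd z) X (Y *m S z) = bl (Gd z) (X *m S z) Y.
Proof.
move=> Oz; rewrite -SE // bl_sym ?Gsym // SE // bl_sym ?Gd_sym //.
Qed.

Lemma dt_US z X : Omega z -> bl (G z) (pd et (fun y => U y *m S y) z) X =
  bl (pd et Gd z) (U z) X + bl (Gd z) (pd et U z) X - bl (Gd z) (U z *m S z) X.
Proof.
move=> Oz; have := an_derive_bil et Ga US_an (anm_cst X) Oz.
have -> : pd et (fun y => bl (G y) (U y *m S y) X) z =
   pd et (fun y => bl (Gd y) (U y) X) z.
  by apply: eq_derive_on Oz => y Oy; rewrite SE.
rewrite (an_derive_bil et Gd_an Ua (anm_cst X) Oz) !pd_cst !bil0r !addr0 => ->.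
by rewrite /Gd; ring.
Qed.

(** The derivative of g'^#(U) contains g''(U, X), which is traded for the first equation at (U, X).
    There the curvature and one of the two [dn] terms vanish by antisymmetry, so the second equation
    has no curvature and a single [dn] term with half the coefficient. *)
Lemma dt_Cd z X : Omega z -> bl (G z) (pd et Cd z) X =
  cd z * pd (sp X) l z - 2^-1 * bl (Gd z) (Cd z) X + vector_defect z X + 2^-1 * metric_defect z (U z) X.
Proof.
move=> Oz.
have -> : pd et Cd z = pd et (pd et U) z - (pd et u z *: L z + u z *: pd et L z)
    + 2^-1 *: pd et (fun y => U y *m S y) z.
  rewrite /Cd (anm_deriveD _ (anmB Ud_an uL_an) US2_an Oz).
  rewrite (anm_deriveB _ Ud_an uL_an Oz) (anm_deriveZ _ ua L_an Oz).
  by rewrite (anm_deriveZ _ (an_cst _) US_an Oz) pd_cst scale0r add0r.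
have dnUU : dn z (U z) (U z) X = 0 by rewrite /dn subrr.
rewrite bilDl bilZl dt_US // /metric_defect Rm_U // dnUU SS // /vector_defect /Cd /cd.
rewrite -(LE X Oz); move: (u0 Oz) (l0 Oz).
move: (pd et (pd et U) z) (pd et U z) (pd et L z) (pd et u z) (pd (sp (U z)) l z) (dlog z) (Hs z (U z) X) => Utt Ut Lt ut lU dl HH uz0 lz0.
rewrite !bil_lin -!/(Gd _).
rewrite [bl (Gd z) X (U z)]bl_sym ?Gd_sym //.
by field; rewrite ?uz0 ?lz0.
Qed.

Lemma dt_koszul z X Y : Omega z ->
  pd et (fun y => koszul G y X (U y) Y) z =
  koszul Gd z X (U z) Y + koszul G z X (pd et U z) Y.
Proof.
move=> Oz.
have sU := sp_an Ua; have cX := anm_cst (Omega := Omega) X.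
have cY := anm_cst (Omega := Omega) Y.
have b1 := an_bil (anm_derive (sp X) Ga) Ua cY.
have b2 := an_bil (anm_dir Ga sU) cX cY.
have b3 := an_bil (anm_derive (sp Y) Ga) cX Ua.
rewrite /koszul (an_deriveM _ (an_cst _) (anB (anD b1 b2) b3) Oz) pd_cst mul0r add0r.
rewrite (an_deriveB _ (anD b1 b2) b3 Oz) (an_deriveD _ b1 b2 Oz).
rewrite (an_derive_bil _ (anm_derive (sp X) Ga) Ua cY Oz).
rewrite (an_derive_bil _ (anm_dir Ga sU) cX cY Oz).
rewrite (an_derive_bil _ (anm_derive (sp Y) Ga) cX Ua Oz).
rewrite (anm_derive_dir _ Ga sU Oz) (sp_derive _ Ua Oz) !pd_cst !bil0l !bil0r.
rewrite (anm_deriveC et (sp X) Ga Oz) (anm_deriveC et (sp Y) Ga Oz) -/Gd bilDm.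
by ring.
Qed.

Lemma Tn_sym (H : Z -> 'M[R]_n) z p q w : anm Omega H ->
  (forall z, Omega z -> (H z)^T = H z) -> Omega z ->
  Tn H z p q w = Tn H z p w q.
Proof.
move=> Ha Hsym Oz; rewrite /Tn [bl (pd _ _ _) q w]bl_sym ?derive_sym //.
rewrite [bl (H z) q _]bl_sym ?Hsym // [bl (H z) w _]bl_sym ?Hsym //; ring.
Qed.

(** First variation of the Levi-Civita connection: passing from partial to covariant derivatives of
    g' in its Koszul expression costs exactly g'(Gam(X, U), Y). *)
Lemma koszul_Tn z X Y : Omega z ->
  koszul Gd z X (U z) Y - bl (Gd z) (Gam z X (U z)) Y =
  2^-1 * (Tn Gd z X (U z) Y + Tn Gd z (U z) X Y - Tn Gd z Y X (U z)).
Proof.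
move=> Oz; rewrite /koszul /Tn.
rewrite [Gam z (U z) X]GamC // [Gam z Y X]GamC // [Gam z Y (U z)]GamC //.
rewrite [bl (Gd z) (U z) (Gam z X Y)]bl_sym ?Gd_sym //.
by field.
Qed.

Lemma dt_nablaU z X Y : Omega z ->
  bl (G z) (pd et (fun y => nablaU y X) z) Y =
  bl (G z) (pd (sp X) (pd et U) z + Gam z X (pd et U z)) Y
  + 2^-1 * (Tn Gd z X (U z) Y + Tn Gd z (U z) X Y - Tn Gd z Y X (U z)).
Proof.
move=> Oz; have cX := anm_cst (Omega := Omega) X; have cY := anm_cst (Omega := Omega) Y.
have := an_derive_bil et Ga (nablaU_an cX) cY Oz.
have -> : pd et (fun y => bl (G y) (nablaU y X) Y) z =
    pd et (fun y => bl (G y) (pd (sp X) U y) Y + koszul G y X (U y) Y) z.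
  by apply: eq_derive_on Oz => y Oy; rewrite bilDl GamE.
have b1 := an_bil Ga (anm_derive (sp X) Ua) cY.
rewrite (an_deriveD _ b1 (koszul_an Ga cX Ua cY) Oz) dt_koszul //.
rewrite (an_derive_bil _ Ga (anm_derive (sp X) Ua) cY Oz) !pd_cst !bil0r !addr0.
rewrite (anm_deriveC et (sp X) Ua Oz) -koszul_Tn // -(GamE _ _ Y) //.
rewrite -/Gd; set D := bl (G z) (pd et _ z) Y; rewrite !bilDl => /esym.
by rewrite [_ + D]addrC => /(canRL (addrK _)) ->; ring.
Qed.

Lemma nabla_US z X Y : Omega z ->
  bl (G z) (pd (sp X) (fun y => U y *m S y) z + Gam z X (U z *m S z)) Y =
  Tn Gd z X (U z) Y + bl (Gd z) (nablaU z X) Y.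
Proof.
move=> Oz; have cY := anm_cst (Omega := Omega) Y.
have := d_compat X US_an cY Oz; rewrite pd_cst add0r.
have -> : pd (sp X) (fun y => bl (G y) (U y *m S y) Y) z =
    pd (sp X) (fun y => bl (Gd y) (U y) Y) z.
  by apply: eq_derive_on Oz => y Oy; rewrite SE.
rewrite (an_derive_bil _ Gd_an Ua cY Oz) pd_cst bil0r addr0 SE //.
move=> /esym/(canRL (addrK _)) ->.
by rewrite /Tn /nablaU bilDl; ring.
Qed.

Lemma UdE z : Omega z ->
  pd et U z = Cd z + u z *: L z - 2^-1 *: (U z *m S z).
Proof.
move=> Oz; rewrite /Cd; move: (pd et U z) (u z *: L z) (2^-1 *: _) => a b c.
by rewrite addrAC addrK subrK.
Qed.

(** U' is eliminated by solving the definition of [Cd] for it; this is how the Hessian of lambda and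
    the spatial derivative of C enter the evolution of A. *)
Lemma nabla_Ud z X Y : Omega z ->
  bl (G z) (pd (sp X) (pd et U) z + Gam z X (pd et U z)) Y =
  bl (G z) (pd (sp X) Cd z + Gam z X (Cd z)) Y
  + pd (sp X) u z * pd (sp Y) l z + u z * Hs z X Y
  - 2^-1 * (Tn Gd z X (U z) Y + bl (Gd z) (nablaU z X) Y).
Proof.
move=> Oz; rewrite -nabla_US // -HsE // -LE //.
have -> : pd (sp X) (pd et U) z =
    pd (sp X) Cd z + (pd (sp X) u z *: L z + u z *: pd (sp X) L z)
    - 2^-1 *: pd (sp X) (fun y => U y *m S y) z.
  rewrite (eq_derive_on _ UdE Oz) (anm_deriveB _ (anmD Cd_an uL_an) US2_an Oz).
  rewrite (anm_deriveD _ Cd_an uL_an Oz) (anm_deriveZ _ ua L_an Oz).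
  by rewrite (anm_deriveZ _ (an_cst _) US_an Oz) pd_cst scale0r add0r.
rewrite UdE //.
move: (Cd z) (L z) (U z *m S z) (pd (sp X) Cd z) (pd (sp X) L z)
  (pd (sp X) (fun y => U y *m S y) z) => C0 L0 US0 C1 L1 US1.
by rewrite GamBr // GamDr // !GamZr // !bil_lin; field.
Qed.

Lemma Tn_h z p q w : Omega z ->
  Tn h z p q w = (l z)^-1 * Tn Gd z p q w
    - (l z) ^- 2 * pd (sp p) l z * bl (Gd z) q w.
Proof.
move=> Oz; rewrite /Tn /h (anm_deriveZ _ il_an Gd_an Oz).
by rewrite (an_deriveV _ la (l0 Oz) Oz) !bil_lin; ring.
Qed.

Lemma d_ul (x : Z) z : Omega z -> pd x (fun y => u y / (2 * l y)) z =
  pd x u z / (2 * l z) - u z * pd x l z / (2 * l z ^+ 2).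
Proof.
move=> Oz; have a2l : an Omega (fun y => 2 * l y) by apply: anM => //; exact: an_cst.
have n0 z' : Omega z' -> 2 * l z' != 0.
  by move=> Oz'; rewrite mulf_neq0 ?l0 // pnatr_eq0.
rewrite (an_deriveM _ ua (anV n0 a2l) Oz) (an_deriveV _ a2l (n0 _ Oz) Oz).
rewrite (an_deriveM _ (an_cst _) la Oz) pd_cst mul0r add0r; field.
exact: l0.
Qed.

Lemma XAM z X : Omega z ->
  X *m AM z = nablaU z X - (u z / (2 * l z)) *: (X *m S z).
Proof.
by move=> Oz; rewrite nablaUM // /AM mulmxBr -scalemxAr.
Qed.

Lemma dt_XS z X Y : Omega z -> bl (G z) (X *m pd et S z) Y =
  bl (pd et Gd z) X Y - bl (Gd z) (X *m S z) Y.
Proof.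
move=> Oz; have cX := anm_cst (Omega := Omega) X; have cY := anm_cst (Omega := Omega) Y.
have := an_derive_bil et Ga (anm_mulmx cX S_an) cY Oz.
have -> : pd et (fun y => bl (G y) (X *m S y) Y) z = pd et (fun y => bl (Gd y) X Y) z.
  by apply: eq_derive_on Oz => y Oy; rewrite SE.
rewrite (an_derive_bil _ Gd_an cX cY Oz) (derive_cstM _ _ S_an Oz) !pd_cst !bil0l !bil0r.
by rewrite !addr0 -/Gd => ->; ring.
Qed.

(** g'' enters with weight u / (2 lambda) through [dt_XS] and is traded for the first equation.
    [RmE] turns its curvature into [dn] terms, which cancel against those from the first variation
    of the connection; only terms with a defect as a factor survive. *)
Lemma dt_AM z X Y : Omega z -> bl (G z) (X *m pd et AM z) Y =
  - 2^-1 * bl (Gd z) (X *m AM z) Y + Bd z X * pd (sp Y) l z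
  + bl (G z) (pd (sp X) Cd z + Gam z X (Cd z)) Y
  - cd z / (2 * l z) * bl (Gd z) X Y
  - l z / u z * (QA z X Y + 2^-1 * Bd z X * bl (h z) (U z) Y
                 - 2^-1 * Bd z (U z) * bl (h z) X Y)
  - u z / (2 * l z) * metric_defect z X Y.
Proof.
move=> Oz; have cX := anm_cst (Omega := Omega) X.
have -> : X *m pd et AM z = pd et (fun y => nablaU y X) z
    - (pd et (fun y => u y / (2 * l y)) z *: (X *m S z)
       + (u z / (2 * l z)) *: (X *m pd et S z)).
  rewrite -(derive_cstM _ _ AM_an Oz) (eq_derive_on _ (fun y Oy => XAM X Oy) Oz).
  rewrite (anm_deriveB _ (nablaU_an cX) (anmZ ul_an (anm_mulmx cX S_an)) Oz).
  by rewrite (anm_deriveZ _ ul_an (anm_mulmx cX S_an) Oz) (derive_cstM _ _ S_an Oz).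
rewrite bilBl bilDl !bilZl dt_XS // SE // dt_nablaU // nabla_Ud // d_ul // XAM //.
have RmXY := RmE X Y Oz; rewrite /metric_defect RmXY /Bd /cd /dlog /dn !Tn_h //.
rewrite (Tn_sym _ Y X Gd_an Gd_sym Oz) (Tn_sym Y X (U z) Gd_an Gd_sym Oz).
have hE v w : bl (h z) v w = (l z)^-1 * bl (Gd z) v w by rewrite bilZm.
rewrite !hE SS // [bl (Gd z) X (U z)]bl_sym ?Gd_sym // [bl (Gd z) Y (U z)]bl_sym ?Gd_sym //.
rewrite [bl (Gd z) Y X]bl_sym ?Gd_sym //.
move: (nablaU z X) (X *m S z) => NX XS; rewrite !bilBl !bilZl.
by field; rewrite ?u0 ?l0.
Qed.

Lemma Hs_sym z X Y : Omega z -> Hs z X Y = Hs z Y X.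
Proof. by move=> Oz; rewrite /Hs GamC // (an_deriveC _ _ la Oz). Qed.

(** The mixed derivative of u is rewritten by u' = c + d lambda(U), and g''(X, U) by the first
    equation at (X, U), whose curvature term vanishes by [Rm_skew]. *)
Lemma dt_Bd z X : Omega z -> pd et (fun y => Bd y X) z =
  pd (sp X) cd z + pd (sp (X *m AM z)) l z
  - (2 * l z)^-1 * bl (Gd z) X (Cd z)
  - l z / u z ^+ 2 * (QA z X (U z) + 2^-1 * Bd z X * bl (h z) (U z) (U z)
                      - 2^-1 * Bd z (U z) * bl (h z) X (U z))
  - (2 * l z)^-1 * metric_defect z X (U z).
Proof.
move=> Oz; have cX := anm_cst (Omega := Omega) X.
have a2l : an Omega (fun y => 2 * l y) by apply: anM => //; exact: an_cst.
have n0 z' : Omega z' -> 2 * l z' != 0.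
  by move=> Oz'; rewrite mulf_neq0 ?l0 // pnatr_eq0.
have bg := an_bil Gd_an cX Ua.
have utE y : Omega y -> pd et u y = cd y + pd (sp (U y)) l y.
  by move=> Oy; rewrite /cd subrK.
have -> : pd et (fun y => Bd y X) z = pd (sp X) cd z + pd (sp (nablaU z X)) l z
    + Hs z (U z) X + 2 * pd et l z / (2 * l z) ^+ 2 * bl (Gd z) X (U z)
    - (2 * l z)^-1 * (bl (pd et Gd z) X (U z) + bl (Gd z) X (pd et U z)).
  rewrite /Bd (an_deriveB _ (an_derive (sp X) ua) (anM (anV n0 a2l) bg) Oz).
  rewrite (an_deriveM _ (anV n0 a2l) bg Oz) (an_deriveV _ a2l (n0 _ Oz) Oz).
  rewrite (an_deriveM _ (an_cst _) la Oz) pd_cst mul0r add0r.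
  rewrite (an_derive_bil _ Gd_an cX Ua Oz) pd_cst bil0l addr0.
  rewrite (an_deriveC _ _ ua Oz) (eq_derive_on _ utE Oz).
  rewrite (an_deriveD _ cd_an (an_dir la (sp_an Ua)) Oz).
  rewrite (an_derive_dir _ la (sp_an Ua) Oz) (sp_derive _ Ua Oz).
  rewrite /nablaU (dsp_scD _ _ la Oz) /Hs [Gam z X (U z)]GamC //.
  by ring.
have RmXU := RmE X (U z) Oz; rewrite Rm_skew // in RmXU.
(* [RmE] at Y = U has left-hand side 0, hence can be solved for d^nabla h (X, U, U). This replaces
   the remaining derivatives of g' by A and du. *)
have dnX : dn z X (U z) (U z) = - (2 / u z) * (QA z X (U z)
  + 2^-1 * pd (sp X) u z * bl (h z) (U z) (U z)
  - 2^-1 * pd (sp (U z)) u z * bl (h z) X (U z)).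
  apply: (@mulfI _ (u z / 2)); first by rewrite mulf_neq0 ?u0 // invr_neq0 ?pnatr_eq0.
  have /eqP := RmXU; rewrite eq_sym addrC addr_eq0 => /eqP ->.
  by field; exact: u0.
have dnU : dn z (U z) X (U z) = - dn z X (U z) (U z) by rewrite /dn; ring.
have dnUU : dn z (U z) (U z) X = 0 by rewrite /dn subrr.
rewrite XAM // (dsp_scB (nablaU z X) _ la Oz) (dsp_scZ _ _ la Oz).
rewrite -(LE (X *m S z)) // [bl (G z) (L z) _]bl_sym ?Gsym // SE //.
rewrite {1}UdE // /metric_defect dnUU dnU dnX Rm_skew // [Hs z X (U z)]Hs_sym // /dlog.
rewrite !bilDr !bilNr !bilZr.
have hE v w : bl (h z) v w = (l z)^-1 * bl (Gd z) v w by rewrite bilZm.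
rewrite !hE /Bd.
move: (Cd z) (L z) (U z *m S z) (QA z X (U z)) (pd et l z) => C0 L0 US0 Q0 lt0.
by rewrite -/Gd; field; rewrite u0 ?l0.
Qed.

Definition parallel_at z :=
  [/\ AM z = 0, forall v, Bd z v = 0, cd z = 0 & Cd z = 0].

(** With all defects zero on an open set, the derivative formulas reduce to the defects of the
    equations. The metric equation comes first, because it also occurs in [dt_Cd]. *)
Lemma evolution_of_parallel : (forall z, Omega z -> parallel_at z) ->
  forall z, Omega z -> [/\ forall X Y, metric_defect z X Y = 0, forall X, vector_defect z X = 0 & function_defect z = 0].
Proof.
move=> par z Oz.
have A0 y : Omega y -> AM y = (fun=> 0) y by move=> /par [].
have c0 y : Omega y -> cd y = (fun=> 0) y by move=> /par [].
have C0 y : Omega y -> Cd y = (fun=> 0) y by move=> /par [].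
have B0 v : Bd z v = 0 by have [] := par z Oz.
have dA x : pd x AM z = 0 by rewrite (eq_derive_on _ A0 Oz) pd_cst.
have dC x : pd x Cd z = 0 by rewrite (eq_derive_on _ C0 Oz) pd_cst.
have dc x : pd x cd z = 0 by rewrite (eq_derive_on _ c0 Oz) pd_cst.
have Gam0r v : Gam z v 0 = 0 by rewrite GamC // Gam0l.
have E1 X Y : metric_defect z X Y = 0.
  have := dt_AM X Y Oz; rewrite /QA !dA dC A0 // C0 // c0 // !B0 !mulmx0.
  rewrite !Gam0r !subr0 !addr0 !bil0l !(mulr0, mul0r, addr0, subr0, add0r, oppr0, sub0r).
  move=> /esym/eqP; rewrite oppr_eq0 mulf_eq0 => /orP[|/eqP //].
  rewrite mulf_eq0 (negPf (u0 Oz)) invr_eq0 mulf_eq0 (negPf (l0 Oz)).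
  by rewrite pnatr_eq0.
split=> // [X|].
  have := dt_Cd X Oz; rewrite dC c0 // C0 // E1 !bil0l.
  by rewrite !(mulr0, mul0r, addr0, subr0, add0r, oppr0, sub0r) => <-.
by have := dt_cd Oz; rewrite dc C0 // sp0 pd0 add0r => <-.
Qed.

(** * Propagation of the defects off the slice t = 0 *)

Local Notation flat := (flat Omega time_index).
Local Notation flatm := (flatm Omega time_index).

Lemma flat_blm k (F : Z -> 'M[R]_n) (X1 X2 : Z -> V) :
  flatm k F -> anm Omega X1 -> anm Omega X2 ->
  flat k (fun z => bl (F z) (X1 z) (X2 z)).
Proof.
move=> Fk a1 a2; rewrite blE.
exact: (flatmMl (flatmMr a1 Fk) (anm_tr a2) 0 0).
Qed.

Lemma flatm_sp k (X : Z -> V) : flatm k X -> flatm k (fun z => sp (X z)).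
Proof.
move=> Xk i j; case E: (fintype.split j) => [j'|j'].
  by apply: flat_eq (flat0 _ _ k) => z _; rewrite [RHS]mxE E mxE.
by apply: flat_eq (Xk i j') => z _; rewrite [RHS]mxE E.
Qed.

Lemma flat_koszul k (X1 X2 X3 : Z -> V) : anm Omega X1 -> flatm k X2 ->
  anm Omega X3 -> flat k (fun z => koszul G z (X1 z) (X2 z) (X3 z)).
Proof.
move=> a1 k2 a3; apply: flatM; first exact: an_cst.
apply: flatB; [apply: flatD|].
- by apply: flat_bill => //; apply: anm_dir => //; exact: sp_an.
- by apply: flat_blm => //; apply: flatm_dir => //; exact: flatm_sp.
- by apply: flat_bilr => //; apply: anm_dir => //; exact: sp_an.
Qed.

Lemma flat_bl_Gam k (X1 X2 X3 : Z -> V) : anm Omega X1 -> flatm k X2 ->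
  anm Omega X3 -> flat k (fun z => bl (G z) (Gam z (X1 z) (X2 z)) (X3 z)).
Proof.
by move=> a1 k2 a3; apply: flat_eq (flat_koszul a1 k2 a3) => z Oz; rewrite GamE.
Qed.

(** The derivatives of A are taken along [sp X] and [sp (U z)], whose time components are 0, so the
    order k is kept. *)
Lemma flat_QA k X (Y : Z -> V) : flatm k AM -> anm Omega Y ->
  flat k (fun z => QA z X (Y z)).
Proof.
move=> Ak aY; have cX := anm_cst (Omega := Omega) X.
have XA : flatm k (fun z => X *m AM z) by exact: flatmMr.
have UA : flatm k (fun z => U z *m AM z) by exact: flatmMr.
apply: (@flat_eq _ _ _ _ _ (fun z => bl (G z) (U z *m pd (sp X) AM z) (Y z)
   + bl (G z) (Gam z X (U z *m AM z)) (Y z)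
   - bl (G z) (X *m pd (sp (U z)) AM z) (Y z)
   - bl (G z) (Gam z (U z) (X *m AM z)) (Y z))).
  by move=> z _; rewrite /QA !bil_lin.
apply: flatB; [apply: flatB; [apply: flatD|]|].
- apply: flat_bill => //; apply: flatmMr => //.
  by apply: flatm_derive => //; exact: sp_time.
- exact: flat_bl_Gam.
- apply: flat_bill => //; apply: flatmMr => //.
  by apply: flatm_along => //; [move=> z; exact: sp_time|exact: sp_an].
- exact: flat_bl_Gam.
Qed.

Lemma flatm_of_pairing k (F : Z -> V) :
  (forall j, flat k (fun z => bl (G z) (F z) (delta_mx 0 j))) -> flatm k F.
Proof.
move=> Fk; have rk : flatm k (fun z => \row_j bl (G z) (F z) (delta_mx 0 j)).
  by move=> i j; apply: flat_eq (Fk j) => z _; rewrite mxE.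
move=> i j; apply: flat_eq (flatmMl rk invG_an i j) => z Oz; congr (_ _ i j).
apply: (bil_inj (Gunit Oz)) => w; rewrite bil_row ?Gunit //.
by rewrite [RHS]bil_sumr.
Qed.

Lemma Bd_sum z v : Omega z -> Bd z v = \sum_k v 0 k * Bd z (delta_mx 0 k).
Proof.
move=> Oz; rewrite /Bd (dsp_sc_sum _ ua Oz).
rewrite [bl (Gd z) v (U z)]bl_sym ?Gd_sym // [bl _ (U z) v]bil_sumr mulr_sumr -sumrB.
apply: eq_bigr => k _; rewrite [bl _ (U z) _]bl_sym ?Gd_sym //; ring.
Qed.

Lemma Bd_an (X : Z -> V) : anm Omega X -> an Omega (fun z => Bd z (X z)).
Proof.
move=> Xa; apply: anB; first by apply: an_dir => //; exact: sp_an.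
apply: anM; last by apply: an_bil => //; exact: Gd_an.
apply: anV; last by apply: anM => //; exact: an_cst.
by move=> z Oz; rewrite mulf_neq0 ?l0 // pnatr_eq0.
Qed.

Lemma i2l_an : an Omega (fun z => (2 * l z)^-1).
Proof.
apply: anV; last by apply: anM => //; exact: an_cst.
by move=> z Oz; rewrite mulf_neq0 ?l0 // pnatr_eq0.
Qed.

Lemma iu_an : an Omega (fun z => (u z)^-1).
Proof. exact: anV. Qed.

(** Induction on the order. Once the equations hold, each term of the t-derivatives has a defect or
    a spatial derivative of one as a factor, so it is flat of order k; vanishing at t = 0 then
    raises the defects to order k + 1. [Bd] is followed on basis vectors, to which [Bd_sum] reduces
    it. *)
Lemma flat_defects :
  (forall z, Omega z -> [/\ forall X Y, metric_defect z X Y = 0, forall X, vector_defect z X = 0 & function_defect z = 0]) ->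
  (forall z, Omega z -> z 0 time_index = 0 -> parallel_at z) ->
  forall k, [/\ flatm k AM, forall i, flat k (fun z => Bd z (delta_mx 0 i)),
    flat k cd & flatm k Cd].
Proof.
move=> ev init; elim=> [|k [kA kB kc kC]].
  split; [exact: AM_an| |exact: cd_an|exact: Cd_an].
  by move=> i; apply: Bd_an; exact: anm_cst.
have E1 z X Y : Omega z -> metric_defect z X Y = 0 by move=> /ev [].
have E2 z X : Omega z -> vector_defect z X = 0 by move=> /ev [].
have E3 z : Omega z -> function_defect z = 0 by move=> /ev [].
have BU : flat k (fun z => Bd z (U z)).
  apply: flat_eq (flat_sum (index_enum _) (fun i => flatM (Ua 0 i) (kB i))) => z Oz.
  by rewrite [RHS]Bd_sum.
have lu : an Omega (fun z => l z / u z) by apply: anM => //; exact: iu_an.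
have QAB X (Y : Z -> V) : anm Omega Y -> flat k (fun z => Bd z X) ->
    flat k (fun z => QA z X (Y z) + 2^-1 * Bd z X * bl (h z) (U z) (Y z)
                 - 2^-1 * Bd z (U z) * bl (h z) X (Y z)).
  move=> aY BX; apply: flatB; [apply: flatD; first exact: flat_QA|].
    apply: flatMr; first by apply: an_bil => //; exact: h_an.
    by apply: flatM => //; exact: an_cst.
  apply: flatMr; first by apply: an_bil => //; [exact: h_an|exact: anm_cst].
  by apply: flatM => //; exact: an_cst.
have dAk : flatm k (pd et AM).
  move=> i; suff H : flatm k (fun z => (delta_mx 0 i : V) *m pd et AM z).
    by move=> j; apply: flat_eq (H 0 j) => z _; rewrite -rowE mxE.
  apply: flatm_of_pairing => j.
  set X : V := delta_mx 0 i; set Y : V := delta_mx 0 j.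
  have cX := anm_cst (Omega := Omega) X; have cY := anm_cst (Omega := Omega) Y.
  apply: (@flat_eq _ _ _ _ _ (fun z =>
    - 2^-1 * bl (Gd z) (X *m AM z) Y + Bd z X * pd (sp Y) l z
    + (bl (G z) (pd (sp X) Cd z) Y + bl (G z) (Gam z X (Cd z)) Y)
    - cd z * (2 * l z)^-1 * bl (Gd z) X Y
    - l z / u z * (QA z X Y + 2^-1 * Bd z X * bl (h z) (U z) Y
                 - 2^-1 * Bd z (U z) * bl (h z) X Y))).
    by move=> z Oz; rewrite dt_AM // E1 // mulr0 subr0 -bilDl.
  apply: flatB; [apply: flatB; [apply: flatD; [apply: flatD|]|]|].
  - apply: flatM; first exact: an_cst.
    by apply: flat_bill => //; [exact: Gd_an|exact: flatmMr].
  - by apply: flatMr; [exact: an_derive|exact: kB].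
  - apply: flatD; last exact: flat_bl_Gam.
    by apply: flat_bill => //; apply: flatm_derive => //; exact: sp_time.
  - apply: flatMr; first by apply: an_bil => //; exact: Gd_an.
    by apply: flatMr => //; exact: i2l_an.
  - apply: flatM lu _; apply: (QAB X (fun=> Y)) => //; exact: kB.
have dBk i : flat k (pd et (fun z => Bd z (delta_mx 0 i))).
  set X : V := delta_mx 0 i; have cX := anm_cst (Omega := Omega) X.
  apply: (@flat_eq _ _ _ _ _ (fun z =>
    pd (sp X) cd z + pd (sp (X *m AM z)) l z
    - (2 * l z)^-1 * bl (Gd z) X (Cd z)
    - (l z / u z * (u z)^-1) * (QA z X (U z) + 2^-1 * Bd z X * bl (h z) (U z) (U z)
                      - 2^-1 * Bd z (U z) * bl (h z) X (U z)))).
    move=> z Oz; rewrite dt_Bd // E1 // mulr0 subr0; congr (_ - _ * _).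
    by rewrite expr2 invfM mulrA.
  apply: flatB; [apply: flatB; [apply: flatD|]|].
  - by apply: flat_derive => //; exact: sp_time.
  - by apply: flat_dir => //; apply: flatm_sp; exact: flatmMr.
  - by apply: flatM; [exact: i2l_an|apply: flat_bilr => //; exact: Gd_an].
  - by apply: flatM; [apply: anM => //; exact: iu_an|exact: QAB X U Ua (kB i)].
have dck : flat k (pd et cd).
  apply: (@flat_eq _ _ _ _ _ (fun z => pd (sp (Cd z)) l z)).
    by move=> z Oz; rewrite dt_cd // E3 // addr0.
  by apply: flat_dir => //; exact: flatm_sp.
have dCk : flatm k (pd et Cd).
  apply: flatm_of_pairing => j; set X : V := delta_mx 0 j.
  have cX := anm_cst (Omega := Omega) X.
  apply: (@flat_eq _ _ _ _ _ (fun z => cd z * pd (sp X) l z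
    - 2^-1 * bl (Gd z) (Cd z) X)).
    by move=> z Oz; rewrite dt_Cd // E1 // E2 // mulr0 !addr0.
  apply: flatB; first by apply: flatMr => //; exact: an_derive.
  by apply: flatM; [exact: an_cst|apply: flat_bill => //; exact: Gd_an].
rewrite etE in dAk dBk dck dCk; split.
- move=> i j; split; first exact: AM_an.
    by move=> z Oz z0; have [-> _ _ _] := init z Oz z0; rewrite mxE.
  by apply: flat_eq (dAk i j) => z Oz; rewrite (anm_deriveE _ _ _ AM_an Oz).
- move=> i; split; first by apply: Bd_an; exact: anm_cst.
    by move=> z Oz z0; have [_ -> _ _] := init z Oz z0.
  exact: dBk.
- split=> //; first exact: cd_an.
  by move=> z Oz z0; have [_ _ -> _] := init z Oz z0.
- move=> i j; split; first exact: Cd_an.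
    by move=> z Oz z0; have [_ _ _ ->] := init z Oz z0; rewrite mxE.
  by apply: flat_eq (dCk i j) => z Oz; rewrite (anm_deriveE _ _ _ Cd_an Oz).
Qed.

Lemma near_parallel z : Omega z ->
  (forall i j, \forall y \near z, AM y i j = 0) ->
  (forall i, \forall y \near z, Bd y (delta_mx 0 i) = 0) ->
  (\forall y \near z, cd y = 0) -> (forall j, \forall y \near z, Cd y 0 j = 0) ->
  \forall y \near z, parallel_at y.
Proof.
move=> Oz nA nB nc nC.
have nA1 i : \forall y \near z, forall j, AM y i j = 0.
  exact: (@filter_forall Z 'I_n (fun j y => AM y i j = 0) (nbhs z) _ (nA i)).
have nA' : \forall y \near z, forall i j, AM y i j = 0.
  exact: (@filter_forall Z 'I_n (fun i y => forall j, AM y i j = 0) (nbhs z) _ nA1).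
have nB' : \forall y \near z, forall i, Bd y (delta_mx 0 i) = 0.
  exact: (@filter_forall Z 'I_n (fun i y => Bd y (delta_mx 0 i) = 0) (nbhs z) _ nB).
have nC' : \forall y \near z, forall j, Cd y 0 j = 0.
  exact: (@filter_forall Z 'I_n (fun j y => Cd y 0 j = 0) (nbhs z) _ nC).
have On := Omega_near Oz.
near=> y.
have Oy : Omega y by near: y; exact: On.
have yA : forall i j, AM y i j = 0 by near: y; exact: nA'.
have yB : forall i, Bd y (delta_mx 0 i) = 0 by near: y; exact: nB'.
have yC : forall j, Cd y 0 j = 0 by near: y; exact: nC'.
split.
- by apply/matrixP => i j; rewrite yA mxE.
- by move=> v; rewrite Bd_sum // big1 // => i _; rewrite yB mulr0.
- by near: y; exact: nc.
- by apply/rowP => j; rewrite yC mxE.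
Unshelve. all: by end_near. Qed.

Lemma parallel_near_slice :
  (forall z, Omega z -> [/\ forall X Y, metric_defect z X Y = 0, forall X, vector_defect z X = 0 & function_defect z = 0]) ->
  (forall z, Omega z -> z 0 time_index = 0 -> parallel_at z) ->
  forall z, Omega z -> z 0 time_index = 0 -> \forall y \near z, parallel_at y.
Proof.
move=> ev init z Oz z0; have fl := flat_defects ev init.
apply: near_parallel => //.
- by move=> i j; apply: (flat_eq0 (i0 := time_index)) Oz z0 => k; have [fA _ _ _] := fl k; exact: fA.
- by move=> i; apply: (flat_eq0 (i0 := time_index)) Oz z0 => k; have [_ fB _ _] := fl k; exact: fB.
- by apply: (flat_eq0 (i0 := time_index)) Oz z0 => k; have [_ _ fc _] := fl k.
- by move=> j; apply: (flat_eq0 (i0 := time_index)) Oz z0 => k; have [_ _ _ fC] := fl k; exact: fC.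
Qed.

Lemma parallel_closure z : Omega z ->
  (forall N, nbhs z N -> exists2 y, N y & \forall x \near y, parallel_at x) ->
  \forall y \near z, parallel_at y.
Proof.
move=> Oz zN.
have sub f : an Omega f -> (forall x, parallel_at x -> f x = 0) ->
    \forall y \near z, f y = 0.
  move=> fa f0; apply: (an_eq0_closure fa Oz) => N /zN [y Ny ny]; exists y => //.
  by apply: filterS ny.
apply: near_parallel => //.
- by move=> i j; apply: sub; [exact: AM_an|move=> x [-> _ _ _]; rewrite mxE].
- by move=> i; apply: sub; [apply: Bd_an; exact: anm_cst|move=> x [_ -> _ _]].
- by apply: sub; [exact: cd_an|move=> x []].
- by move=> j; apply: sub; [exact: Cd_an|move=> x [_ _ _ ->]; rewrite mxE].
Qed.

End Geometry.

(** * Slices and spacetime in coordinates *)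

Section Slices.
Context (R : realType) (n : nat).
Local Notation Z := 'rV[R]_(1 + n).
Local Notation E := 'rV[R]_n.
Implicit Types (t : R) (x v : E).

Definition pt t x : Z := row_mx t%:M x.

Lemma pt_space t x v (c : R) : pt t (c *: v + x) = c *: sp v + pt t x.
Proof. by rewrite /pt /sp scale_row_mx add_row_mx scaler0 add0r. Qed.

Lemma pt_time t x (c : R) : pt (c + t) x = c *: et R n + pt t x.
Proof.
rewrite /pt /et scale_row_mx add_row_mx scaler0 add0r; congr row_mx.
by rewrite raddfD /= scale_scalar_mx mulr1.
Qed.

Lemma pt_time0 t x : pt t x 0 (time_index n) = t.
Proof. by rewrite /pt row_mxEl mxE eqxx mulr1n. Qed.

(** The two difference quotients are the same function, so the derivatives agree even where the
    limit does not exist and takes its default value. *)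
Lemma derive_slice (W : normedModType R) (f : Z -> W) t x v :
  'D_v (fun y => f (pt t y)) x = pd (sp v) f (pt t x).
Proof.
rewrite pdE /derive; set d := (fun _ : R => _); set d' := (fun _ : R => _).
suff -> : d = d' by []; rewrite funeqE => c; by rewrite /d /d' /= pt_space.
Qed.

Lemma derive1_slice (W : normedModType R) (f : Z -> W) t x :
  derive1 (fun s => f (pt s x)) t = pd (et R n) f (pt t x).
Proof.
rewrite pdE /derive1 /derive; set d := (fun _ : R => _); set d' := (fun _ : R => _).
suff -> : d = d' by []; rewrite funeqE => c; by rewrite /d /d' /= pt_time.
Qed.

Lemma derivable_slice (W : normedModType R) (f : Z -> W) t x :
  derivable f (pt t x) (et R n) -> derivable (fun s => f (pt s x)) t 1.
Proof.
rewrite /derivable; set d := (fun _ : R => _); set d' := (fun _ : R => _).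
suff -> : d = d' by [].
by rewrite funeqE => c; rewrite /d /d' /= [c%:A]mulr1 pt_time.
Qed.

End Slices.

Section Translation.
Context (R : realType) (n : nat) (Omega : open_domain R (1 + n)).
Local Notation Z := 'rV[R]_(1 + n).
Local Notation E := 'rV[R]_n.
Context (G : Z -> 'M[R]_n) (U : Z -> E) (u l : Z -> R).
Hypothesis Ga : anm Omega G.
Hypothesis Ua : anm Omega U.
Hypothesis la : an Omega l.
Hypothesis l_gt0 : forall z, Omega z -> 0 < l z.

Let l0 z : Omega z -> l z != 0.
Proof. by move=> /l_gt0 /lt0r_neq0. Qed.

Let gs (s : R) (y : E) := G (pt s y).
Let Us (s : R) (y : E) := U (pt s y).
Let us (s : R) (y : E) := u (pt s y).
Let ls (s : R) (y : E) := l (pt s y).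

Implicit Types (t : R) (x y : E).
Local Notation et := (et R n).

Lemma christoffel_slice t x v w : Omega (pt t x) -> christoffel (gs t) x v w = Gam G (pt t x) v w.
Proof.
move=> Oz; rewrite /christoffel /Gam; congr (_ *m _); apply/rowP => k.
rewrite [LHS]mxE [RHS]mxE /koszul /gs.
rewrite (derive_slice (fun z => bil (G z) w (delta_mx 0 k))).
rewrite (derive_slice (fun z => bil (G z) v (delta_mx 0 k))).
rewrite (derive_slice (fun z => bil (G z) v w)).
have H a b c : pd (sp c) (fun z => bil (G z) a b) (pt t x) =
    bl (pd (sp c) G (pt t x)) a b.
  have := an_derive_bil (sp c) Ga (anm_cst a) (anm_cst b) Oz.
  by rewrite !pd_cst bil0l bil0r !addr0 blE.
by rewrite !H.
Qed.

Lemma nabla_slice t x (X : E -> E) (Q : Z -> E) : Omega (pt t x) ->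
  nabla (gs t) X (fun y => Q (pt t y)) x =
  pd (sp (X x)) Q (pt t x) + Gam G (pt t x) (X x) (Q (pt t x)).
Proof. by move=> Oz; rewrite /nabla derive_slice christoffel_slice. Qed.

Lemma nabla_form_slice t x (H : Z -> 'M[R]_n) (P Q W : Z -> E) :
  Omega (pt t x) -> anm Omega H -> anm Omega Q -> anm Omega W ->
  nabla_form (gs t) (fun y => H (pt t y)) (fun y => P (pt t y))
    (fun y => Q (pt t y)) (fun y => W (pt t y)) x =
  Tn G H (pt t x) (P (pt t x)) (Q (pt t x)) (W (pt t x)).
Proof.
move=> Oz Ha Qa Wa; rewrite /nabla_form !nabla_slice // /pairing.
rewrite (derive_slice (fun z => bil (H z) (Q z) (W z))).
have := an_derive_bil (sp (P (pt t x))) Ha Qa Wa Oz; rewrite /Tn blE => ->.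
by rewrite -!blE !bil_lin; ring.
Qed.

Lemma dnabla_slice t x (H : Z -> 'M[R]_n) (P Q W : Z -> E) : Omega (pt t x) ->
  anm Omega H -> anm Omega P -> anm Omega Q -> anm Omega W ->
  dnabla (gs t) (fun y => H (pt t y)) (fun y => P (pt t y))
    (fun y => Q (pt t y)) (fun y => W (pt t y)) x =
  Tn G H (pt t x) (P (pt t x)) (Q (pt t x)) (W (pt t x))
  - Tn G H (pt t x) (Q (pt t x)) (P (pt t x)) (W (pt t x)).
Proof. by move=> Oz Ha Pa Qa Wa; rewrite /dnabla !nabla_form_slice. Qed.

Lemma grad_slice s y : grad (gs s) (ls s) y = L G l (pt s y).
Proof.
rewrite /grad /L; congr (_ *m _); apply/rowP => k; rewrite !mxE /ls.
by rewrite (derive_slice l).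
Qed.

Lemma hess_slice t x (P : Z -> E) Y : Omega (pt t x) ->
  hess (gs t) (ls t) (fun y => P (pt t y)) (cst Y) x =
  Hs G l (pt t x) (P (pt t x)) Y.
Proof.
move=> Oz; rewrite /hess /Hs.
rewrite (_ : (fun y => 'D_(cst Y y) (ls t) y) = (fun y => pd (sp Y) l (pt t y))).
  rewrite (derive_slice (pd (sp Y) l)) (derive_slice l) (nabla_slice _ (fun=> Y)) //.
  by rewrite pd_cst add0r.
by apply/funext => y; rewrite /ls (derive_slice l).
Qed.

Lemma dotlog_slice t x : Omega (pt t x) ->
  dot (fun s y => ln (ls s y)) t x = dlog l (pt t x).
Proof.
move=> Oz; have lz : 0 < ls t x by exact: l_gt0.
have dl : derivable (fun s => ls s x) t 1.
  apply: (derivable_slice (f := l)); apply: diff_derivable.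
  exact: an_differentiable la Oz.
rewrite /dot (_ : (fun s => ln (ls s x)) = (@ln R) \o (fun s => ls s x)) //.
have dln := is_derive1_ln lz.
rewrite derive1_comp; [|exact: dl|by case: dln].
have [_ dlnE] := dln; rewrite derive1E dlnE.
by rewrite (derive1_slice l) mulrC.
Qed.

Lemma dot_slice (W : normedModType R) (f : Z -> W) s y :
  dot (fun s y => f (pt s y)) s y = pd et f (pt s y).
Proof. exact: derive1_slice. Qed.

Lemma dot_dot_slice (W : normedModType R) (f : Z -> W) s y :
  dot (dot (fun s y => f (pt s y))) s y = pd et (pd et f) (pt s y).
Proof.
rewrite (_ : dot (fun s y => f (pt s y)) = (fun s y => pd et f (pt s y))).
  exact: dot_slice.
by apply/funext => s'; apply/funext => y'; rewrite dot_slice.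
Qed.

Lemma near_slice t x : Omega (pt t x) -> \forall y \near x, Omega (pt t y).
Proof.
move=> /Omega_near /nbhs_ballP [e /= e0 Oe]; apply/nbhs_ballP; exists e => //= y.
rewrite -!ball_normE /= => xy; apply: Oe; rewrite -ball_normE /=.
apply: le_lt_trans xy; rewrite /pt opp_row_mx add_row_mx subrr.
rewrite [leLHS]/Num.Def.normr/= mx_normrE bigmax_le // => -[i j] _ /=.
rewrite mxE; case: splitP => k _; first by rewrite mxE normr0.
rewrite ord1; exact: rV_norm_ge.
Qed.

Lemma riem_slice t x X Y : Omega (pt t x) ->
  riem (gs t) (cst X) (Us t) (Us t) (cst Y) x = Rm G U (pt t x) X Y.
Proof.
move=> Oz; rewrite /riem /Rm blE.
have On := near_slice Oz.
(* [nabla] depends only on germs, so an inner covariant derivative may be replaced by its spacetime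
   expression, known only at points of [Omega], before the outer one is taken. *)
have nablaE (F : E -> E) (F' : Z -> E) (P : E -> E) :
    (forall y, Omega (pt t y) -> F y = F' (pt t y)) ->
    nabla (gs t) P F x = pd (sp (P x)) F' (pt t x) + Gam G (pt t x) (P x) (F' (pt t x)).
  move=> FF; apply: etrans (nabla_slice P F' Oz); rewrite /nabla.
  congr (_ + christoffel (gs t) x (P x) _); last exact: FF.
  by apply: near_eq_derive; apply: filterS On => y; exact: FF.
rewrite (nablaE _ (fun z => nablaU G U z (U z))); last first.
  by move=> y Oy; rewrite (nabla_slice _ U).
rewrite (nablaE _ (fun z => nablaU G U z X)); last first.
  by move=> y Oy; rewrite (nabla_slice _ U).
rewrite (nablaE _ U) // /lie_bracket derive_cst subr0 (derive_slice U).
by [].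
Qed.

Lemma metric_equation_slice t x X Y : Omega (pt t x) ->
  metric_equation gs Us us ls t x X Y <-> metric_defect G U u l (pt t x) X Y = 0.
Proof.
move=> Oz; rewrite /metric_equation (dot_dot_slice G) dotlog_slice // riem_slice //.
rewrite (hess_slice (fun=> X)) // !(dot_slice G).
have hE : (fun y => (ls t y)^-1 *: dot gs t y) = (fun y => h G l (pt t y)).
  by apply/funext => y; exact: (congr1 _ (dot_slice G t y)).
have dgE (A B C : Z -> E) : anm Omega A -> anm Omega B -> anm Omega C ->
    dnabla (gs t) (fun y => (ls t y)^-1 *: dot gs t y) (fun y => A (pt t y))
      (fun y => B (pt t y)) (fun y => C (pt t y)) x =
    dn G l (pt t x) (A (pt t x)) (B (pt t x)) (C (pt t x)).
  move=> Aa Ba Ca; apply: etrans (dnabla_slice Oz (h_an Ga la l0) Aa Ba Ca).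
  by rewrite hE.
rewrite (dgE U (fun=> X) (fun=> Y) Ua (anm_cst X) (anm_cst Y)).
rewrite (dgE U (fun=> Y) (fun=> X) Ua (anm_cst Y) (anm_cst X)).
rewrite /metric_defect blE /dlog /S /Gd /us /ls /gs /Us; split.
  by move=> ->; rewrite subrr.
by move=> /eqP; rewrite subr_eq0 => /eqP.
Qed.

Lemma vector_equation_slice t x X : Omega (pt t x) ->
  vector_equation gs Us us ls t x X <-> vector_defect G U u l (pt t x) X = 0.
Proof.
move=> Oz; rewrite /vector_equation (dot_dot_slice U) dotlog_slice //.
have hE : (fun y => (ls t y)^-1 *: dot gs t y) = (fun y => h G l (pt t y)).
  by apply/funext => y; exact: (congr1 _ (dot_slice G t y)).
rewrite (hess_slice U) // !(dot_slice G) !(dot_slice U) !(dot_slice u).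
rewrite !grad_slice (_ : (fun s => grad (gs s) (ls s)) = (fun s y => L G l (pt s y))).
  rewrite !(dot_slice (L G l)) !(derive_slice l).
  have -> : dnabla (gs t) (fun y => (ls t y)^-1 *: dot gs t y) (Us t) (cst X) (Us t) x =
      dn G l (pt t x) (U (pt t x)) X (U (pt t x)).
    by apply: etrans (dnabla_slice Oz (h_an Ga la l0) Ua (anm_cst X) Ua); rewrite hE.
  rewrite /vector_defect blE /dlog /S /Gd /us /ls /gs /Us; split.
    by move=> ->; rewrite subrr.
  by move=> /eqP; rewrite subr_eq0 => /eqP.
by apply/funext => s; apply/funext => y; exact: grad_slice.
Qed.

Lemma function_equation_slice t x : Omega (pt t x) ->
  function_equation gs Us us ls t x <-> function_defect G U u l (pt t x) = 0.
Proof.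
move=> Oz; rewrite /function_equation (dot_dot_slice u).
rewrite !(dot_slice G) !(dot_slice U) !grad_slice.
rewrite (_ : (fun s => grad (gs s) (ls s)) = (fun s y => L G l (pt s y))).
  rewrite !(dot_slice (L G l)) !(derive_slice l).
  rewrite /function_defect blE /dlog /S /Gd /us /ls /gs /Us; split.
    by move=> ->; rewrite subrr.
  by move=> /eqP; rewrite subr_eq0 => /eqP.
by apply/funext => s; apply/funext => y; exact: grad_slice.
Qed.

End Translation.

(** * The Levi-Civita connection of the spacetime metric *)

Lemma christoffelE (R : realType) (m : nat) (Omega : open_domain R m)
    (g : 'rV[R]_m -> 'M[R]_m) (z v w y : 'rV[R]_m) : anm Omega g ->
  Omega z -> g z \in unitmx ->
  bl (g z) (christoffel g z v w) y =
  2^-1 * (bl (pd v g z) w y + bl (pd w g z) v y - bl (pd y g z) v w).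
Proof.
move=> ga Oz gu; rewrite /christoffel bil_row //.
have H a b c : 'D_c (fun z => bil (g z) a b) z = bl (pd c g z) a b.
  have := an_derive_bil c ga (anm_cst a) (anm_cst b) Oz.
  by rewrite !pd_cst bil0l bil0r !addr0 blE pdE.
have -> : bl (pd y g z) v w = \sum_k y 0 k * bl (pd (delta_mx 0 k) g z) v w.
  rewrite {1}[y]row_sum_delta; elim: (index_enum _) => [|k s ih].
    by rewrite !big_nil pd0 bil0m.
  rewrite !big_cons (anm_derive_dirD _ _ ga Oz) (anm_derive_dirZ _ _ ga Oz).
  by rewrite bilDm bilZm ih.
rewrite (bil_sumr (pd v g z) w y) (bil_sumr (pd w g z) v y) -big_split -sumrB mulr_sumr /=.
by apply: eq_bigr => k _; rewrite !H; ring.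
Qed.

Section Spacetime.
Context (R : realType) (n : nat) (Omega : open_domain R (1 + n)).
Local Notation Z := 'rV[R]_(1 + n).
Local Notation E := 'rV[R]_n.
Context (G : Z -> 'M[R]_n) (U : Z -> E) (u l : Z -> R).
Hypothesis Ga : anm Omega G.
Hypothesis Ua : anm Omega U.
Hypothesis ua : an Omega u.
Hypothesis la : an Omega l.
Hypothesis Gsym : forall z, Omega z -> (G z)^T = G z.
Hypothesis Gunit : forall z, Omega z -> G z \in unitmx.
Hypothesis l0 : forall z, Omega z -> l z != 0.
Local Notation et := (et R n).

Definition Gbar z : 'M[R]_(1 + n) := block_mx (- l z ^+ 2)%:M 0 0 (G z).
Definition Vbar z : Z := row_mx (u z / l z)%:M (- U z).

Lemma row_mx_spE (a : R) (X : E) : row_mx a%:M X = a *: et + sp X.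
Proof.
by rewrite /et /sp scale_row_mx add_row_mx scaler0 addr0 add0r scale_scalar_mx mulr1.
Qed.

Lemma bl_block (a b c : R) (M : 'M[R]_n) (p q : E) :
  bl (block_mx a%:M 0 0 M : 'M[R]_(1 + n)) (row_mx b%:M p) (row_mx c%:M q) =
  a * b * c + bl M p q.
Proof.
rewrite !blE /bil mul_row_block !mulmx0 addr0 add0r tr_row_mx mul_row_col.
rewrite [LHS]mxE; congr (_ + _).
by rewrite -scalar_mxM tr_scalar_mx -scalar_mxM mxE eqxx mulr1n [b * a]mulrC.
Qed.

Lemma Gbar_unit z : Omega z -> Gbar z \in unitmx.
Proof.
move=> Oz; rewrite unitmxE det_ublock det_scalar1 unitrM.
by rewrite -unitmxE Gunit // andbT unitfE oppr_eq0 expf_neq0 // l0.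
Qed.

Lemma anm_block (a b : Z -> R) (M : Z -> 'M[R]_n) : an Omega a -> anm Omega M ->
  anm Omega (fun z => block_mx (a z)%:M 0 0 (M z) : 'M[R]_(1 + n)).
Proof.
move=> aa Ma i j; case: (splitP i) => i' ii'; case: (splitP j) => j' jj'.
- apply: an_eq aa => z _.
  have -> : i = lshift n i' by apply/val_inj.
  have -> : j = lshift n j' by apply/val_inj.
  by rewrite block_mxEul !ord1 mxE eqxx mulr1n.
- apply: an_eq (an_cst 0) => z _.
  have -> : i = lshift n i' by apply/val_inj.
  have -> : j = rshift 1 j' by apply/val_inj.
  by rewrite block_mxEur mxE.
- apply: an_eq (an_cst 0) => z _.
  have -> : i = rshift 1 i' by apply/val_inj.
  have -> : j = lshift n j' by apply/val_inj.
  by rewrite block_mxEdl mxE.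
- apply: an_eq (Ma i' j') => z _.
  have -> : i = rshift 1 i' by apply/val_inj.
  have -> : j = rshift 1 j' by apply/val_inj.
  by rewrite block_mxEdr.
Qed.

Lemma anm_scalar (a : Z -> R) : an Omega a -> anm Omega (fun z => (a z)%:M : 'M[R]_1).
Proof. by move=> aa i j; apply: an_eq aa => z _; rewrite !ord1 mxE eqxx mulr1n. Qed.

Lemma Gbar_an : anm Omega Gbar.
Proof. by apply: anm_block => //; apply: anN; exact: anX. Qed.

Lemma ul_quot_an : an Omega (fun z => u z / l z).
Proof. by apply: anM => //; exact: anV. Qed.

Lemma Vbar_an : anm Omega Vbar.
Proof.
by apply: anm_row_mx; [apply: anm_scalar; exact: ul_quot_an|exact: anmN].
Qed.

Lemma pd_Gbar w z a b (X Y : E) : Omega z ->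
  bl (pd w Gbar z) (row_mx a%:M X) (row_mx b%:M Y) =
  - (2 * l z * pd w l z) * a * b + bl (pd w G z) X Y.
Proof.
move=> Oz.
have := an_derive_bil w Gbar_an (anm_cst (row_mx a%:M X)) (anm_cst (row_mx b%:M Y)) Oz.
rewrite !pd_cst bil0l bil0r !addr0 => <-.
have -> : pd w (fun z => bl (Gbar z) (row_mx a%:M X) (row_mx b%:M Y)) z =
   pd w (fun z => - (l z * l z) * (a * b) + bl (G z) X Y) z.
  by apply: eq_derive_on Oz => y _; rewrite bl_block expr2 mulrA.
have a1 := anN (anM la la).
have a2 := an_bil Ga (anm_cst X) (anm_cst Y).
rewrite (an_deriveD _ (anM a1 (an_cst _)) a2 Oz) (an_deriveM _ a1 (an_cst _) Oz).
rewrite (an_deriveN _ (anM la la) Oz) (an_deriveM _ la la Oz) pd_cst.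
rewrite (an_derive_bil _ Ga (anm_cst X) (anm_cst Y) Oz) !pd_cst bil0l bil0r.
by ring.
Qed.

Lemma pd_Vbar w z : Omega z -> pd w Vbar z =
  row_mx (pd w u z / l z - u z * pd w l z / l z ^+ 2)%:M (- pd w U z).
Proof.
move=> Oz; rewrite -(hsubmxK (pd w Vbar z)); congr row_mx.
  rewrite [LHS]mx11_scalar; congr (_%:M); rewrite mxE (anm_deriveE _ _ _ Vbar_an Oz).
  have -> : pd w (fun y => Vbar y 0 (lshift n 0)) z = pd w (fun y => u y / l y) z.
    by apply: eq_derive_on Oz => y _; rewrite row_mxEl mxE eqxx mulr1n.
  rewrite (an_deriveM _ ua (anV l0 la) Oz) (an_deriveV _ la (l0 Oz) Oz).
  by field; exact: l0.
apply/rowP => k; rewrite [LHS]mxE (anm_deriveE _ _ _ Vbar_an Oz).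
rewrite -(anm_deriveN _ Ua Oz) (anm_deriveE _ _ _ (anmN Ua) Oz).
by apply: eq_derive_on Oz => y _; rewrite row_mxEr.
Qed.

Lemma pd_row_mx (f : Z -> R) a X z : an Omega f -> Omega z ->
  pd (row_mx a%:M X) f z = a * pd et f z + pd (sp X) f z.
Proof.
move=> fa Oz; rewrite row_mx_spE (an_derive_dirD _ _ fa Oz).
by rewrite (an_derive_dirZ _ _ fa Oz).
Qed.

Lemma pdm_row_mx (p q : nat) (F : Z -> 'M[R]_(p, q)) a X z : anm Omega F -> Omega z ->
  pd (row_mx a%:M X) F z = a *: pd et F z + pd (sp X) F z.
Proof.
move=> fa Oz; rewrite row_mx_spE (anm_derive_dirD _ _ fa Oz).
by rewrite (anm_derive_dirZ _ _ fa Oz).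
Qed.

Lemma pd_spN (f : Z -> R) X z : an Omega f -> Omega z ->
  pd (sp (- X)) f z = - pd (sp X) f z.
Proof. by move=> fa Oz; rewrite -scaleN1r (dsp_scZ _ _ fa Oz) mulN1r. Qed.

Lemma pdm_spN (p q : nat) (F : Z -> 'M[R]_(p, q)) X z : anm Omega F -> Omega z ->
  pd (sp (- X)) F z = - pd (sp X) F z.
Proof. by move=> fa Oz; rewrite -scaleN1r (dspZ _ _ fa Oz) scaleN1r. Qed.

(** Koszul's formula for the block metric, tested against b d/dt + Y. The result is bilinear in (a,
    X) and (b, Y), so taking a and b in {0, 1} with X or Y zero isolates each of the four
    defects. *)
Lemma nabla_Vbar z a b X Y : Omega z ->
  bl (Gbar z) (nabla Gbar (cst (row_mx a%:M X)) Vbar z) (row_mx b%:M Y) =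
  - (l z * a * b * cd U u l z + l z * b * Bd G U u l z X
     + a * bl (G z) (Cd G U u l z) Y + bl (G z) (X *m AM G U u l z) Y).
Proof.
move=> Oz; rewrite /nabla (_ : 'D__ Vbar z = pd (row_mx a%:M X) Vbar z); last first.
  by rewrite pdE.
rewrite bilDl (christoffelE _ _ _ Gbar_an Oz (Gbar_unit Oz)).
rewrite pd_Vbar // bl_block /cst /Vbar !pd_Gbar //.
rewrite (pd_row_mx a X ua Oz) (pd_row_mx a X la Oz) (pd_row_mx b Y la Oz).
rewrite (pd_row_mx (u z / l z) (- U z) la Oz) (pdm_row_mx a X Ua Oz).
rewrite (pdm_row_mx a X Ga Oz) (pdm_row_mx b Y Ga Oz).
rewrite (pdm_row_mx (u z / l z) (- U z) Ga Oz).
rewrite (pd_spN (U z) la Oz) (pdm_spN (U z) Ga Oz).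
rewrite (XAM u l Ga Ua Gsym Gunit) // /nablaU /cd /Bd /Cd -/(Gd G).
have KG := GamE Ga Gunit X (U z) Y Oz; rewrite /koszul in KG.
rewrite !bil_lin KG (SE Ga Gsym Gunit) // (SE Ga Gsym Gunit) // (LE la Gunit) //.
have lz := l0 Oz.
have Nm M v w : bl (- M : 'M[R]_n) v w = - bl M v w.
  by rewrite -scaleN1r bilZm mulN1r.
by rewrite Nm; field.
Qed.

Lemma parallel_VbarP z : Omega z ->
  (forall v, nabla Gbar (cst v) Vbar z = 0) <-> parallel_at G U u l z.
Proof.
move=> Oz; have lz := l0 Oz; split=> [par|[A0 B0 c0 C0] v].
  have key a b X Y : l z * a * b * cd U u l z + l z * b * Bd G U u l z X
     + a * bl (G z) (Cd G U u l z) Y + bl (G z) (X *m AM G U u l z) Y = 0.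
    by have := nabla_Vbar a b X Y Oz; rewrite par bil0l => /esym/eqP;
      rewrite oppr_eq0 => /eqP.
  have sp00 : sp (0 : E) = 0 by exact: sp0.
  have B00 : Bd G U u l z 0 = 0.
    by rewrite /Bd sp00 pd0 bil0l mulr0 subr0.
  split.
  - apply/row_matrixP => i; rewrite row0 rowE; apply: (bil_inj (Gunit Oz)) => Y.
    by have := key 0 0 (delta_mx 0 i) Y; rewrite !(mulr0, mul0r, add0r) bil0l.
  - move=> X; have := key 0 1 X 0.
    rewrite !bil0r !(mulr0, mul0r, add0r, addr0, mulr1).
    by move=> /eqP; rewrite mulf_eq0 (negPf lz) => /eqP.
  - have := key 1 1 0 0; rewrite B00 !bil0r !(mulr0, mul0r, add0r, addr0, mulr1).
    by move=> /eqP; rewrite mulf_eq0 (negPf lz) => /eqP.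
  - apply: (bil_inj (Gunit Oz)) => Y; have := key 1 0 0 Y.
    by rewrite mul0mx !bil0l !(mulr0, mul0r, add0r, addr0, mul1r).
apply: (bil_inj (Gbar_unit Oz)) => y; rewrite bil0l.
rewrite -[v]hsubmxK -[y]hsubmxK [lsubmx v]mx11_scalar [lsubmx y]mx11_scalar.
by rewrite nabla_Vbar // A0 B0 c0 C0 mulmx0 !bil0l !(mulr0, addr0) oppr0.
Qed.

End Spacetime.

(** * Pullback, chain rule and naturality of parallel fields *)

Section Pullback.
Context (R : realType) (n : nat).
Local Notation Z := 'rV[R]_(1 + n).

Lemma hpoly_rsubmx k (M : R) (p : 'rV[R]_n -> R) : hpoly k M p ->
  hpoly k M (fun z : Z => p (rsubmx z)).
Proof.
elim=> {k M p}.
- by move=> c; exact: hpoly_const.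
- move=> k M p i _ ih; apply: hpoly_eq (hpolyX (rshift 1 i) ih) _ _ => // z.
  by rewrite mxE.
- by move=> k; exact: hpoly0.
- by move=> k M N p q _ ihp _ ihq; exact: hpolyD.
- by move=> k M N p MN _; exact: hpoly_weaken.
Qed.

Lemma rsubmx_norm (z : Z) : `|rsubmx z| <= `|z|.
Proof.
rewrite [leLHS]/Num.Def.normr/= mx_normrE bigmax_le // => -[i j] _ /=.
by rewrite ord1 mxE; exact: rV_norm_ge.
Qed.

Lemma analytic_germ_rsubmx (f : 'rV[R]_n -> R) (z : Z) :
  analytic_germ f (rsubmx z) -> analytic_germ (fun y : Z => f (rsubmx y)) z.
Proof.
move=> [P [M [K [r [K0 r0 hP cP]]]]].
exists (fun k v => P k (rsubmx v)), M, K, r; split=> //.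
  by move=> k; exact: hpoly_rsubmx.
by move=> v vr; rewrite linearD; apply: cP; exact: le_lt_trans (rsubmx_norm v) vr.
Qed.
End Pullback.

Lemma analytic_germ_coor (R : realType) (m : nat) (i : 'I_m) (a : 'rV[R]_m) :
  analytic_germ (fun y : 'rV[R]_m => y 0 i) a.
Proof.
pose P (k : nat) : 'rV[R]_m -> R :=
  if k is k'.+1 then (if k' is 0 then fun v => v 0 i else fun=> 0) else fun=> a 0 i.
exists P, (Num.max 1 `|a 0 i|), 1, 1; split=> //.
  move=> [|[|k]]; rewrite expr1n mulr1.
  - by apply: hpoly_weaken (hpoly_const _ _); rewrite le_max lexx orbT.
  - apply: (@hpoly_weaken _ _ _ 1); first by rewrite le_max lexx.
    apply: hpoly_eq (hpolyX i (hpoly_const _ (1 : R))) _ _ => [|v].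
      by rewrite normr1.
    by rewrite mulr1.
  - by apply: hpoly_weaken (hpoly0 _ _ _); rewrite le_max ler01.
move=> v _; apply: cvg_near_cst; exists 2%N => //= N N2.
rewrite /series /= big_ltn ?(leq_trans _ N2) // big_ltn // big_nat_cond big1.
  by rewrite addr0 mxE.
by case=> [|[|k]].
Qed.

Lemma pd_comp (R : realType) (m k a b : nat) (Om : open_domain R m)
    (Om' : open_domain R k) (phi : 'rV[R]_m -> 'rV[R]_k)
    (F : 'rV[R]_k -> 'M[R]_(a, b)) v z :
  anm Om phi -> anm Om' F -> Om z -> Om' (phi z) ->
  derivable (fun y => F (phi y)) z v /\
  pd v (fun y => F (phi y)) z = pd (pd v phi z) F (phi z).
Proof.
move=> pa Fa Oz Oz'.
have dphi : differentiable phi z.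
  rewrite (_ : phi = \sum_(j < k) (fun y => phi y 0 j *: (delta_mx 0 j : 'rV[R]_k))).
    apply: differentiable_sum => j; apply: differentiableZl.
    exact: an_differentiable (pa 0 j) Oz.
  by apply/funext => y; rewrite fct_sumE -row_sum_delta.
have dF i j : differentiable (fun y => F (phi y) i j) z.
  apply: (@differentiable_comp _ _ _ _ phi (fun x => F x i j)) => //.
  exact: an_differentiable (Fa i j) Oz'.
have dv : derivable (fun y => F (phi y)) z v.
  by apply/derivable_mxP => i j; exact: diff_derivable.
split=> //; apply/matrixP => i j.
rewrite (anm_deriveE _ i j Fa Oz') !pdE (derive_mx dv) mxE !deriveE //.
  exact: (congr1 (fun f => f v) (diff_comp dphi (an_differentiable (Fa i j) Oz'))).
exact: an_differentiable (Fa i j) Oz'.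
Qed.

Section Naturality.
Context (R : realType) (m : nat) (Om Om' : open_domain R m).
Local Notation E := 'rV[R]_m.
Context (phi : E -> E) (g g' : E -> 'M[R]_m) (V V' : E -> E).
Hypothesis phi_an : anm Om phi.
Hypothesis ga : anm Om g.
Hypothesis ga' : anm Om' g'.
Hypothesis Va : anm Om V.
Hypothesis Va' : anm Om' V'.
Hypothesis gunit : forall z, Om z -> g z \in unitmx.
Hypothesis gunit' : forall z, Om' z -> g' z \in unitmx.
Hypothesis gsym : forall z, Om' z -> (g' z)^T = g' z.
Hypothesis phi_dom : forall z, Om z -> Om' (phi z).
Hypothesis isometry : forall z v w, Om z ->
  bl (g' (phi z)) (pd v phi z) (pd w phi z) = bl (g z) v w.
Hypothesis pushV : forall z, Om z -> V' (phi z) = pd (V z) phi z.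

Let J z : 'M[R]_m := \matrix_i pd (delta_mx 0 i) phi z.

Let JE z v : Om z -> pd v phi z = v *m J z.
Proof.
move=> Oz; apply/rowP => j; rewrite (anm_deriveE _ 0 j phi_an Oz).
rewrite (pd_partials _ (phi_an 0 j) Oz) mxE; apply: eq_bigr => i _.
by rewrite mxE (anm_deriveE _ 0 j phi_an Oz).
Qed.

Let J_an : anm Om J.
Proof.
move=> i j; apply: an_eq (anm_derive (delta_mx 0 i) phi_an 0 j) => z _.
by rewrite [RHS]mxE.
Qed.

Let JgJ z : Om z -> J z *m g' (phi z) *m (J z)^T = g z.
Proof.
move=> Oz; apply/matrixP => i j.
have E0 (M : 'M[R]_m) : bl M (delta_mx 0 i) (delta_mx 0 j) = M i j.
  by rewrite blE /bil trmx_delta -rowE -colE !mxE.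
rewrite -!E0 -isometry // !JE // blE /bil trmx_mul !mulmxA.
by [].
Qed.

(** The isometry J g' J^T = g with g nondegenerate makes the Jacobian invertible, without recourse
    to an inverse of [phi]. *)
Let J_unit z : Om z -> J z \in unitmx.
Proof.
move=> Oz; have := gunit Oz; rewrite -(JgJ Oz) -mulmxA unitmx_mul.
by case/andP.
Qed.

(** The composite equals J^-1 g J^-T, which is analytic by matrix algebra; no power series are
    composed. *)
Let g'phi_an : anm Om (fun z => g' (phi z)).
Proof.
have iJ := anm_inv J_unit J_an.
apply: anm_eq (anm_mulmx (anm_mulmx iJ ga) (anm_tr iJ)) => z Oz /=.
rewrite -(JgJ Oz) !mulmxA mulVmx ?J_unit // mul1mx -mulmxA -trmx_mul mulVmx ?J_unit //.
by rewrite trmx1 mulmx1.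
Qed.

(** Both Christoffel vectors are expanded by Koszul's formula. Differentiating the isometry relation
    produces second derivatives of [phi]; by their symmetry all cancel except one, which matches the
    one from differentiating V' o phi = d phi(V). *)
Lemma nabla_natural z v y : Om z ->
  bl (g' (phi z)) (nabla g' (cst (pd v phi z)) V' (phi z)) (pd y phi z) =
  bl (g z) (nabla g (cst v) V z) y.
Proof.
move=> Oz; have Oz' := phi_dom Oz.
have nablaE (g0 : E -> 'M[R]_m) (V0 : E -> E) x w :
    nabla g0 (cst w) V0 x = pd w V0 x + christoffel g0 x w (V0 x).
  by rewrite pdE.
rewrite !nablaE !bilDl (christoffelE _ _ _ ga' Oz' (gunit' Oz')).
rewrite (christoffelE _ _ _ ga Oz (gunit Oz)) pushV //.
have dV : pd (pd v phi z) V' (phi z) = pd (pd v V z) phi z + pd (V z) (pd v phi) z.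
  have [_ <-] := pd_comp v phi_an Va' Oz Oz'.
  by rewrite -(anm_derive_dir _ phi_an Va Oz); exact: eq_derive_on Oz.
have dg x w1 w2 : bl (pd x g z) w1 w2 =
    bl (pd (pd x phi z) g' (phi z)) (pd w1 phi z) (pd w2 phi z)
    + bl (g' (phi z)) (pd x (pd w1 phi) z) (pd w2 phi z)
    + bl (g' (phi z)) (pd w1 phi z) (pd x (pd w2 phi) z).
  have [_ <-] := pd_comp x phi_an ga' Oz Oz'.
  have a1 := anm_derive w1 phi_an; have a2 := anm_derive w2 phi_an.
  rewrite -(an_derive_bil _ g'phi_an a1 a2 Oz).
  have := an_derive_bil x ga (anm_cst w1) (anm_cst w2) Oz.
  rewrite !pd_cst bil0l bil0r !addr0 => <-.
  by apply: eq_derive_on Oz => x' Ox'; rewrite isometry.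
rewrite dV bilDl isometry // !dg.
rewrite (anm_deriveC v (V z) phi_an Oz) (anm_deriveC y (V z) phi_an Oz).
rewrite (anm_deriveC y v phi_an Oz).
rewrite [bl (g' (phi z)) (pd (V z) phi z) (pd v (pd y phi) z)]bl_sym ?gsym //.
by field.
Qed.

Lemma parallel_natural z : Om z ->
  (forall v, nabla g (cst v) V z = 0) ->
  forall v, nabla g' (cst v) V' (phi z) = 0.
Proof.
move=> Oz par v; have Oz' := phi_dom Oz.
have surj w : w = pd (w *m invmx (J z)) phi z by rewrite JE // mulmxKV ?J_unit.
rewrite (surj v); apply: (bil_inj (gunit' Oz')) => y.
by rewrite (surj y) nabla_natural // par !bil0l.
Qed.

End Naturality.

(** * Charts *)

Section Charts.
Context (R : realType) (n : nat) (M : topologicalType) (A : atlas R n M).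
Hypothesis HM : analytic_manifold A.
Local Notation Z := 'rV[R]_(1 + n).
Implicit Types (i j : chart A) (D : set (R * M)) (z : Z) (q : R * M).

Definition img i : set 'rV[R]_n := chart_map i @` dom i.
Definition point_at i z : R * M := (lsubmx z 0 0, chart_inv i (rsubmx z)).
Definition coords i q : Z := row_mx q.1%:M (chart_map i q.2).
(** The spatial part is required to lie in the chart image because [chart_inv] has arbitrary values
    elsewhere. *)
Definition chart_domain i D : set Z := [set z | img i (rsubmx z) /\ D (point_at i z)].

Lemma coordsK i q : dom i q.2 -> point_at i (coords i q) = q.
Proof.
move=> iq; rewrite /point_at /coords row_mxKl row_mxKr mxE eqxx mulr1n chart_mapK //.
by case: q iq.
Qed.

Lemma point_atK i z : img i (rsubmx z) -> dom i (point_at i z).2 /\ coords i (point_at i z) = z.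
Proof.
move=> [p ip pz]; rewrite /point_at /coords /= -pz chart_mapK //; split=> //.
by rewrite pz -mx11_scalar hsubmxK.
Qed.

Lemma chart_domain_coords i D q : dom i q.2 -> D q -> chart_domain i D (coords i q).
Proof.
by move=> iq Dq; split; [exists q.2 => //; rewrite row_mxKr|rewrite /= coordsK].
Qed.

Lemma chart_domainE i D z : chart_domain i D z <->
  (@chart_map _ _ _ (cylinder A) i @` (@dom _ _ _ (cylinder A) i `&` D)) z.
Proof.
split=> [[iz Dz]|[q [iq Dq] <-]]; last exact: chart_domain_coords.
by have [dz lz] := point_atK iz; exists (point_at i z).
Qed.

Lemma row_mx_cvg (T : Type) (F : set_system T) (FF : Filter F) (f : T -> R)
    (g : T -> 'rV[R]_n) (a : R) (b : 'rV[R]_n) :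
  f x @[x --> F] --> a -> g x @[x --> F] --> b ->
  (row_mx (f x)%:M (g x) : Z) @[x --> F] --> (row_mx a%:M b : Z).
Proof.
move=> fa gb; apply/cvgrPdist_lt => e e0.
have {}fa : \forall x \near F, `|a - f x| < e by move/cvgrPdist_lt : fa; exact.
have {}gb : \forall x \near F, `|b - g x| < e by move/cvgrPdist_lt : gb; exact.
near=> x; rewrite opp_row_mx add_row_mx.
rewrite [ltLHS]/Num.Def.normr/= mx_normrE bigmax_lt // => -[i j] _ /=.
rewrite mxE; case: splitP => k _.
  by rewrite ord1 [k]ord1 -raddfN -raddfD /= mxE eqxx mulr1n; near: x.
rewrite ord1; apply: le_lt_trans (rV_norm_ge _ _) _; by near: x.
Unshelve. all: by end_near. Qed.

Lemma chart_map_cvg i p : dom i p -> chart_map i x @[x --> p] --> chart_map i p.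
Proof.
move=> ip; have := @chart_continuous _ _ _ _ HM i.
rewrite continuous_open_subspace; last exact: dom_open.
by apply; rewrite inE.
Qed.

Lemma chart_inv_cvg i x : img i x -> chart_inv i y @[y --> x] --> chart_inv i x.
Proof.
move=> ix; have := @chart_inv_continuous _ _ _ _ HM i.
rewrite continuous_open_subspace; last exact: image_open.
by apply; rewrite inE.
Qed.

Lemma coords_cvg i q : dom i q.2 -> coords i x @[x --> q] --> coords i q.
Proof.
move=> iq; apply: row_mx_cvg; first exact: cvg_fst.
apply: (@cvg_comp _ _ _ snd (chart_map i)); last exact: chart_map_cvg.
exact: cvg_snd.
Qed.

Lemma rsubmx_cvg z : (rsubmx x : 'rV[R]_n) @[x --> z] --> (rsubmx z : 'rV[R]_n).
Proof.
move=> B /nbhs_ballP [e /= e0 Be]; apply/nbhs_ballP; exists e => //= x.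
rewrite -ball_normE /= => zx; apply: Be; rewrite -ball_normE /= -linearB.
exact: le_lt_trans (rsubmx_norm _) zx.
Qed.

Lemma point_cvg i z : img i (rsubmx z) -> point_at i x @[x --> z] --> point_at i z.
Proof.
move=> iz B [[B1 B2] /= [h1 h2] sub].
have H1 : nbhs z [set x : Z | B1 (lsubmx x 0 0)].
  have dz : differentiable (fun x : Z => x 0 (lshift n 0)) z.
    exact: differentiable_coord.
  have := differentiable_continuous dz; move: h1; rewrite mxE => h1 /(_ B1 h1).
  rewrite (_ : [set x : Z | B1 (lsubmx x 0 0)] = [set x : Z | B1 (x 0 (lshift n 0))]) //.
  by apply/seteqP; split=> x; rewrite /= mxE.
have H2 : nbhs z [set x : Z | B2 (chart_inv i (rsubmx x))].
  exact: (rsubmx_cvg (chart_inv_cvg iz h2)).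
apply: filterS (filterI H1 H2) => x [x1 x2]; exact: (sub (_, _)).
Qed.

Lemma chart_domain_open i D : open D -> open (chart_domain i D).
Proof.
move=> oD; rewrite openE => z [iz Dz].
have oi : nbhs (rsubmx z) (img i).
  by apply: open_nbhs_nbhs; split => //; exact: image_open.
have oDz : nbhs (point_at i z) D by apply: open_nbhs_nbhs; split.
apply: filterI.
  exact: (rsubmx_cvg oi).
exact: (point_cvg iz oDz).
Qed.

End Charts.

Lemma posdef_unit (R : realType) (n : nat) (G : 'M[R]_n) :
  (forall v, v != 0 -> 0 < bil G v v) -> G \in unitmx.
Proof.
move=> Gpos; rewrite -row_free_unit; apply: inj_row_free => v vG.
apply/eqP/negPn/negP => /Gpos; rewrite /bil vG mul0mx mxE ltxx.
by [].
Qed.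

(** * Chart changes on the cylinder *)

Section Transitions.
Context (R : realType) (n : nat) (M : topologicalType) (A : atlas R n M).
Hypothesis HM : analytic_manifold A.
Local Notation Z := 'rV[R]_(1 + n).
Implicit Types (i j : chart A) (p : M).

Lemma overlapE i j x : img i x -> dom j (chart_inv i x) ->
  (chart_map i @` (dom i `&` dom j)) x.
Proof. by case=> p ip <-; rewrite chart_mapK // => jp; exists p. Qed.

Lemma overlap_open i j : open (chart_map i @` (dom i `&` dom j)).
Proof.
rewrite openE => x [p [ip jp] px].
have ix : img i x by exists p.
have xp : chart_inv i x = p by rewrite -px chart_mapK.
have oi : nbhs x (img i) by apply: open_nbhs_nbhs; split => //; exact: image_open.
have oj : nbhs (chart_inv i x) (dom j).
  by apply: open_nbhs_nbhs; split; [exact: dom_open|rewrite xp].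
by apply: filterS (filterI oi (chart_inv_cvg HM ix oj)) => y [iy jy]; exact: overlapE.
Qed.

Definition overlap i j := OpenDomain (@overlap_open i j).

Lemma transition_an i j : anm (overlap i j) (transition i j).
Proof.
by move=> a k x Ox; rewrite ord1; apply/analytic_atE; exact: transition_analytic.
Qed.

Definition change i j (z : Z) : Z := coords j (point_at i z).

Context (D : set (R * M)) (D_open : open D).
Lemma chart_overlap_open j : open (D `&` [set q | dom j q.2]).
Proof.
apply: openI => //; rewrite openE => q /= jq.
have : nbhs q.2 (dom j) by apply: open_nbhs_nbhs; split => //; exact: dom_open.
exact: cvg_snd.
Qed.

Definition Om i := OpenDomain (chart_domain_open HM (i := i) D_open).
Definition Om_overlap i j := OpenDomain (chart_domain_open HM (i := i) (@chart_overlap_open j)).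

Lemma Om_overlap_sub i j z : Om_overlap i j z -> Om i z.
Proof. by move=> [iz [Dz _]]; split. Qed.

Lemma Om_overlapP i j z : Om_overlap i j z ->
  [/\ dom i (point_at i z).2, dom j (point_at i z).2, D (point_at i z) & coords i (point_at i z) = z].
Proof.
move=> [iz [Dz jz]]; have [? ?] := point_atK HM iz.
by split.
Qed.

Lemma Om_change i j z : Om_overlap i j z -> Om j (change i j z).
Proof.
by move=> Oz; have [_ jz Dz _] := Om_overlapP Oz; exact: chart_domain_coords.
Qed.

Lemma point_change i j z : Om_overlap i j z -> point_at j (change i j z) = point_at i z.
Proof. by move=> Oz; have [_ jz _ _] := Om_overlapP Oz; rewrite /change coordsK. Qed.

Lemma changeE i j z : change i j z =
  row_mx (z 0 (time_index n))%:M (transition i j (rsubmx z)).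
Proof. by rewrite /change /coords /point_at /= mxE. Qed.

Lemma overlap_rsubmx i j z : Om_overlap i j z -> overlap i j (rsubmx z).
Proof. by move=> [iz [_ jz]]; exact: overlapE. Qed.

Lemma change_an i j : anm (Om_overlap i j) (change i j).
Proof.
apply: anm_eq; first by move=> z _; rewrite changeE; reflexivity.
apply: anm_row_mx.
  by apply: anm_scalar => z _; exact: analytic_germ_coor.
move=> a k z Oz; apply: (@analytic_germ_rsubmx _ _ (fun x => transition i j x a k)).
by apply: transition_an; exact: overlap_rsubmx.
Qed.

Lemma anm_rsubmx (O : open_domain R (1 + n)) : anm O (@rsubmx R 1 1 n).
Proof.
move=> a k; apply: (@an_eq _ _ _ (fun z => z 0 (rshift 1 k))).
  by move=> z _; rewrite mxE ord1.
by move=> z _; exact: analytic_germ_coor.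
Qed.

Lemma pd_coor m k (v z : 'rV[R]_m) : pd v (fun y : 'rV[R]_m => y 0 k) z = v 0 k.
Proof. by rewrite pdE derive_coor. Qed.

Lemma pd_change i j w z : Om_overlap i j z ->
  pd w (change i j) z = row_mx (lsubmx w) (push i j (point_at i z).2 (rsubmx w)).
Proof.
move=> Oz; have [iz jz Dz lz] := Om_overlapP Oz.
rewrite -[LHS]hsubmxK; congr row_mx.
  apply/rowP => a; rewrite ord1 !mxE (anm_deriveE _ _ _ (change_an (i := i) (j := j)) Oz).
  rewrite -[RHS](pd_coor _ _ z); apply: eq_derive_on (Oz) => y _.
  by rewrite changeE row_mxEl mxE eqxx mulr1n.
have aR : anm (Om_overlap i j) (@rsubmx R 1 1 n) by exact: anm_rsubmx.
have pr : pd w (@rsubmx R 1 1 n) z = rsubmx w.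
  apply/rowP => k; rewrite (anm_deriveE _ _ _ aR Oz) mxE -[RHS](pd_coor _ _ z).
  by congr (pd _ _ _); apply/funext => y; rewrite mxE.
have [_ H] := pd_comp w aR (transition_an (i := i) (j := j)) Oz (overlap_rsubmx Oz).
rewrite pr in H.
have -> : push i j (point_at i z).2 (rsubmx w) = pd (rsubmx w) (transition i j) (rsubmx z).
  by rewrite pdE /push -{2}lz /coords row_mxKr.
rewrite -H; apply/rowP => k; rewrite mxE.
rewrite (anm_deriveE _ _ _ (change_an (i := i) (j := j)) Oz).
rewrite (@anm_deriveE _ _ (Om_overlap i j) _ _ (fun y => transition i j (rsubmx y))) //.
  by apply: eq_derive_on (Oz) => y _; rewrite changeE row_mxEr.
move=> a b y Oy; apply: (@analytic_germ_rsubmx _ _ (fun x => transition i j x a b)).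
by apply: transition_an; exact: overlap_rsubmx.
Qed.

End Transitions.

(** * Orthonormal bases and the Lorentzian signature *)

Lemma posdef_basis (R : realType) (n : nat) (G : 'M[R]_n) : G^T = G ->
  (forall v, v != 0 -> 0 < bil G v v) ->
  exists2 P : 'M[R]_n, P \in unitmx & P *m G *m P^T = 1%:M.
Proof.
elim: n G => [|n ih] G Gsym Gpos.
  by exists 1%:M; rewrite ?unitmx1 //; apply/matrixP; case.
pose G1 : 'M[R]_(1 + n) := G.
pose a := (ulsubmx G1) 0 0; pose b := ursubmx G1; pose N := drsubmx G1.
have GE : G1 = block_mx a%:M b b^T N.
  rewrite -[LHS]submxK /a -mx11_scalar; congr block_mx.
  by rewrite /b trmx_ursub [G1^T]Gsym.
have G1pos (v : 'rV[R]_(1 + n)) : v != 0 -> 0 < (v *m G1 *m v^T) 0 0.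
  exact: Gpos.
have a_gt0 : 0 < a.
  have /G1pos : (row_mx 1%:M 0 : 'rV[R]_(1 + n)) != 0.
    by rewrite row_mx_eq0 negb_and -scalemx1 scale1r oner_neq0.
  rewrite GE mul_row_block tr_row_mx mul_row_col !mul0mx !addr0 !mul1mx trmx0.
  by rewrite mulmx0 addr0 trmx1 mulmx1 mxE eqxx mulr1n.
have a0 := lt0r_neq0 a_gt0.
(* Completing the square: [Q] clears the first row and column and leaves the Schur complement [N'],
   which inherits positivity; the first vector is then rescaled by the inverse square root of a. *)
pose c := a^-1 *: b.
pose Q : 'M[R]_(1 + n) := block_mx 1%:M 0 (- c^T) 1%:M.
pose N' := N - c^T *m b.
have Qu : Q \in unitmx by rewrite unitmxE det_lblock !det1 mulr1 unitr1.
have QGQ : Q *m G1 *m Q^T = block_mx a%:M 0 0 N'.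
  rewrite GE /Q tr_block_mx !mulmx_block !trmx1 trmx0 linearN /= trmxK.
  rewrite !mul1mx !mul0mx !mulmx1 !addr0 !mulmx0 !addr0 !mulNmx !mulmxN.
  have -> : c^T *m a%:M = b^T.
    by rewrite mul_mx_scalar /c linearZ /= scalerA divff // scale1r.
  have -> : a%:M *m c = b by rewrite mul_scalar_mx /c scalerA divff // scale1r.
  by rewrite !addNr mul0mx oppr0 add0r addrC.
have N'T : N'^T = N'.
  have : (Q *m G1 *m Q^T)^T = Q *m G1 *m Q^T.
    by rewrite !trmx_mul trmxK [G1^T]Gsym mulmxA.
  by rewrite QGQ tr_block_mx => /eq_block_mx [].
have N'pos v : v != 0 -> 0 < bil N' v v.
  move=> v0; have /G1pos : (row_mx 0 v : 'rV[R]_(1 + n)) *m Q != 0.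
    apply: contra v0 => /eqP vQ.
    have : (row_mx 0 v : 'rV[R]_(1 + n)) == 0.
      by rewrite -(mulmxK Qu (row_mx 0 v)) vQ mul0mx.
    by rewrite row_mx_eq0 => /andP[].
  rewrite trmx_mul !mulmxA -2!(mulmxA (row_mx 0 v)) QGQ.
  by rewrite mul_row_block tr_row_mx mul_row_col !mul0mx !mulmx0 !add0r trmx0 mulmx0 add0r.
have [P Pu PNP] := ih N' N'T N'pos.
pose s := (Num.sqrt a)^-1.
have s0 : s != 0 by rewrite invr_neq0 // gt_eqF // sqrtr_gt0.
have ssa : s * a * s = 1.
  rewrite /s -[X in _ * X * _](sqr_sqrtr (ltW a_gt0)).
  by field; rewrite gt_eqF // sqrtr_gt0.
pose B : 'M[R]_(1 + n) := block_mx s%:M 0 0 P.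
have Bu : B \in unitmx.
  by rewrite unitmxE det_ublock det_scalar1 unitrM -unitmxE Pu andbT unitfE.
suff BQ : B *m Q *m G1 *m (B *m Q)^T = 1%:M.
  by exists (B *m Q); rewrite ?unitmx_mul ?Bu.
rewrite trmx_mul !mulmxA -2!(mulmxA B) QGQ /B tr_block_mx !mulmx_block.
rewrite !(trmx0, mul0mx, mulmx0, addr0, add0r) PNP.
rewrite tr_scalar_mx -!scalar_mxM ssa.
by rewrite -scalar_mx_block.
Qed.

Lemma lorentz_basis (R : realType) (n : nat) (G : 'M[R]_n) (l : R) : G^T = G ->
  (forall v, v != 0 -> 0 < bil G v v) -> l != 0 ->
  exists2 P : 'M[R]_(1 + n), P \in unitmx &
    P *m block_mx (- l ^+ 2)%:M 0 0 G *m P^T = block_mx (- 1)%:M 0 0 1%:M.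
Proof.
move=> Gsym Gpos l0; have [P Pu PGP] := posdef_basis Gsym Gpos.
exists (block_mx l^-1%:M 0 0 P).
  rewrite unitmxE det_ublock det_scalar1 unitrM.
  by rewrite -unitmxE Pu andbT unitfE invr_eq0.
rewrite tr_block_mx !mulmx_block.
rewrite !(trmx0, mul0mx, mulmx0, addr0, add0r) PGP.
rewrite tr_scalar_mx -!scalar_mxM; congr (block_mx _%:M _ _ _).
by field.
Qed.

(** * One-parameter families in charts and propagation of parallelism *)

Section Families.
Context (R : realType) (n : nat) (M : topologicalType) (A : atlas R n M).
Hypothesis HM : analytic_manifold A.
Local Notation Z := 'rV[R]_(1 + n).
Implicit Types (i j : chart A) (p : M) (z : Z) (q : R * M).
Context (lambda : R * M -> R) (lambda_gt0 : forall q : R * M, 0 < lambda q).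
Hypothesis lambda_analytic : analytic_function (cylinder A) setT lambda.
Context (D : set (R * M)) (D_open : open D).
Context (gt : R -> chart A -> M -> 'M[R]_n) (Ut : R -> chart A -> M -> 'rV[R]_n).
Context (ut : R * M -> R).
Hypothesis gt_family : metric_family D gt.
Hypothesis Ut_family : vector_family D Ut.
Hypothesis ut_family : positive_family A D ut.

Let O i := Om HM D_open i.
Definition Gc i z : 'M[R]_n := gt (point_at i z).1 i (point_at i z).2.
Definition Uc i z : 'rV[R]_n := Ut (point_at i z).1 i (point_at i z).2.
Definition uc i z : R := ut (point_at i z).
Definition lc i z : R := lambda (point_at i z).

Lemma Gc_an i : anm (O i) (Gc i).
Proof.
move=> a b z /(chart_domainE HM i D) Oz; apply/analytic_atE.
by case: gt_family => _ /(_ i a b z); apply.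
Qed.

Lemma Uc_an i : anm (O i) (Uc i).
Proof.
move=> a b z /(chart_domainE HM i D) Oz; apply/analytic_atE.
by case: Ut_family => _ /(_ i a b z); apply.
Qed.

Lemma uc_an i : an (O i) (uc i).
Proof.
move=> z /(chart_domainE HM i D) Oz; apply/analytic_atE.
by case: ut_family => _ /(_ i z); apply.
Qed.

Lemma lc_an i : an (O i) (lc i).
Proof.
move=> z [iz Dz]; apply/analytic_atE.
by apply: lambda_analytic; apply/(chart_domainE HM i setT).
Qed.

Lemma Gc_spec i z : O i z ->
  (Gc i z)^T = Gc i z /\ forall v, v != 0 -> 0 < bil (Gc i z) v v.
Proof.
move=> [iz Dz]; have [dz _] := point_atK HM iz.
have [_ h] := gt_family.1 (point_at i z).1.
exact: (h i (point_at i z).2 Dz dz).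
Qed.

Lemma Gc_sym i z : O i z -> (Gc i z)^T = Gc i z.
Proof. by move=> /Gc_spec []. Qed.

Lemma Gc_unit i z : O i z -> Gc i z \in unitmx.
Proof. by move=> /Gc_spec [_]; exact: posdef_unit. Qed.

Lemma uc_neq0 i z : O i z -> uc i z != 0.
Proof. by move=> [_ Dz]; rewrite gt_eqF //; case: ut_family => h _; exact: (h _ Dz). Qed.

Lemma lc_gt0 i z : O i z -> 0 < lc i z.
Proof. by move=> _; exact: lambda_gt0. Qed.

Lemma lc_neq0 i z : O i z -> lc i z != 0.
Proof. by move=> _; rewrite gt_eqF //; exact: lambda_gt0. Qed.

Lemma O_coords i q : dom i q.2 -> D q -> O i (coords i q).
Proof. exact: chart_domain_coords. Qed.

Lemma O_point i z : O i z ->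
  [/\ dom i (point_at i z).2, D (point_at i z) & coords i (point_at i z) = z].
Proof. by move=> [iz Dz]; have [? ?] := point_atK HM iz. Qed.

Let gbar := spacetime_metric lambda gt.
Let V := spacetime_field lambda ut Ut.

Lemma parallelE : parallel D gbar V <->
  forall i z, O i z -> parallel_at (Gc i) (Uc i) (uc i) (lc i) z.
Proof.
have P i z (Oz : O i z) := parallel_VbarP (@Gc_an i) (@Uc_an i) (@uc_an i) (@lc_an i)
  (@Gc_sym i) (@Gc_unit i) (@lc_neq0 i) Oz.
split=> [par i z Oz|par i q v Dq iq].
  apply/(P i z Oz) => v; have [iz Dz lz] := O_point Oz.
  by have := par i _ v Dz iz; rewrite -{2}lz.
have Oz := O_coords iq Dq.
exact: ((P i _ Oz).2 (par i _ Oz) v).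
Qed.

Lemma evolutionE : evolution_system gt Ut ut lambda D <->
  forall i z, O i z ->
  [/\ forall X Y, metric_defect (Gc i) (Uc i) (uc i) (lc i) z X Y = 0,
      forall X, vector_defect (Gc i) (Uc i) (uc i) (lc i) z X = 0 &
      function_defect (Gc i) (Uc i) (uc i) (lc i) z = 0].
Proof.
have ptE i t x : point_at i (pt t x) = (t, chart_inv i x).
  by rewrite /point_at /pt row_mxKl row_mxKr mxE eqxx mulr1n.
have gE i : (fun s => local (gt s) i) = (fun s y => Gc i (pt s y)).
  by apply/funext => s; apply/funext => y; rewrite /Gc ptE.
have UE i : (fun s => local (Ut s) i) = (fun s y => Uc i (pt s y)).
  by apply/funext => s; apply/funext => y; rewrite /Uc ptE.
have uE i : (fun s y => ut (s, chart_inv i y)) = (fun s y => uc i (pt s y)).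
  by apply/funext => s; apply/funext => y; rewrite /uc ptE.
have lE i : (fun s y => lambda (s, chart_inv i y)) = (fun s y => lc i (pt s y)).
  by apply/funext => s; apply/funext => y; rewrite /lc ptE.
have P i t x (Oz : O i (pt t x)) :
    ((forall X Y, metric_equation (fun s => local (gt s) i) (fun s => local (Ut s) i)
        (fun s y => ut (s, chart_inv i y)) (fun s y => lambda (s, chart_inv i y)) t x X Y) /\
     (forall X, vector_equation (fun s => local (gt s) i) (fun s => local (Ut s) i)
        (fun s y => ut (s, chart_inv i y)) (fun s y => lambda (s, chart_inv i y)) t x X) /\
     function_equation (fun s => local (gt s) i) (fun s => local (Ut s) i)
        (fun s y => ut (s, chart_inv i y)) (fun s y => lambda (s, chart_inv i y)) t x) <->
    [/\ forall X Y, metric_defect (Gc i) (Uc i) (uc i) (lc i) (pt t x) X Y = 0,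
      forall X, vector_defect (Gc i) (Uc i) (uc i) (lc i) (pt t x) X = 0 &
      function_defect (Gc i) (Uc i) (uc i) (lc i) (pt t x) = 0].
  rewrite gE UE uE lE.
  have m X Y := metric_equation_slice (uc i) (@Gc_an i) (@Uc_an i) (@lc_an i) (@lc_gt0 i) X Y Oz.
  have v X := vector_equation_slice (uc i) (@Gc_an i) (@Uc_an i) (@lc_an i) (@lc_gt0 i) X Oz.
  have f := function_equation_slice (Gc i) (Uc i) (uc i) (lc i) Oz.
  split=> [[h1 [h2 h3]]|[h1 h2 h3]]; split; try split.
  - by move=> X Y; apply/m.
  - by move=> X; apply/v.
  - exact/f.
  - by move=> X Y; apply/m.
  - by move=> X; apply/v.
  - exact/f.
split=> [ev i z Oz|ev i t p Dp ip].
  have [iz Dz zE] := O_point Oz.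
  have Oz' : O i (pt (point_at i z).1 (chart_map i (point_at i z).2)).
    by rewrite (_ : pt _ _ = z).
  by rewrite -zE; exact: ((P i _ _ Oz').1 (ev i _ _ Dz iz)).
have Oz : O i (pt t (chart_map i p)) by exact: (@O_coords i (t, p)).
by apply/(P i t _ Oz); exact: ev.
Qed.

Lemma push_opp i j p v : dom i p -> dom j p -> push i j p (- v) = - push i j p v.
Proof.
move=> ip jp; have Ox : overlap HM i j (chart_map i p) by exists p.
have pushE w : push i j p w = pd w (transition i j) (chart_map i p) by rewrite pdE.
by rewrite !pushE -scaleN1r
  (anm_derive_dirZ _ _ (@transition_an _ _ _ _ HM i j) Ox) scaleN1r.
Qed.

Lemma change_isometry i j z v w : Om_overlap HM D_open i j z ->
  bl (Gbar (Gc j) (lc j) (change i j z)) (pd v (change i j) z) (pd w (change i j) z) =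
  bl (Gbar (Gc i) (lc i) z) v w.
Proof.
move=> Oz; have [iz jz Dz zE] := Om_overlapP Oz.
rewrite -[v in RHS]hsubmxK -[w in RHS]hsubmxK !(pd_change _ Oz).
rewrite [lsubmx v]mx11_scalar [lsubmx w]mx11_scalar !bl_block /Gc /lc.
rewrite (point_change Oz) blE; congr (_ + _).
exact: ((gt_family.1 (point_at i z).1).1 i j _ _ _ Dz iz jz).
Qed.

Lemma change_field i j z : Om_overlap HM D_open i j z ->
  Vbar (Uc j) (uc j) (lc j) (change i j z) =
  pd (Vbar (Uc i) (uc i) (lc i) z) (change i j) z.
Proof.
move=> Oz; have [iz jz Dz zE] := Om_overlapP Oz.
rewrite (pd_change _ Oz) /Vbar row_mxKl row_mxKr push_opp //.
rewrite /Uc /uc /lc (point_change Oz).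
by rewrite (Ut_family.1 (point_at i z).1 i j _ Dz iz jz).
Qed.

Lemma overlap_coords i j q : dom i q.2 -> dom j q.2 -> D q -> Om_overlap HM D_open i j (coords i q).
Proof. by move=> iq jq Dq; apply: chart_domain_coords. Qed.

Lemma change_coords i j q : dom i q.2 -> change i j (coords i q) = coords j q.
Proof. by move=> iq; rewrite /change (coordsK HM). Qed.

Local Notation par i := (parallel_at (Gc i) (Uc i) (uc i) (lc i)).

(** The four defects are not compared one by one: [parallel_VbarP] turns them into the vanishing of
    the covariant derivative of V, which the chart change, an isometry carrying V to V,
    preserves. *)
Lemma parallel_change i j q : dom i q.2 -> dom j q.2 -> D q ->
  par i (coords i q) -> par j (coords j q).
Proof.
move=> iq jq Dq pz; have Oz := overlap_coords iq jq Dq.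
have P i' z (Oz : O i' z) := parallel_VbarP (@Gc_an i') (@Uc_an i') (@uc_an i') (@lc_an i')
  (@Gc_sym i') (@Gc_unit i') (@lc_neq0 i') Oz.
have sub z : Om_overlap HM D_open i j z -> O i z by exact: Om_overlap_sub.
have dO z : Om_overlap HM D_open i j z -> O j (change i j z) by exact: Om_change.
have resm a b (F : Z -> 'M[R]_(a, b)) : anm (O i) F -> anm (Om_overlap HM D_open i j) F.
  by move=> Fa k k' z /sub; exact: Fa.
rewrite -(change_coords j iq); apply/(P j _ (dO _ Oz)).
have ga i' := Gbar_an (@Gc_an i') (@lc_an i').
have Va i' := Vbar_an (@Uc_an i') (@uc_an i') (@lc_an i') (@lc_neq0 i').
apply: (parallel_natural (@change_an _ _ _ _ HM _ D_open i j) (resm _ _ _ (@ga i)) (@ga j)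
  (resm _ _ _ (@Va i)) (@Va j) _ _ _ dO (@change_isometry i j) (@change_field i j) Oz).
- by move=> z /sub Oz'; exact: (Gbar_unit (@Gc_unit i) (@lc_neq0 i) Oz').
- by move=> z Oz'; exact: (Gbar_unit (@Gc_unit j) (@lc_neq0 j) Oz').
- by move=> z Oz'; rewrite /Gbar tr_block_mx tr_scalar_mx !trmx0 (Gc_sym Oz').
- by apply/(P i _ (sub _ Oz)).
Qed.

Lemma spacetime_lorentzian : lorentzian_metric D gbar.
Proof.
split=> [i j q v w Dq iq jq|i q Dq iq].
  have Oz := overlap_coords iq jq Dq; have := change_isometry v w Oz.
  rewrite change_coords // /Gbar /Gc /lc (coordsK HM iq) (coordsK HM jq) blE => <-.
  by rewrite !pdE.
have Dq' : slice D q.1 q.2 by case: q Dq iq.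
have [gsym gpos] := (gt_family.1 q.1).2 i q.2 Dq' iq.
split; first by rewrite /gbar tr_block_mx tr_scalar_mx !trmx0 gsym.
by apply: lorentz_basis => //; rewrite gt_eqF.
Qed.

Lemma spacetime_vector : vector_field D V.
Proof.
move=> i j q Dq iq jq; have Oz := overlap_coords iq jq Dq.
have := change_field Oz.
by rewrite change_coords // /Vbar /Uc /uc /lc (coordsK HM iq) (coordsK HM jq) /push pdE.
Qed.

Lemma spacetime_analytic : analytic_components D gbar /\ analytic_components D V.
Proof.
split=> i k k' z /(chart_domainE HM i D) Oz; apply/analytic_atE.
  have ga : anm (O i) _ := Gbar_an (@Gc_an i) (@lc_an i).
  exact: (ga k k' z Oz).
have Va : anm (O i) _ := Vbar_an (@Uc_an i) (@uc_an i) (@lc_an i) (@lc_neq0 i).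
exact: (Va k k' z Oz).
Qed.

Lemma near_slice_chart i q : dom i q.2 -> D q -> \forall x \near q, dom i x.2 /\ D x.
Proof.
move=> iq Dq; have := @chart_overlap_open _ _ _ _ HM _ D_open i.
rewrite openE => /(_ q) H; have {}H : nbhs q (D `&` [set q | dom i q.2]) by exact: H.
by apply: filterS H => x [].
Qed.

(** Asking for all charts at all nearby points gives a condition on the cylinder itself, and an open
    one, as a connectedness argument requires. *)
Definition parallel_around q := \forall x \near q, forall i, dom i x.2 -> par i (coords i x).

Lemma parallel_around_of_chart i q : dom i q.2 -> D q ->
  (\forall y \near coords i q, par i y) -> parallel_around q.
Proof.
move=> iq Dq nz.
have nq : \forall x \near q, par i (coords i x) := coords_cvg HM iq nz.
apply: filterS (filterI (near_slice_chart iq Dq) nq) => x [[ix Dx] px] j jx.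
exact: (parallel_change ix jx Dx px).
Qed.

Lemma parallel_around_chart i q : dom i q.2 -> D q -> parallel_around q ->
  \forall y \near coords i q, par i y.
Proof.
move=> iq Dq nq; have Oz := O_coords iq Dq.
have iz : img i (rsubmx (coords i q)) by have [] := Oz.
have nq' : nbhs (point_at i (coords i q))
    [set x | forall i, dom i x.2 -> par i (coords i x)] by rewrite (coordsK HM iq).
have nz := point_cvg HM iz nq'.
apply: filterS (filterI (Omega_near Oz) nz) => y [Oy /(_ i)].
by have [iy _ yE] := O_point Oy; rewrite yE; exact.
Qed.

(** On a connected set C inside D that joins q to some (0, p), the points with [parallel_around]
    form a subset that is nonempty by flatness at t = 0, open by definition, and closed by
    analyticity. *)
Lemma parallel_propagates : evolution_system gt Ut ut lambda D ->
  (forall p, D (0, p)) ->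
  (forall q, D q -> exists p, connected_component D q (0, p)) ->
  (forall i p, dom i p -> par i (coords i (0, p))) ->
  parallel D gbar V.
Proof.
move=> /evolutionE ev D0 Dcomp init.
have around0 p : parallel_around (0, p).
  have [i ip] := dom_cover HM p.
  apply: (@parallel_around_of_chart i) => //.
  apply: (parallel_near_slice (@Gc_an i) (@Uc_an i) (@uc_an i) (@lc_an i)
    (@Gc_sym i) (@Gc_unit i) (@uc_neq0 i) (@lc_neq0 i) (ev i)).
  - move=> z Oz z0; have [iz _ zE] := O_point Oz.
    have := init i _ iz; rewrite (_ : (0, _) = point_at i z) ?zE //.
    by rewrite /point_at mxE (_ : z 0 _ = 0).
  - exact: (@O_coords i (0, p)).
  - exact: pt_time0.
have around_closed q : D q -> closure parallel_around q -> parallel_around q.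
  move=> Dq cq; have [i iq] := dom_cover HM q.2.
  apply: (@parallel_around_of_chart i) => //.
  apply: (parallel_closure (@Gc_an i) (@Uc_an i) (@uc_an i) (@lc_an i)
    (@Gc_sym i) (@Gc_unit i) (@lc_neq0 i)); first exact: O_coords.
  move=> N Nz; have nq := coords_cvg HM iq Nz.
  have [x [px [[ix Dx] Nx]]] := cq _ (filterI (near_slice_chart iq Dq) nq).
  by exists (coords i x) => //; exact: parallel_around_chart.
have around q : D q -> parallel_around q.
  move=> Dq; have [p [C [Cq CD Cc] C0]] := Dcomp q Dq.
  (* Connectedness is applied to a subset given as the trace on C of an interior and of a closure;
     the closure adds no point of C, since C lies in D and [around_closed] holds there. *)
  have CE : C `&` parallel_around = C.
    apply: Cc.
    - by exists (0, p); split.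
    - exists (interior [set x | forall i, dom i x.2 -> par i (coords i x)]) => //.
      exact: open_interior.
    - exists (closure parallel_around); first exact: closed_closure.
      apply/seteqP; split=> x [Cx ax]; split => //; first exact: subset_closure.
      by apply: around_closed => //; exact: CD.
  by have [] : (C `&` parallel_around) q by rewrite CE.
apply/parallelE => i z Oz; have [iz Dz zE] := O_point Oz.
by have /nbhs_singleton /(_ i iz) := around _ Dz; rewrite zE.
Qed.

End Families.

(** * The defects on the initial slice *)

Lemma nabla_near_eq (R : realType) (n : nat) (g g' : 'rV[R]_n -> 'M[R]_n)
    (Y Y' : 'rV[R]_n -> 'rV[R]_n) v x :
  (\forall y \near x, g y = g' y) -> (\forall y \near x, Y y = Y' y) ->
  nabla g (cst v) Y x = nabla g' (cst v) Y' x.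
Proof.
move=> gg YY; have Yx := nbhs_singleton YY.
rewrite /nabla /cst Yx; congr (_ + _); first exact: near_eq_derive.
rewrite /christoffel (nbhs_singleton gg); congr (_ *m _); apply/rowP => k.
rewrite !mxE; congr (_ * (_ + _ - _)); apply: near_eq_derive;
  by apply: filterS gg => y ->.
Qed.

Section InitialSlice.
Context (R : realType) (n : nat) (Omega : open_domain R (1 + n)).
Local Notation Z := 'rV[R]_(1 + n).
Local Notation E := 'rV[R]_n.
Context (G : Z -> 'M[R]_n) (U : Z -> E) (u l : Z -> R).
Hypothesis Ga : anm Omega G.
Hypothesis Gsym : forall z, Omega z -> (G z)^T = G z.
Hypothesis Gunit : forall z, Omega z -> G z \in unitmx.
Hypothesis u0 : forall z, Omega z -> u z != 0.
Hypothesis l0 : forall z, Omega z -> l z != 0.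

Lemma S_mulmx z : Omega z -> S G z *m G z = Gd G z.
Proof.
move=> Oz; rewrite /S /sharp trmx_mul trmx_inv (Gsym Oz) (Gd_sym Ga Gsym Oz).
by rewrite mulmxKV // Gunit.
Qed.

(** The constraint N = -u W turns A into -u W - (u / 2 lambda) S, so A = 0 means S = -2 lambda W,
    that is, g' = -2 lambda II. Given this, B vanishes by the formula for du, while C = 0 and c = 0
    become the prescribed U' and u'. *)
Lemma parallel_at_velocities z (W : 'M[R]_n) : Omega z ->
  (forall v, nablaU G U z v + u z *: (v *m W) = 0) ->
  (forall v, pd (sp v) u z = - bl (G z) (v *m W) (U z)) ->
  parallel_at G U u l z <->
  [/\ Gd G z = - 2 * l z *: (W *m G z),
      pd (et R n) U z = u z *: L G l z + l z *: (U z *m W) &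
      pd (et R n) u z = pd (sp (U z)) l z].
Proof.
move=> Oz NW du.
have NE : NM G U z = - u z *: W.
  apply/row_matrixP => k; rewrite rowK rowE -scalemxAr.
  by apply/eqP; rewrite scaleNr -addr_eq0 NW.
have lz := l0 Oz; have uz := u0 Oz.
have SEW : S G z = (- 2 * l z) *: W -> [/\ AM G U u l z = 0,
    forall v, Bd G U u l z v = 0 & Cd G U u l z =
      pd (et R n) U z - (u z *: L G l z + l z *: (U z *m W))].
  move=> Sz; split.
  - rewrite /AM NE Sz scalerA -scalerBl (_ : _ - _ = 0) ?scale0r //.
    by field.
  - move=> v; rewrite /Bd du -(SE Ga Gsym Gunit) // Sz -scalemxAr bilZl.
    by field.
  - rewrite /Cd Sz -scalemxAr scalerA [in RHS]opprD addrA; congr (_ + _).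
    by rewrite -scaleNr; congr (_ *: _); field.
have SEG : S G z = (- 2 * l z) *: W <-> Gd G z = - 2 * l z *: (W *m G z).
  rewrite -S_mulmx // scalemxAl; split=> [->//|SG].
  by rewrite -(mulmxK (Gunit Oz) (S G z)) SG mulmxK // Gunit.
split=> [[A0 B0 c0 C0]|[/SEG /SEW [A0 B0 C0] Ud ud]]; last first.
  by split=> //; [rewrite /cd ud subrr|rewrite C0 Ud subrr].
have Sz : S G z = (- 2 * l z) *: W.
  move: A0; rewrite /AM NE => /eqP; rewrite subr_eq0 => /eqP.
  move=> /(congr1 (fun X => (2 * l z / u z) *: X)); rewrite !scalerA.
  rewrite (_ : 2 * l z / u z * (u z / (2 * l z)) = 1); last by field; rewrite lz.
  by rewrite scale1r => <-; congr (_ *: _); field.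
have [_ _ CE] := SEW Sz; split; first exact/SEG.
  by apply/eqP; rewrite -subr_eq0 -CE C0.
by apply/eqP; rewrite -subr_eq0; apply/eqP; exact: c0.
Qed.

End InitialSlice.

Section Velocities.
Context (R : realType) (n : nat) (M : topologicalType) (A : atlas R n M).
Hypothesis HM : analytic_manifold A.
Context (g W : chart A -> M -> 'M[R]_n) (U : chart A -> M -> 'rV[R]_n) (u : M -> R).
Hypothesis u_sqr : forall i p, dom i p -> u p ^+ 2 = bil (g i p) (U i p) (U i p).
Hypothesis constraint : forall (i : chart A) p (X : 'rV[R]_n), dom i p ->
  nabla (local g i) (cst X) (local U i) (chart_map i p) + u p *: (X *m W i p) = 0.
Context (lambda : R * M -> R) (lambda_gt0 : forall q : R * M, 0 < lambda q).
Hypothesis lambda_analytic : analytic_function (cylinder A) setT lambda.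
Context (D : set (R * M)) (D_open : open D) (D_nbhd : forall p, D (0, p)).
Context (gt : R -> chart A -> M -> 'M[R]_n) (Ut : R -> chart A -> M -> 'rV[R]_n).
Context (ut : R * M -> R).
Hypothesis gt_family : metric_family D gt.
Hypothesis Ut_family : vector_family D Ut.
Hypothesis ut_family : positive_family A D ut.
Hypothesis initial : initial_values gt Ut ut g U u.

(** The constraint concerns g and U on M, the defects the families on the cylinder. The initial
    values identify both near each point of t = 0, which suffices for spatial derivatives. *)
Lemma initial_velocitiesP : initial_velocities gt Ut ut lambda g W U u <->
  forall (i : chart A) p, dom i p ->
    parallel_at (Gc gt i) (Uc Ut i) (uc ut i) (lc lambda i) (coords i (0, p)).
Proof.
suff P (i : chart A) p : dom i p ->
    parallel_at (Gc gt i) (Uc Ut i) (uc ut i) (lc lambda i) (coords i (0, p)) <->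
    (let lambda0 := fun y => lambda (0, chart_inv i y) in
    derive1 (fun s => gt s i p) 0 = - 2 * lambda (0, p) *: (W i p *m g i p) /\
    derive1 (fun s => Ut s i p) 0 =
      u p *: grad (local g i) lambda0 (chart_map i p)
      + lambda (0, p) *: (U i p *m W i p) /\
    derive1 (fun s => ut (s, p)) 0 = 'D_(U i p) lambda0 (chart_map i p)).
  by split=> h i p ip; apply/(P i p ip); exact: h.
move=> ip; set x := chart_map i p.
pose Omega := Om HM D_open i.
have Oz : Omega (coords i (0, p)) by exact: O_coords.
change (coords i (0, p)) with (pt 0 x) in *.
have ptE t y : point_at i (pt t y) = (t, chart_inv i y).
  by rewrite /point_at /pt row_mxKl row_mxKr mxE eqxx mulr1n.
have xK : chart_inv i x = p by exact: chart_mapK.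
have [g0 [U0 u0]] := initial ip.
have GE : Gc gt i (pt 0 x) = g i p by rewrite /Gc ptE xK g0.
have UE : Uc Ut i (pt 0 x) = U i p by rewrite /Uc ptE xK U0.
have uE : uc ut i (pt 0 x) = u p by rewrite /uc ptE xK u0.
have lE : lc lambda i (pt 0 x) = lambda (0, p) by rewrite /lc ptE xK.
have Ga : anm Omega (Gc gt i) by exact: Gc_an.
have Ua : anm Omega (Uc Ut i) by exact: Uc_an.
have ua : an Omega (uc ut i) by exact: uc_an.
have la : an Omega (lc lambda i) by exact: lc_an.
have Gsym z : Omega z -> (Gc gt i z)^T = Gc gt i z by exact: Gc_sym.
have Gunit z : Omega z -> Gc gt i z \in unitmx by exact: Gc_unit.
have un0 z : Omega z -> uc ut i z != 0 by exact: uc_neq0.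
have ln0 z : Omega z -> lc lambda i z != 0 by exact: lc_neq0.
have nx : \forall y \near x, dom i (chart_inv i y).
  have oi : nbhs x (img i).
    by apply: open_nbhs_nbhs; split; [exact: image_open|exists p].
  by apply: filterS oi => y [q iq <-]; rewrite (chart_mapK HM).
have gE : \forall y \near x, local g i y = Gc gt i (pt 0 y).
  by apply: filterS nx => y iy; rewrite /Gc ptE; have [-> _] := initial iy.
have UcE : \forall y \near x, local U i y = Uc Ut i (pt 0 y).
  by apply: filterS nx => y iy; rewrite /Uc ptE; have [_ [-> _]] := initial iy.
have NW v : nablaU (Gc gt i) (Uc Ut i) (pt 0 x) v
    + uc ut i (pt 0 x) *: (v *m W i p) = 0.
  rewrite uE -[RHS](constraint v ip); congr (_ + _).
  rewrite (nabla_near_eq v gE UcE).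
  exact: (esym (nabla_slice Ga (cst v) (Uc Ut i) Oz)).
have du v : pd (sp v) (uc ut i) (pt 0 x) =
    - bl (Gc gt i (pt 0 x)) (v *m W i p) (Uc Ut i (pt 0 x)).
  (* Half of u^2 = g(U, U) is differentiated along the slice; with the constraint this gives u du(v)
     = -u g(W v, U), and u is cancelled. *)
  apply: (mulfI (un0 _ Oz)).
  have := d_halfnorm Ga Ua Gsym Gunit v Oz.
  rewrite -(derive_slice (halfnorm (Gc gt i) (Uc Ut i))).
  rewrite (_ : 'D_v _ x = 'D_v (fun y => 2^-1 * uc ut i (pt 0 y) ^+ 2) x); last first.
    apply: near_eq_derive; apply: filterS nx => y iy.
    have [gy [Uy uy]] := initial iy.
    by rewrite /halfnorm /uc /Uc /Gc ptE blE gy Uy uy -u_sqr.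
  rewrite (derive_slice (fun z => 2^-1 * uc ut i z ^+ 2)).
  rewrite (an_deriveM _ (an_cst _) (anX 2 ua) Oz) pd_cst mul0r add0r.
  rewrite (_ : (fun z => uc ut i z ^+ 2) = (fun z => uc ut i z * uc ut i z)) //.
  rewrite (an_deriveM _ ua ua Oz).
  have -> : nablaU (Gc gt i) (Uc Ut i) (pt 0 x) v = - (uc ut i (pt 0 x) *: (v *m W i p)).
    by apply/eqP; rewrite -addr_eq0 NW.
  rewrite bilNl bilZl => H; rewrite mulrN -H; by field.
have P := parallel_at_velocities Ga Gsym Gunit un0 ln0 Oz NW du.
have -> : derive1 (fun s => gt s i p) 0 = Gd (Gc gt i) (pt 0 x).
  rewrite /Gd -(derive1_slice (Gc gt i)); congr (derive1 _ 0).
  by apply/funext => s; rewrite /Gc ptE xK.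
have -> : derive1 (fun s => Ut s i p) 0 = pd (et R n) (Uc Ut i) (pt 0 x).
  rewrite -(derive1_slice (Uc Ut i)); congr (derive1 _ 0).
  by apply/funext => s; rewrite /Uc ptE xK.
have -> : derive1 (fun s => ut (s, p)) 0 = pd (et R n) (uc ut i) (pt 0 x).
  rewrite -(derive1_slice (uc ut i)); congr (derive1 _ 0).
  by apply/funext => s; rewrite /uc ptE xK.
have lamE : (fun y => lambda (0, chart_inv i y)) = (fun y => lc lambda i (pt 0 y)).
  by apply/funext => y; rewrite /lc ptE.
rewrite /= lamE (derive_slice (lc lambda i)).
have -> : grad (local g i) (fun y => lc lambda i (pt 0 y)) x
    = L (Gc gt i) (lc lambda i) (pt 0 x).
  by rewrite -grad_slice /grad (nbhs_singleton gE).
rewrite -GE -UE -uE -lE.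
by split=> [/P [h1 h2 h3]|[h1 [h2 h3]]]; [split|apply/P; split].
Qed.

End Velocities.

Theorem theorem4p1 (R : realType) (n : nat) (M : topologicalType)
    (A : atlas R n M) (HM : analytic_manifold A)
    (g W : chart A -> M -> 'M[R]_n) (U : chart A -> M -> 'rV[R]_n) (u : M -> R)
    (g_metric : riemannian_metric setT g)
    (g_analytic : analytic_components setT g)
    (W_endo : endomorphism setT W) (W_analytic : analytic_components setT W)
    (W_sym : forall (i : chart A) (p : M) (X Y : 'rV[R]_n), dom i p ->
       bil (g i p) (X *m W i p) Y = bil (g i p) X (Y *m W i p))
    (U_field : vector_field setT U) (U_analytic : analytic_components setT U)
    (U_neq0 : forall (i : chart A) (p : M), dom i p -> U i p != 0)
    (u_gt0 : forall p : M, 0 < u p)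
    (u_sqr : forall (i : chart A) (p : M), dom i p ->
       u p ^+ 2 = bil (g i p) (U i p) (U i p))
    (constraint : forall (i : chart A) (p : M) (X : 'rV[R]_n), dom i p ->
       nabla (local g i) (cst X) (local U i) (chart_map i p)
       + u p *: (X *m W i p) = 0)
    (lambda : R * M -> R) (lambda_gt0 : forall q : R * M, 0 < lambda q)
    (lambda_analytic : analytic_function (cylinder A) setT lambda)
    (Ubar : set (R * M)) (Ubar_open : open Ubar)
    (Ubar_nbhd : forall p : M, Ubar (0, p))
    (Ubar_components : forall q : R * M, Ubar q ->
       exists p : M, connected_component Ubar q (0, p))
    (gt : R -> chart A -> M -> 'M[R]_n) (Ut : R -> chart A -> M -> 'rV[R]_n)
    (ut : R * M -> R)
    (gt_family : metric_family Ubar gt) (Ut_family : vector_family Ubar Ut)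
    (ut_family : positive_family A Ubar ut)
    (initial : initial_values gt Ut ut g U u) :
  let gbar := spacetime_metric lambda gt in
  let V := spacetime_field lambda ut Ut in
  (lorentzian_metric Ubar gbar /\ analytic_components Ubar gbar /\
   vector_field Ubar V /\ analytic_components Ubar V /\
   parallel Ubar gbar V)
  <->
  (evolution_system gt Ut ut lambda Ubar /\
   initial_values gt Ut ut g U u /\
   initial_velocities gt Ut ut lambda g W U u).
Proof.
move=> gbar V.
have velP := initial_velocitiesP HM u_sqr constraint lambda_gt0 lambda_analytic
  Ubar_open Ubar_nbhd gt_family Ut_family ut_family initial.
have parP := parallelE HM lambda_gt0 lambda_analytic Ubar_open
  gt_family Ut_family ut_family.
have evP := evolutionE HM lambda_gt0 lambda_analytic Ubar_open ut
  gt_family Ut_family.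
split=> [[_ [_ [_ [_ /parP par]]]]|[ev [_ vel]]].
  split; [apply/evP => i z Oz|split => //; apply/velP => i p ip].
    apply: (evolution_of_parallel (Omega := Om HM Ubar_open i)) Oz; last exact: par.
    - exact: Gc_an.
    - exact: Uc_an.
    - exact: uc_an.
    - exact: lc_an.
    - exact: Gc_sym.
    - exact: Gc_unit.
    - exact: uc_neq0.
    - exact: lc_neq0.
  by apply: par; exact: O_coords.
have [gbar_an V_an] := spacetime_analytic HM lambda_gt0 lambda_analytic Ubar_open
  gt_family Ut_family ut_family.
split; first exact: spacetime_lorentzian.
split=> //; split; first exact: spacetime_vector.
split=> //; apply: parallel_propagates => //.
exact/velP.
Qed.
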